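(* Let $f_1,f_2,f_3,f_4:\mathbb{R}\to\mathbb{R}$ be quadratic functions as in the context (so that $x_1^\epsilon x_2^\epsilon x_3^\epsilon x_4^\epsilon$ is a convex quadrilateral with vertices in counterclockwise order), and let $w_\epsilon$, $z_{4,\epsilon}$ and the gradient tree $I$ be as in the context. Let $\delta>0$ be a real number such that $D_{z_{4,\epsilon}}(\delta)\cap D_{z_j}(\delta)=\emptyset$ for all sufficiently small $\epsilon>0$ and $j=1,2,3$. Let $p_0\in\mathbb{R}$ be one of $p_1,p_2,p_3,p_4$ whose Morse index is zero. Let $I_i$ be the restriction of $I$ to the external edge $e_i$. If $(p_3-p_1)(p_4-p_2)=0$, then $$\lim_{\epsilon\to+0}\ \sup_{z\in D_\epsilon(\delta)}\left|w_\epsilon(z)-p_0\right|=0,$$ $$\lim_{\epsilon\to+0}\ \sup_{(\tau,\sigma)\in\Theta_{ext}}\left|w_\epsilon\circ\phi_{z_i,\delta}(\tau,\sigma)-I_i(\epsilon\tau)\right|=0\qquad(i=1,2,3,4).$$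
   Context: **Lines and quadrilateral.** Indices are mod $4$. $f_i$ is a real quadratic polynomial with $f_i'(x)=a_ix+b_i$ ($a_i,b_i\in\mathbb{R}$, $i=1,\dots,4$). For $\epsilon>0$ let $L_i^\epsilon=\operatorname{graph}(\epsilon\,df_i)=\{(x,y)\in\mathbb{R}^2: y=\epsilon(a_ix+b_i)\}\subset T^*\mathbb{R}\simeq\mathbb{R}^2\simeq\mathbb{C}$ (with $(x,y)\mapsto x+iy$). Assume $a_i\ne a_{i+1}$ for all $i$; let $x_i^\epsilon$ be the intersection point of $L_i^\epsilon$ and $L_{i+1}^\epsilon$, and $p_i\in\mathbb{R}$ its first coordinate (independent of $\epsilon$), i.e. the critical point of $f_{i+1}-f_i$. Standing assumption: $x_1^\epsilon,x_2^\epsilon,x_3^\epsilon,x_4^\epsilon$ are, in counterclockwise order, the vertices of a (nondegenerate) convex quadrilateral (this does not depend on $\epsilon$). The Morse index of $p_i$ means its index as a critical point of $f_{i+1}-f_i$ (zero iff $a_{i+1}>a_i$). **Holomorphic disk.** $\mathbb{H}$ is the open upper half plane, $\overline{\mathbb{H}}$ its closure. $w_\epsilon$ is the Schwarz–Christoffel map, i.e. the conformal map of $\mathbb{H}$ onto the interior of the quadrilateral $x_1^\epsilon x_2^\epsilon x_3^\epsilon x_4^\epsilon$, extended continuously to the boundary, with $w_\epsilon(1)=x_1^\epsilon$, $w_\epsilon(\infty)=x_2^\epsilon$, $w_\epsilon(0)=x_3^\epsilon$; $z_{4,\epsilon}\in(0,1)$ is the point with $w_\epsilon(z_{4,\epsilon})=x_4^\epsilon$.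 Put $z_1=1$, $z_2=\infty$, $z_3=0$, $z_4=z_{4,\epsilon}$. **Gradient tree.** A gradient tree for $(f_1,\dots,f_4)$ consists of a real number $l\ge0$ (length of the internal edge) and curves $I_i:(-\infty,0]\to\mathbb{R}$ (restriction to the external edge $e_i$), $i=1,\dots,4$, with $\frac{dI_i}{dt}=-(f_{i+1}-f_i)'(I_i)$, $\lim_{t\to-\infty}I_i(t)=p_i$, such that one of the following holds: (a) $l=0$ and $I_1(0)=I_2(0)=I_3(0)=I_4(0)$; (b) $l>0$ and there is $I_{int}:[0,l]\to\mathbb{R}$ with $\frac{dI_{int}}{dt}=-(f_3-f_1)'(I_{int})$, $I_{int}(0)=I_1(0)=I_2(0)$, $I_{int}(l)=I_3(0)=I_4(0)$; (c) $l>0$ and there is $I_{int}:[0,l]\to\mathbb{R}$ with $\frac{dI_{int}}{dt}=-(f_4-f_2)'(I_{int})$, $I_{int}(0)=I_2(0)=I_3(0)$, $I_{int}(l)=I_4(0)=I_1(0)$. It is known that under the standing assumption there is exactly one gradient tree, denoted $I$, of type (b) if $(p_3-p_1)(p_4-p_2)>0$, type (c) if $(p_3-p_1)(p_4-p_2)<0$, type (a) if $(p_3-p_1)(p_4-p_2)=0$. **Regions and maps.** For $\delta>0$: $D_p(\delta)=\{z\in\overline{\mathbb{H}}:|z-p|<\delta\}$ for $p\in\mathbb{R}$, $D_\infty(\delta)=\{z\in\overline{\mathbb{H}}:|z|^{-1}<\delta\}$, and $$D_\epsilon(\delta)=\overline{\mathbb{H}}\setminus\left(D_{z_3}(\delta)\cup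 D_{z_{4,\epsilon}}(\delta)\cup D_{z_1}(\delta)\cup D_{z_2}(\delta)\right).$$ $\Theta_{ext}=(-\infty,0)\times[0,1]$. For $(\tau,\sigma)\in\Theta_{ext}$: $\phi_{p,\delta}(\tau,\sigma)=p+\delta\exp[\pi(\tau+i\sigma)]$ for $p\in\mathbb{R}$, and $\phi_{\infty,\delta}(\tau,\sigma)=-\delta^{-1}\exp[-\pi(\tau+i\sigma)]$. *)

(* Defs.v *)
From Stdlib Require Import Reals.
From Coquelicot Require Import Coquelicot.
Open Scope R_scope.

(** Indices modulo 4. *)
Inductive idx : Set := i1 | i2 | i3 | i4.

Definition nxt (i : idx) : idx :=
  match i with i1 => i2 | i2 => i3 | i3 => i4 | i4 => i1 end.

(** ** Lines and quadrilaterals *)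

Definition dfun (f : idx -> R -> R) (i j : idx) : R -> R :=
  fun x => f j x - f i x.

(** The graph of [eps * df] in T^*R, identified with C by (x,y) |-> x + iy. *)
Definition lagr (f : R -> R) (eps : R) (z : C) : Prop :=
  Im z = eps * Derive f (Re z).

(** Number of negative eigenvalues of the (1 x 1) Hessian of [g] at [q];
    [q] is meant to be a nondegenerate critical point. *)
Definition morse_index (g : R -> R) (q : R) : nat :=
  if Rlt_dec (Derive_n g 2 q) 0 then 1%nat else 0%nat.

(** Positive iff [w] lies strictly to the left of the oriented line from
    [u] to [v]. *)
Definition orient (u v w : C) : R :=
  (Re v - Re u) * (Im w - Im u) - (Im v - Im u) * (Re w - Re u).

(** The points x_1, x_2, x_3, x_4 are, in counterclockwise order, the vertices
    of a nondegenerate convex quadrilateral: for each side, the two other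
    vertices lie strictly to its left. *)
Definition ccw_convex (x : idx -> C) : Prop :=
  forall i j, j <> i -> j <> nxt i -> 0 < orient (x i) (x (nxt i)) (x j).

Definition quadrilateral (x : idx -> C) (z : C) : Prop :=
  exists t1 t2 t3 t4 : R,
    0 <= t1 /\ 0 <= t2 /\ 0 <= t3 /\ 0 <= t4 /\ t1 + t2 + t3 + t4 = 1 /\
    z = (t1 * x i1 + t2 * x i2 + t3 * x i3 + t4 * x i4)%C.

Definition interior (S : C -> Prop) (z : C) : Prop := locally z S.

(** ** The Schwarz-Christoffel map *)

Definition HH (z : C) : Prop := 0 < Im z.
Definition HHbar (z : C) : Prop := 0 <= Im z.

(** Neighbourhoods of infinity in C. *)
Definition C_at_infinity (P : C -> Prop) : Prop :=
  exists M : R, forall z : C, M < Cmod z -> P z.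

(** [w] restricts to a bijective holomorphic map from the open upper half plane
    onto [U]. *)
Definition conformal_onto (w : C -> C) (U : C -> Prop) : Prop :=
  (forall z, HH z -> ex_derive (K := C_AbsRing) (V := C_NormedModule) w z) /\
  (forall z z', HH z -> HH z' -> w z = w z' -> z = z') /\
  (forall u, U u <-> exists z, HH z /\ w z = u).

(** The values of [w] outside [HHbar] are irrelevant; w(infinity) is the limit
    of [w] at infinity within [HHbar]. *)
Definition schwarz_christoffel (x : idx -> C) (w : C -> C) (z4 : R) : Prop :=
  conformal_onto w (interior (quadrilateral x)) /\
  (forall z, HHbar z -> filterlim w (within HHbar (locally z)) (locally (w z))) /\
  w (RtoC 1) = x i1 /\
  filterlim w (within HHbar C_at_infinity) (locally (x i2)) /\
  w (RtoC 0) = x i3 /\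
  0 < z4 < 1 /\ w (RtoC z4) = x i4.

(** ** Gradient trees *)

(** Derivative at [t] of [g], regarded as a function on [S] only (one-sided at
    an endpoint of an interval). *)
Definition is_derive_in (S : R -> Prop) (g : R -> R) (t v : R) : Prop :=
  filterdiff g (within S (locally t)) (fun h => scal h v).

Definition neg_grad_curve (g : R -> R) (S : R -> Prop) (c : R -> R) : Prop :=
  forall t, S t -> is_derive_in S c t (- Derive g (c t)).

(** [l] is the length of the internal edge and [I i] the restriction of the
    tree to the i-th external edge, of which only the values on (-oo, 0] matter. *)
Definition gradient_tree (f : idx -> R -> R) (p : idx -> R)
    (l : R) (I : idx -> R -> R) : Prop :=
  0 <= l /\
  (forall i, neg_grad_curve (dfun f i (nxt i)) (fun t => t <= 0) (I i) /\
             is_lim (I i) m_infty (p i)) /\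
  ( (l = 0 /\ I i1 0 = I i2 0 /\ I i2 0 = I i3 0 /\ I i3 0 = I i4 0)
  \/
    (0 < l /\ exists Iint : R -> R,
       neg_grad_curve (dfun f i1 i3) (fun t => 0 <= t <= l) Iint /\
       Iint 0 = I i1 0 /\ Iint 0 = I i2 0 /\
       Iint l = I i3 0 /\ Iint l = I i4 0)
  \/
    (0 < l /\ exists Iint : R -> R,
       neg_grad_curve (dfun f i2 i4) (fun t => 0 <= t <= l) Iint /\
       Iint 0 = I i2 0 /\ Iint 0 = I i3 0 /\
       Iint l = I i4 0 /\ Iint l = I i1 0)).

(** ** Regions and strip-like ends *)

(** Points of the boundary of the half plane, infinity included. *)
Inductive bpoint : Set := Bfin (r : R) | Binf.

Definition zpt (z4 : R) (i : idx) : bpoint :=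
  match i with i1 => Bfin 1 | i2 => Binf | i3 => Bfin 0 | i4 => Bfin z4 end.

(** [z <> 0] is needed because |z|^{-1} is to be read as +oo at 0. *)
Definition Dnear (q : bpoint) (delta : R) (z : C) : Prop :=
  HHbar z /\
  match q with
  | Bfin r => Cmod (z - RtoC r)%C < delta
  | Binf => z <> RtoC 0 /\ / Cmod z < delta
  end.

Definition Dthick (z4 delta : R) (z : C) : Prop :=
  HHbar z /\ forall i, ~ Dnear (zpt z4 i) delta z.

Definition Theta_ext (tau sigma : R) : Prop := tau < 0 /\ 0 <= sigma <= 1.

(** exp (x + iy) *)
Definition cexp (z : C) : C := (exp (Re z) * cos (Im z), exp (Re z) * sin (Im z)).

Definition phi (q : bpoint) (delta tau sigma : R) : C :=
  match q with
  | Bfin r => (r + delta * cexp (PI * (tau + Ci * sigma)))%C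
  | Binf => (- (/ delta * cexp (- (PI * (tau + Ci * sigma)))))%C
  end.

(** [sup (E eps)] tends to [l] as [eps] tends to 0 from the right; the supremum
    is required to exist as a real number for all small [eps > 0]. *)
Definition sup_tends_to (E : R -> R -> Prop) (l : R) : Prop :=
  exists s : R -> R,
    at_right 0 (fun eps => is_lub (E eps) (s eps)) /\
    filterlim s (at_right 0) (locally l).

(* Main.v *)
(** Put [g = w_eps]. The quadrilateral has height [O(eps)], so [Im g = O(eps)], and on the boundary arc that is mapped to the line with index [k] the function [Im g - eps (a k * Re g + b k)], which is the imaginary part of [(1 - i eps a k) g - i eps b k], vanishes. The Borel-Caratheodory inequality in the interior and a barrier near the arcs give [|g'| <= K eps / d], where [d] is the distance to the marked points [0], [z4], [1]. Hence [g] varies by [O(eps)] on the thick part and on every half circle about a marked point.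

In the strip coordinate [s + i t] at the [i]-th end, Cauchy's theorem shows that the average [m] of [Re g - p i] over a cross-section satisfies [m' = eps (a i - a (nxt i)) / PI * m + O(eps^2)] for [s <= 0]. If the Morse index is zero, boundedness at [-oo] forces [m = O(eps)]; this identifies the value of [g] on the thick part as [p i0]. Otherwise [m] is [O(eps)]-close to the exponential with the same value at [s = 0], that is, to an edge of the gradient tree: in the degenerate case two opposite [p i] of index zero coincide, their edges are constant, and so all edges end at [p i0].

That [g] maps each arc into the expected line is deduced from injectivity. If the boundary values run across a point of a side on some arc, then [g] attains near this arc all values close to that point, so a side can be crossed only once; since each of the four arcs joins two consecutive vertices, the [k]-th arc runs along the [k]-th side. *)

Require Import Defs.
From Stdlib Require Import Reals Lra Lia Psatz Classical ClassicalEpsilon Ranalysis5.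
From Coquelicot Require Import Coquelicot.
Open Scope R_scope.

(** * Continuity and complex differentiability *)

(** The obstacle is uniformity: [z4] moves with [eps], and the tree moves along the infinite strips
    on the scale [1 / eps]. Every constant therefore depends only on [delta], the slopes, the
    intercepts and the critical points; the position of [z4] enters only through [2 * delta <= z4]
    and [2 * delta <= 1 - z4], which disjointness gives. Integrating the equation for [m], whose
    rate is of order [eps], multiplies its error by a factor of order [1 / eps]; this is why the
    error has to be [O(eps^2)]. Two factors [eps] are available: on both edges of the strip the
    imaginary part is [eps] times an affine function of the real part, and the real part is within
    [O(eps)] of its average. The derivative bound is scale invariant: in the strip coordinate the
    factor [1 / d] is cancelled by the derivative of the exponential, so the bound is [O(eps)] along
    the whole strip. The complex analysis rests on Goursat's theorem for rectangles, read as an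
    identity of real integrals; the exponential turns circles into vertical segments, which gives
    mean values, then the maximum principle, and from it all further estimates. *)

Notation ccont := (@continuous C_UniformSpace C_UniformSpace).
Notation rcont := (@continuous C_UniformSpace R_UniformSpace).

Lemma Re_le_Cmod (z : C) : Rabs (Re z) <= Cmod z.
Proof. apply Rle_trans with (2 := Rmax_Cmod z), Rmax_l. Qed.

Lemma Im_le_Cmod (z : C) : Rabs (Im z) <= Cmod z.
Proof. apply Rle_trans with (2 := Rmax_Cmod z), Rmax_r. Qed.

Lemma Cmod_le_Re_Im (z : C) : Cmod z <= Rabs (Re z) + Rabs (Im z).
Proof.
  unfold Cmod. change (fst z) with (Re z). change (snd z) with (Im z).
  pose proof (Rabs_pos (Re z)). pose proof (Rabs_pos (Im z)).
  apply Rsqr_incr_0_var; [ | lra].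
  rewrite Rsqr_sqrt by nra. unfold Rsqr.
  rewrite <- (pow2_abs (Re z)), <- (pow2_abs (Im z)). nra.
Qed.

Lemma Re_minus_le (y z : C) : Rabs (Re y - Re z) <= Cmod (y - z).
Proof. exact (Re_le_Cmod (y - z)). Qed.

Lemma Im_minus_le (y z : C) : Rabs (Im y - Im z) <= Cmod (y - z).
Proof. exact (Im_le_Cmod (y - z)). Qed.

Lemma Cmod_minus_le (y z : C) : Cmod (y - z) <= Rabs (Re y - Re z) + Rabs (Im y - Im z).
Proof. exact (Cmod_le_Re_Im (y - z)). Qed.

Lemma Re_minus_RtoC_le (z : C) (m : R) : Rabs (Re z - m) <= Cmod (z - RtoC m).
Proof. exact (Re_minus_le z (RtoC m)). Qed.

Lemma Im_minus_RtoC_le (z : C) (m : R) : Rabs (Im z) <= Cmod (z - RtoC m).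
Proof. rewrite <- (Rminus_0_r (Im z)). exact (Im_minus_le z (RtoC m)). Qed.

Lemma Cmod_minus_RtoC_le (z : C) (m : R) : Cmod (z - RtoC m) <= Rabs (Re z - m) + Rabs (Im z).
Proof. rewrite <- (Rminus_0_r (Im z)). exact (Cmod_minus_le z (RtoC m)). Qed.

Lemma Cmod_sqr (z : C) : Cmod z * Cmod z = Re z * Re z + Im z * Im z.
Proof. unfold Cmod. rewrite sqrt_sqrt. unfold Re, Im. ring. nra. Qed.

Lemma Cmod_minus_sym (y z : C) : Cmod (y - z) = Cmod (z - y).
Proof. rewrite <- Cmod_opp. f_equal. ring. Qed.

Lemma Cmod_Ci : Cmod Ci = 1.
Proof. transitivity (sqrt 1). unfold Cmod, Ci; simpl. f_equal; ring. apply sqrt_1. Qed.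

Lemma Cmod_vertical (t y : R) : Cmod ((t, y) - (t, 0)) = Rabs y.
Proof.
  unfold Cmod. simpl. rewrite <- sqrt_Rsqr_abs. f_equal. unfold Rsqr. ring.
Qed.

Lemma pos_below2 (a b : R) : 0 < a -> 0 < b -> exists m, 0 < m /\ m <= a /\ m <= b.
Proof. exists (Rmin a b). split. now apply Rmin_pos. split. apply Rmin_l. apply Rmin_r. Qed.

Lemma pos_below4 (a b c d : R) : 0 < a -> 0 < b -> 0 < c -> 0 < d ->
  exists m, 0 < m /\ m <= a /\ m <= b /\ m <= c /\ m <= d.
Proof.
  intros Ha Hb Hc Hd. destruct (pos_below2 a b) as [m [M0 M]]; auto.
  destruct (pos_below2 c d) as [n [N0 N]]; auto. destruct (pos_below2 m n) as [k [K0 K]]; auto.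
  exists k. lra.
Qed.

Lemma C_eq (y z : C) : Re y = Re z -> Im y = Im z -> y = z.
Proof. destruct y, z; simpl; intros; subst; auto. Qed.

Lemma cont_Re (z : C) : rcont Re z.
Proof. destruct z; apply continuous_fst. Qed.

Lemma cont_Im (z : C) : rcont Im z.
Proof. destruct z; apply continuous_snd. Qed.

Section PairContinuity.
Context {U : UniformSpace}.

Lemma cont_pair (u v : U -> R) (z : U) :
  continuous u z -> continuous v z ->
  continuous (U := C_UniformSpace) (fun y => (u y, v y)) z.
Proof.
  intros Hu Hv.
  apply (continuous_comp_2 (V := R_UniformSpace) (W := R_UniformSpace) (X := C_UniformSpace)
    u v (fun a b => (a, b))); auto.
  apply continuous_ext with (f := fun p => p). now intros [? ?].
  apply continuous_id.
Qed.

Lemma cont_C (f : U -> C) (z : U) :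
  continuous (fun y => Re (f y)) z -> continuous (fun y => Im (f y)) z ->
  continuous (U := C_UniformSpace) f z.
Proof.
  intros Hu Hv.
  apply continuous_ext with (f := fun y => (Re (f y), Im (f y))).
  intros y. now destruct (f y). now apply cont_pair.
Qed.

Lemma cont_Re_comp (f : U -> C) (z : U) :
  continuous (U := C_UniformSpace) f z -> continuous (fun y => Re (f y)) z.
Proof. intros H. apply (continuous_comp f Re); auto. apply cont_Re. Qed.

Lemma cont_Im_comp (f : U -> C) (z : U) :
  continuous (U := C_UniformSpace) f z -> continuous (fun y => Im (f y)) z.
Proof. intros H. apply (continuous_comp f Im); auto. apply cont_Im. Qed.

Lemma cont_Rplus (u v : U -> R) (z : U) :
  continuous u z -> continuous v z -> continuous (fun y => u y + v y) z.
Proof. apply @continuous_plus. Qed.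

Lemma cont_Rminus (u v : U -> R) (z : U) :
  continuous u z -> continuous v z -> continuous (fun y => u y - v y) z.
Proof. apply @continuous_minus. Qed.

Lemma cont_Rmult (u v : U -> R) (z : U) :
  continuous u z -> continuous v z -> continuous (fun y => u y * v y) z.
Proof. apply (continuous_mult (K := R_AbsRing)). Qed.

Lemma cont_Rinv (u : U -> R) (z : U) :
  continuous u z -> u z <> 0 -> continuous (fun y => / u y) z.
Proof.
  intros Hu Hz. apply (continuous_comp u Rinv); auto.
  apply continuity_pt_filterlim, continuity_pt_inv; auto.
  apply continuity_pt_id.
Qed.

Lemma cont_Rabs (u : U -> R) (z : U) :
  continuous u z -> continuous (fun y => Rabs (u y)) z.
Proof.
  intros Hu. apply (continuous_comp u Rabs); auto.
  apply continuity_pt_filterlim, Rcontinuity_abs.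
Qed.

Lemma cont_plus (f g : U -> C) (z : U) :
  continuous (U := C_UniformSpace) f z -> continuous (U := C_UniformSpace) g z ->
  continuous (U := C_UniformSpace) (fun y => (f y + g y)%C) z.
Proof.
  intros Hf Hg. apply cont_C.
  - apply (cont_Rplus (fun y => Re (f y)) (fun y => Re (g y))); now apply cont_Re_comp.
  - apply (cont_Rplus (fun y => Im (f y)) (fun y => Im (g y))); now apply cont_Im_comp.
Qed.

Lemma cont_minus (f g : U -> C) (z : U) :
  continuous (U := C_UniformSpace) f z -> continuous (U := C_UniformSpace) g z ->
  continuous (U := C_UniformSpace) (fun y => (f y - g y)%C) z.
Proof.
  intros Hf Hg. apply cont_C.
  - apply (cont_Rminus (fun y => Re (f y)) (fun y => Re (g y))); now apply cont_Re_comp.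
  - apply (cont_Rminus (fun y => Im (f y)) (fun y => Im (g y))); now apply cont_Im_comp.
Qed.

Lemma cont_mult (f g : U -> C) (z : U) :
  continuous (U := C_UniformSpace) f z -> continuous (U := C_UniformSpace) g z ->
  continuous (U := C_UniformSpace) (fun y => (f y * g y)%C) z.
Proof.
  intros Hf Hg.
  assert (Rf := cont_Re_comp _ _ Hf). assert (If := cont_Im_comp _ _ Hf).
  assert (Rg := cont_Re_comp _ _ Hg). assert (Ig := cont_Im_comp _ _ Hg).
  apply cont_C.
  - apply (cont_Rminus (fun y => Re (f y) * Re (g y)) (fun y => Im (f y) * Im (g y)));
    [exact (cont_Rmult _ _ _ Rf Rg) | exact (cont_Rmult _ _ _ If Ig)].
  - apply (cont_Rplus (fun y => Re (f y) * Im (g y)) (fun y => Im (f y) * Re (g y)));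
    [exact (cont_Rmult _ _ _ Rf Ig) | exact (cont_Rmult _ _ _ If Rg)].
Qed.

Lemma cont_sqr_sum (f : U -> C) (z : U) :
  continuous (U := C_UniformSpace) f z -> continuous (fun y => Re (f y) ^ 2 + Im (f y) ^ 2) z.
Proof.
  intros Hf. assert (Hr := cont_Re_comp _ _ Hf). assert (Hi := cont_Im_comp _ _ Hf).
  apply (continuous_ext (fun y => Re (f y) * Re (f y) + Im (f y) * Im (f y))).
  intros y. rewrite <- !Rsqr_pow2. reflexivity.
  exact (cont_Rplus _ _ _ (cont_Rmult _ _ _ Hr Hr) (cont_Rmult _ _ _ Hi Hi)).
Qed.

Lemma Csqr_neq_0 (z : C) : z <> (RtoC 0) -> Re z ^ 2 + Im z ^ 2 <> 0.
Proof.
  intros H E. apply H. apply C_eq; simpl; nra.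
Qed.

Lemma cont_inv (f : U -> C) (z : U) :
  continuous (U := C_UniformSpace) f z -> f z <> (RtoC 0) ->
  continuous (U := C_UniformSpace) (fun y => (/ f y)%C) z.
Proof.
  intros Hf Hz. pose proof (Csqr_neq_0 _ Hz) as Hn.
  assert (Hr := cont_Re_comp _ _ Hf). assert (Hi := cont_Im_comp _ _ Hf).
  assert (Hs : continuous (fun y => / (Re (f y) ^ 2 + Im (f y) ^ 2)) z).
  { apply (cont_Rinv (fun y => Re (f y) ^ 2 + Im (f y) ^ 2)); auto. now apply cont_sqr_sum. }
  apply cont_C; simpl; apply cont_Rmult; auto.
  apply (continuous_opp (V := R_NormedModule) (fun y => Im (f y))); auto.
Qed.

Lemma cont_div (f g : U -> C) (z : U) :
  continuous (U := C_UniformSpace) f z -> continuous (U := C_UniformSpace) g z ->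
  g z <> (RtoC 0) ->
  continuous (U := C_UniformSpace) (fun y => (f y / g y)%C) z.
Proof. intros. apply cont_mult; auto. now apply cont_inv. Qed.

Lemma cont_cconst (c : C) (z : U) : continuous (U := C_UniformSpace) (fun _ => c) z.
Proof. apply continuous_const. Qed.

Lemma cont_Cmod (f : U -> C) (z : U) :
  continuous (U := C_UniformSpace) f z -> continuous (fun y => Cmod (f y)) z.
Proof.
  intros Hf.
  apply (continuous_comp (fun y => fst (f y) ^ 2 + snd (f y) ^ 2) sqrt).
  - exact (cont_sqr_sum f z Hf).
  - apply continuity_pt_filterlim, continuity_pt_sqrt. nra.
Qed.

Lemma cont_cexp (f : U -> C) (z : U) :
  continuous (U := C_UniformSpace) f z ->
  continuous (U := C_UniformSpace) (fun y => cexp (f y)) z.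
Proof.
  intros Hf.
  assert (He : continuous (fun y => exp (Re (f y))) z).
  { apply (continuous_comp (fun y => Re (f y)) exp). now apply cont_Re_comp.
    apply continuity_pt_filterlim, derivable_continuous_pt, derivable_pt_exp. }
  apply cont_C; simpl; apply cont_Rmult; auto.
  - apply (continuous_comp (fun y => Im (f y)) cos). now apply cont_Im_comp.
    apply continuity_pt_filterlim, continuity_cos.
  - apply (continuous_comp (fun y => Im (f y)) sin). now apply cont_Im_comp.
    apply continuity_pt_filterlim, continuity_sin.
Qed.

End PairContinuity.

(** The topology of [C] is that of a product, with squares as balls. Squares and disks about [z]
    contain each other after rescaling; the factor [2] comes from adding the two coordinates. *)
Lemma locally_C_Cmod (z : C) (P : C -> Prop) :
  locally z P <-> exists d, 0 < d /\ forall y, Cmod (y - z) < d -> P y.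
Proof.
  split.
  - intros [d Hd]. exists d. split. apply cond_pos.
    intros y Hy. apply Hd. apply C_NormedModule_mixin_compat1. exact Hy.
  - intros [d [Hd H]].
    assert (Hd2 : 0 < d / 2) by lra.
    exists (mkposreal _ Hd2). intros y [H1 H2]. apply H.
    apply Rle_lt_trans with (1 := Cmod_le_Re_Im _).
    change (Rabs (Re y - Re z) < d / 2) in H1.
    change (Rabs (Im y - Im z) < d / 2) in H2.
    change (Rabs (Re y - Re z) + Rabs (Im y - Im z) < d). lra.
Qed.

Lemma ccont_Cmod (f : C -> C) (z : C) :
  ccont f z <-> forall e, 0 < e -> exists d, 0 < d /\
    forall y, Cmod (y - z) < d -> Cmod (f y - f z) < e.
Proof.
  split.
  - intros H e He. apply (locally_C_Cmod z (fun y => Cmod (f y - f z) < e)).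
    apply (H (fun v => Cmod (v - f z) < e)).
    apply locally_C_Cmod. now exists e.
  - intros H P HP. apply locally_C_Cmod in HP. destruct HP as [e [He HP]].
    destruct (H e He) as [d [Hd Hd']].
    apply (proj2 (locally_C_Cmod z (fun y => P (f y)))). exists d. auto.
Qed.

Lemma rcont_Cmod (u : C -> R) (z : C) :
  rcont u z <-> forall e, 0 < e -> exists d, 0 < d /\
    forall y, Cmod (y - z) < d -> Rabs (u y - u z) < e.
Proof.
  split.
  - intros H e He. apply (locally_C_Cmod z (fun y => Rabs (u y - u z) < e)).
    apply (H (fun v => Rabs (v - u z) < e)).
    exists (mkposreal e He). intros v Hv. exact Hv.
  - intros H P [e HP].
    destruct (H e (cond_pos e)) as [d [Hd Hd']].
    apply (proj2 (locally_C_Cmod z (fun y => P (u y)))). exists d. split; auto.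
    intros y Hy. apply HP. exact (Hd' y Hy).
Qed.

(** Complex differentiability in Caratheodory's form: the difference quotient extends to a function that is continuous at [z]. *)
Definition holo (f : C -> C) (z l : C) : Prop :=
  exists q, ccont q z /\ q z = l /\ forall y, f y = (f z + q y * (y - z))%C.

Lemma holo_intro (f : C -> C) (z l : C) :
  (forall e, 0 < e -> exists d, 0 < d /\ forall y, Cmod (y - z) < d ->
     Cmod (f y - f z - l * (y - z)) <= e * Cmod (y - z)) ->
  holo f z l.
Proof.
  pose (q := fun y => if excluded_middle_informative (y = z) then l
                      else ((f y - f z) / (y - z))%C).
  assert (Hqz : q z = l) by (unfold q; destruct (excluded_middle_informative (z = z)); congruence).
  assert (Hq : forall y, f y = (f z + q y * (y - z))%C).
  { intros y. unfold q. destruct (excluded_middle_informative (y = z)) as [->|N].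
    ring. field. intros E. apply N. replace y with (y - z + z)%C by ring. rewrite E. ring. }
  exists q. split; [ | auto].
  apply ccont_Cmod. intros e He. destruct (H (e / 2)) as [d [Hd Hy]]; [lra | ].
  exists d. split; auto. intros y Hyd. rewrite Hqz.
  destruct (classic (y = z)) as [-> | N].
  - rewrite Hqz. replace (l - l)%C with (RtoC 0) by ring. now rewrite Cmod_0.
  - specialize (Hy y Hyd).
    assert (P : 0 < Cmod (y - z)).
    { apply Cmod_gt_0. intros E. apply N. replace y with (y - z + z)%C by ring. rewrite E. ring. }
    rewrite (Hq y) in Hy.
    replace (f z + q y * (y - z) - f z - l * (y - z))%C with ((q y - l) * (y - z))%C in Hy by ring.
    rewrite Cmod_mult in Hy.
    apply Rmult_le_reg_r in Hy; lra.
Qed.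

Lemma holo_elim (f : C -> C) (z l : C) :
  holo f z l ->
  forall e, 0 < e -> exists d, 0 < d /\ forall y, Cmod (y - z) < d ->
     Cmod (f y - f z - l * (y - z)) <= e * Cmod (y - z).
Proof.
  intros [q [Hc [Hl Hf]]] e He. apply ccont_Cmod with (e := e) in Hc; auto.
  destruct Hc as [d [Hd H]]. exists d. split; auto. intros y Hy.
  rewrite (Hf y). subst l.
  replace (f z + q y * (y - z) - f z - q z * (y - z))%C with ((q y - q z) * (y - z))%C by ring.
  rewrite Cmod_mult. apply Rmult_le_compat_r. apply Cmod_ge_0. apply Rlt_le; auto.
Qed.

Lemma holo_ext_near (f g : C -> C) (z l : C) (d : R) :
  0 < d -> (forall y, Cmod (y - z) < d -> f y = g y) -> holo f z l -> holo g z l.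
Proof.
  intros Hd H Hf. apply holo_intro. intros e He.
  destruct (holo_elim _ _ _ Hf e He) as [d' [Hd' H']].
  destruct (pos_below2 d d' Hd Hd') as [m [Hm M]]. exists m. split; auto.
  intros y Hy. rewrite <- !H. apply H'. lra.
  replace (z - z)%C with (RtoC 0) by ring. now rewrite Cmod_0. lra.
Qed.

Lemma holo_cont (f : C -> C) (z l : C) : holo f z l -> ccont f z.
Proof.
  intros [q [Hc [_ Hf]]].
  apply continuous_ext with (f := fun y => (f z + q y * (y - z))%C); auto.
  apply cont_plus. apply cont_cconst. apply cont_mult; auto.
  apply cont_minus. apply continuous_id. apply cont_cconst.
Qed.

Lemma holo_const (c z : C) : holo (fun _ => c) z (RtoC 0).
Proof.
  exists (fun _ => (RtoC 0)). split. apply cont_cconst. split; auto. intros; ring.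
Qed.

Lemma holo_id (z : C) : holo (fun y => y) z (RtoC 1).
Proof.
  exists (fun _ => (RtoC 1)). split. apply cont_cconst. split; auto. intros; ring.
Qed.

Lemma holo_plus (f g : C -> C) (z l m : C) :
  holo f z l -> holo g z m -> holo (fun y => (f y + g y)%C) z (l + m)%C.
Proof.
  intros [q [Hq [Hl Hf]]] [r [Hr [Hm Hg]]].
  exists (fun y => (q y + r y)%C). split. now apply cont_plus.
  split. congruence. intros y. rewrite (Hf y), (Hg y). ring.
Qed.

Lemma holo_mult (f g : C -> C) (z l m : C) :
  holo f z l -> holo g z m -> holo (fun y => (f y * g y)%C) z (l * g z + f z * m)%C.
Proof.
  intros Hf Hg. assert (Cg := holo_cont _ _ _ Hg). destruct Hf as [q [Hq [Hl Hf]]].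
  destruct Hg as [r [Hr [Hm Hg]]].
  exists (fun y => (q y * g y + f z * r y)%C). split.
  apply cont_plus; apply cont_mult; auto. apply cont_cconst.
  split. congruence. intros y. rewrite (Hf y), (Hg y). ring.
Qed.

Lemma holo_inv (f : C -> C) (z l : C) :
  holo f z l -> f z <> (RtoC 0) -> holo (fun y => (/ f y)%C) z (- l / (f z * f z))%C.
Proof.
  intros Hf Hz. assert (Cf := holo_cont _ _ _ Hf).
  destruct Hf as [q [Hq [Hl Hf]]].
  assert (Hn : exists d, 0 < d /\ forall y, Cmod (y - z) < d -> f y <> (RtoC 0)).
  { apply ccont_Cmod with (e := Cmod (f z)) in Cf; [ | now apply Cmod_gt_0].
    destruct Cf as [d [Hd H]]. exists d. split; auto. intros y Hy E.
    specialize (H y Hy). rewrite E, Cmod_minus_sym in H.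
    replace (f z - 0)%C with (f z) in H by ring. lra. }
  destruct Hn as [d [Hd Hn]].
  (* The factorisation in [holo] has to hold for all [y], including distant zeros of [f]. There the
     reciprocal is replaced by the value that the factorisation prescribes, which changes nothing
     near [z]. *)
  apply (holo_ext_near (fun y => if excluded_middle_informative (f y = (RtoC 0))
     then (/ f z + (- q y / (f y * f z)) * (y - z))%C else (/ f y)%C) _ _ _ d Hd).
  { intros y Hy. destruct (excluded_middle_informative (f y = (RtoC 0))); auto.
    exfalso. now apply (Hn y). }
  exists (fun y => (- q y / (f y * f z))%C). split; [ | split].
  - apply cont_div. apply cont_minus with (f := fun _ => (RtoC 0)) in Hq.
    { apply continuous_ext with (2 := Hq). intros; simpl; unfold Cminus; apply Cplus_0_l. }
    apply cont_cconst.
    apply cont_mult; auto. apply cont_cconst. now apply Cmult_neq_0.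
  - now subst l.
  - intros y. destruct (excluded_middle_informative (f z = (RtoC 0))). contradiction.
    destruct (excluded_middle_informative (f y = (RtoC 0))); auto.
    assert (E := Hf y).
    replace (- q y / (f y * f z) * (y - z))%C with (- (q y * (y - z)) / (f y * f z))%C
      by (field; auto).
    replace (q y * (y - z))%C with (f y - f z)%C by (rewrite E; ring).
    field. auto.
Qed.

Lemma holo_comp (f g : C -> C) (z l m : C) :
  holo f z l -> holo g (f z) m -> holo (fun y => g (f y)) z (m * l)%C.
Proof.
  intros Hf. assert (Cf := holo_cont _ _ _ Hf).
  destruct Hf as [q [Hq [Hl Hf]]]. intros [r [Hr [Hm Hg]]].
  exists (fun y => (r (f y) * q y)%C). split; [ | split].
  - apply cont_mult; auto. now apply (continuous_comp f r).
  - congruence.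
  - intros y. rewrite (Hg (f y)). rewrite (Hf y) at 2. ring.
Qed.

Lemma holo_eq (f : C -> C) (z l m : C) : holo f z l -> l = m -> holo f z m.
Proof. now intros H <-. Qed.

Lemma holo_ext (f g : C -> C) (z l : C) :
  (forall y, f y = g y) -> holo f z l -> holo g z l.
Proof. intros H. apply (holo_ext_near f g z l 1); auto. lra. Qed.

Lemma holo_scal (c : C) (f : C -> C) (z l : C) :
  holo f z l -> holo (fun y => (c * f y)%C) z (c * l)%C.
Proof.
  intros H. eapply holo_eq. apply holo_mult. apply holo_const. exact H. cbv beta; ring.
Qed.

Lemma holo_minus (f g : C -> C) (z l m : C) :
  holo f z l -> holo g z m -> holo (fun y => (f y - g y)%C) z (l - m)%C.
Proof.
  intros Hf Hg. apply holo_ext with (f := fun y => (f y + - (1) * g y)%C).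
  intros; ring.
  eapply holo_eq. apply holo_plus. exact Hf. apply holo_scal. exact Hg. ring.
Qed.

Lemma holo_div (f g : C -> C) (z l m : C) :
  holo f z l -> holo g z m -> g z <> (RtoC 0) ->
  holo (fun y => (f y / g y)%C) z ((l * g z - f z * m) / (g z * g z))%C.
Proof.
  intros Hf Hg Hz. eapply holo_eq. apply holo_mult. exact Hf.
  apply holo_inv. exact Hg. auto. cbv beta; field; auto.
Qed.

Lemma derivable_pt_lim_eps (u : R -> R) (x l e : R) :
  is_derive u x l -> 0 < e -> exists d, 0 < d /\ forall h, Rabs h < d ->
    Rabs (u (x + h) - u x - l * h) <= e * Rabs h.
Proof.
  intros H He. apply is_derive_Reals in H. destruct (H e He) as [d Hd].
  exists d. split. apply cond_pos. intros h Hh.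
  destruct (Req_dec h 0) as [-> | N].
  - rewrite Rplus_0_r, Rabs_R0. rewrite Rmult_0_r, Rminus_0_r.
    replace (u x - u x) with 0 by ring. rewrite Rabs_R0. lra.
  - specialize (Hd h N Hh).
    replace (u (x + h) - u x - l * h) with (((u (x + h) - u x) / h - l) * h) by (field; auto).
    rewrite Rabs_mult. apply Rmult_le_compat_r. apply Rabs_pos. lra.
Qed.

Lemma cexp_plus (y z : C) : cexp (y + z) = (cexp y * cexp z)%C.
Proof.
  destruct y, z. apply C_eq; simpl; rewrite exp_plus, ?cos_plus, ?sin_plus; ring.
Qed.

Lemma Cmod_cexp (z : C) : Cmod (cexp z) = exp (Re z).
Proof.
  unfold Cmod, cexp. simpl fst; simpl snd.
  replace ((exp (Re z) * cos (Im z)) ^ 2 + (exp (Re z) * sin (Im z)) ^ 2)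
    with (exp (Re z) * exp (Re z) * (Rsqr (sin (Im z)) + Rsqr (cos (Im z)))) by (unfold Rsqr; ring).
  rewrite sin2_cos2, Rmult_1_r. apply sqrt_square. left. apply exp_pos.
Qed.

Lemma holo_cexp_0 : holo cexp (RtoC 0) (RtoC 1).
Proof.
  apply holo_intro. intros e He.
  (* The errors of the real and the imaginary part add up to [9 * e' * r]; the bound [e' <= 1]
     yields [exp x <= 3]. *)
  destruct (pos_below2 (e / 10) 1) as [e' [He8 [e8 e1]]]; [lra | lra | ].
  assert (De : is_derive exp 0 1). { auto_derive; auto. rewrite exp_0; ring. }
  assert (Dc : is_derive cos 0 0). { auto_derive; auto. rewrite sin_0; ring. }
  assert (Ds : is_derive sin 0 1). { auto_derive; auto. rewrite cos_0; ring. }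
  destruct (derivable_pt_lim_eps exp 0 1 e' De He8) as [d1 [P1 H1]].
  destruct (derivable_pt_lim_eps cos 0 0 e' Dc He8) as [d2 [P2 H2]].
  destruct (derivable_pt_lim_eps sin 0 1 e' Ds He8) as [d3 [P3 H3]].
  (* With [e'] in the minimum, [r <= e'] absorbs the quadratic term [(exp x - 1) * y]. *)
  destruct (pos_below4 d1 d2 d3 e') as [m [Pm Hm]]; auto. exists m. split; auto.
  intros z. replace (z - 0)%C with z by ring. intros Hz.
  assert (R1 := Re_le_Cmod z). assert (R2 := Im_le_Cmod z).
  specialize (H1 (Re z) ltac:(lra)). specialize (H2 (Im z) ltac:(lra)).
  specialize (H3 (Im z) ltac:(lra)).
  rewrite !Rplus_0_l, exp_0 in H1. rewrite !Rplus_0_l, cos_0 in H2.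
  rewrite !Rplus_0_l, sin_0 in H3.
  apply Rle_trans with (1 := Cmod_le_Re_Im _).
  assert (E0 : cexp (RtoC 0) = (RtoC 1)).
  { unfold cexp; simpl. rewrite exp_0, cos_0, sin_0. apply C_eq; simpl; ring. }
  rewrite E0.
  set (x := Re z) in *. set (y := Im z) in *. set (r := Cmod z) in *.
  assert (Hex : 0 < exp x) by apply exp_pos.
   assert (Ay := Rabs_pos y).
  assert (Hex3 : exp x <= 3).
  { apply Rabs_le_between in H1. assert (Rabs x <= 1) by lra.
    assert (x <= 1) by (apply Rle_trans with (2 := H); apply RRle_abs). nra. }
  assert (B1 : Rabs (exp x * cos y + - (1) + - (1 * x - 0 * y)) <= 4 * e' * r).
  { replace (exp x * cos y + - (1) + - (1 * x - 0 * y)) with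
     (exp x * (cos y - 1 - 0 * y) + (exp x - 1 - 1 * x)) by ring.
    apply Rle_trans with (1 := Rabs_triang _ _). rewrite Rabs_mult, (Rabs_pos_eq (exp x)) by lra.
    assert (exp x * Rabs (cos y - 1 - 0 * y) <= 3 * (e' * Rabs y)).
    { apply Rmult_le_compat; auto. lra. apply Rabs_pos. }
    nra. }
  assert (B2 : Rabs (exp x * sin y + - 0 + - (1 * y + 0 * x)) <= 5 * e' * r).
  { replace (exp x * sin y + - 0 + - (1 * y + 0 * x)) with
     (exp x * (sin y - 0 - 1 * y) + (exp x - 1) * y) by ring.
    apply Rle_trans with (1 := Rabs_triang _ _). rewrite !Rabs_mult, (Rabs_pos_eq (exp x)) by lra.
    assert (exp x * Rabs (sin y - 0 - 1 * y) <= 3 * (e' * Rabs y)).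
    { apply Rmult_le_compat; auto. lra. apply Rabs_pos. }
    assert (Rabs (exp x - 1) <= 2 * r).
    { replace (exp x - 1) with ((exp x - 1 - 1 * x) + x) by ring.
      apply Rle_trans with (1 := Rabs_triang _ _). nra. }
    assert (Rabs (exp x - 1) * Rabs y <= (2 * r) * r).
    { apply Rmult_le_compat; auto. apply Rabs_pos. }
    assert (r * r <= e' * r). { apply Rmult_le_compat_r; lra. }
    nra. }
   apply Rle_trans with (1 := Rplus_le_compat _ _ _ _ B1 B2). replace (4 * e' * r + 5 * e' * r) with (9 * e' * r) by ring. apply Rmult_le_compat_r; [apply Cmod_ge_0 | lra].
Qed.

Lemma holo_cexp (z : C) : holo cexp z (cexp z).
Proof.
  assert (H := holo_comp (fun y => y - z)%C cexp z (RtoC 1) (RtoC 1)).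
  eapply holo_ext; [ | eapply holo_eq; [ apply (holo_scal (cexp z)); apply H | ring ] ].
  - intros y. simpl. rewrite <- cexp_plus. f_equal. ring.
  - eapply holo_eq. apply holo_minus. apply holo_id. apply holo_const. ring.
  - replace (z - z)%C with (RtoC 0) by ring. apply holo_cexp_0.
Qed.

Lemma holo_of_ex_derive (f : C -> C) (z : C) :
  ex_derive (K := C_AbsRing) (V := C_NormedModule) f z -> exists l, holo f z l.
Proof.
  intros [l Hl]. exists l. apply holo_intro. intros e He.
  destruct Hl as [_ Hl].
  destruct (Hl z (fun P H => H) (mkposreal e He)) as [d Hd].
  exists d. split. apply cond_pos. intros y Hy. rewrite Cmult_comm. exact (Hd y Hy).
Qed.

(** * Goursat's theorem on rectangles *)

Definition rect (a b c d : R) (z : C) : Prop := a <= Re z <= b /\ c <= Im z <= d.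

(** Every left endpoint [s m] stays below every right endpoint [s n + W / 2 ^ n], so the supremum of
    the left endpoints lies in all intervals of the bisection. *)
Lemma nested_intervals (s : nat -> R) (W : R) :
  0 <= W ->
  (forall n, s (S n) = s n \/ s (S n) = s n + W / 2 ^ S n) ->
  exists x, forall n, s n <= x <= s n + W / 2 ^ n.
Proof.
  intros HW Hs.
  assert (Hpos : forall n, 0 <= W / 2 ^ n).
  { intros n. apply Rdiv_le_0_compat; auto. apply pow_lt; lra. }
  assert (Hhalf : forall n, W / 2 ^ n = 2 * (W / 2 ^ S n)).
  { intros n. simpl. field. apply pow_nonzero. lra. }
  assert (Hup : forall n k, s n <= s (n + k)%nat).
  { induction k. rewrite Nat.add_0_r; lra.
    rewrite Nat.add_succ_r. specialize (Hpos (S (n + k))). destruct (Hs (n + k)%nat); lra. }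
  assert (Hdn : forall n k, s (n + k)%nat + W / 2 ^ (n + k) <= s n + W / 2 ^ n).
  { induction k. rewrite Nat.add_0_r; lra.
    rewrite Nat.add_succ_r. specialize (Hhalf (n + k)%nat). specialize (Hpos (S (n + k))).
    destruct (Hs (n + k)%nat); lra. }
  assert (Hall : forall n m, s m <= s n + W / 2 ^ n).
  { intros n m. destruct (Nat.le_gt_cases n m) as [L | L].
    - replace m with (n + (m - n))%nat by lia. specialize (Hdn n (m - n)%nat).
      specialize (Hpos (n + (m - n))%nat). lra.
    - assert (E := Hup m (n - m)%nat). replace (m + (n - m))%nat with n in E by lia.
      specialize (Hpos n). lra. }
  destruct (completeness (fun r => exists n, r = s n)) as [x [Hx1 Hx2]].
  - exists (s O + W / 2 ^ 0). intros r [n ->]. apply Hall.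
  - now exists (s O), O.
  - exists x. split. apply Hx1. now exists n.
    apply Hx2. intros r [m ->]. apply Hall.
Qed.

Lemma pow_half_small (W r : R) : 0 < r -> exists n, W / 2 ^ n < r.
Proof.
   destruct (Pow_x_infinity 2 ltac:(rewrite Rabs_pos_eq; lra) (Rabs W / r + 1)) as [n Hn].
  exists n. specialize (Hn n (le_n n)).
  assert (P : 0 < 2 ^ n) by (apply pow_lt; lra).
  rewrite Rabs_pos_eq in Hn by lra.
  apply Rlt_div_l; auto.
  apply Rle_lt_trans with (1 := RRle_abs W).
  assert (Rabs W = Rabs W / r * r) by (field; lra). nra.
Qed.

(** Only rectangles similar to the given one occur, so that in Goursat's argument the squared perimeter stays comparable to the area. *)
Lemma rect_bisection (P : R -> R -> R -> R -> Prop) (A B C D : R) :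
  A <= B -> C <= D ->
  (forall a b c d, A <= a -> a <= b -> b <= B -> C <= c -> c <= d -> d <= D ->
     P a ((a + b) / 2) c ((c + d) / 2) -> P ((a + b) / 2) b c ((c + d) / 2) ->
     P a ((a + b) / 2) ((c + d) / 2) d -> P ((a + b) / 2) b ((c + d) / 2) d ->
     P a b c d) ->
  (forall z, rect A B C D z -> exists r, 0 < r /\ forall a b c d t,
     A <= a -> b <= B -> C <= c -> d <= D -> rect a b c d z ->
     b - a < r -> d - c < r -> 0 < t -> b - a = t * (B - A) -> d - c = t * (D - C) ->
     P a b c d) ->
  P A B C D.
Proof.
  intros HAB HCD Hq Hl. apply NNPP. intros HN.
  set (W := B - A). set (H := D - C).
  pose (Q := fun n (q : R * R) =>
    P (fst q) (fst q + W / 2 ^ n) (snd q) (snd q + H / 2 ^ n)).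
  (* Selects a quarter on which [P] fails. The fourth is taken untested: if [P] holds on the other
     three, it must fail there, since otherwise it would hold on the whole. *)
  pose (step := fun n (q : R * R) =>
    let q1 := (fst q, snd q) in
    let q2 := (fst q + W / 2 ^ S n, snd q) in
    let q3 := (fst q, snd q + H / 2 ^ S n) in
    let q4 := (fst q + W / 2 ^ S n, snd q + H / 2 ^ S n) in
    if excluded_middle_informative (Q (S n) q1) then
      if excluded_middle_informative (Q (S n) q2) then
        if excluded_middle_informative (Q (S n) q3) then q4 else q3
      else q2
    else q1).
  pose (s := fix s n := match n with O => (A, C) | S n => step n (s n) end).
  assert (Hs : forall n, fst (s (S n)) = fst (s n) \/ fst (s (S n)) = fst (s n) + W / 2 ^ S n).
  { intros n. simpl s. unfold step.
    repeat (destruct (excluded_middle_informative _)); simpl; auto. }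
  assert (Hs' : forall n, snd (s (S n)) = snd (s n) \/ snd (s (S n)) = snd (s n) + H / 2 ^ S n).
  { intros n. simpl s. unfold step.
    repeat (destruct (excluded_middle_informative _)); simpl; auto. }
  assert (HW : 0 <= W) by (unfold W; lra). assert (HH : 0 <= H) by (unfold H; lra).
  destruct (nested_intervals _ W HW Hs) as [x Hx].
  destruct (nested_intervals _ H HH Hs') as [y Hy].
  assert (Hpos : forall V n, 0 <= V -> 0 <= V / 2 ^ n).
  { intros V n HV. apply Rdiv_le_0_compat; auto. apply pow_lt; lra. }
  assert (Hhalf : forall V n, V / 2 ^ n = 2 * (V / 2 ^ S n)).
  { intros V n. simpl. field. apply pow_nonzero. lra. }
  assert (Hin : forall n, (A <= fst (s n) /\ fst (s n) + W / 2 ^ n <= B) /\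
                          (C <= snd (s n) /\ snd (s n) + H / 2 ^ n <= D)).
  { induction n as [ | n IH].
    - simpl. unfold W, H. lra.
    - specialize (Hs n). specialize (Hs' n).
      assert (E1 := Hhalf W n). assert (E2 := Hhalf H n).
      assert (E3 := Hpos W (S n) HW). assert (E4 := Hpos H (S n) HH). lra. }
  assert (Hbad : forall n, ~ Q n (s n)).
  { induction n as [ | n IH].
    - unfold Q. simpl. replace (A + W / 1) with B by (unfold W; field).
      now replace (C + H / 1) with D by (unfold H; field).
    - destruct (Hin n) as [I1 I2].
      assert (E1 := Hhalf W n). assert (E2 := Hhalf H n).
      assert (E3 := Hpos W (S n) HW). assert (E4 := Hpos H (S n) HH).
      simpl s. unfold step.
      destruct (excluded_middle_informative _) as [Q1 | ]; auto.
      destruct (excluded_middle_informative _) as [Q2 | ]; auto.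
      destruct (excluded_middle_informative _) as [Q3 | ]; auto.
      intros Q4. apply IH.
      apply Hq; try lra;
      replace ((fst (s n) + (fst (s n) + W / 2 ^ n)) / 2) with (fst (s n) + W / 2 ^ S n) by lra;
      replace ((snd (s n) + (snd (s n) + H / 2 ^ n)) / 2) with (snd (s n) + H / 2 ^ S n) by lra; auto;
      rewrite ?E1, ?E2.
      replace (fst (s n) + 2 * (W / 2 ^ S n)) with (fst (s n) + W / 2 ^ S n + W / 2 ^ S n) by ring; auto.
      replace (snd (s n) + 2 * (H / 2 ^ S n)) with (snd (s n) + H / 2 ^ S n + H / 2 ^ S n) by ring; auto.
      replace (fst (s n) + 2 * (W / 2 ^ S n)) with (fst (s n) + W / 2 ^ S n + W / 2 ^ S n) by ring.
      replace (snd (s n) + 2 * (H / 2 ^ S n)) with (snd (s n) + H / 2 ^ S n + H / 2 ^ S n) by ring; auto. }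
  destruct (Hl (x, y)) as [r [Hr HP]].
  { specialize (Hx O). specialize (Hy O). simpl in Hx, Hy. unfold W, H, rect in *. simpl. lra. }
  destruct (pow_half_small (W + H) r Hr) as [n Hn].
  assert (E : (W + H) / 2 ^ n = W / 2 ^ n + H / 2 ^ n).
  { field. apply pow_nonzero. lra. }
  destruct (Hin n) as [I1 I2].
  assert (E3 := Hpos W n HW). assert (E4 := Hpos H n HH).
  (* The rectangle of generation [n] is similar to the original one with ratio [/ 2 ^ n]. *)
  apply (Hbad n). apply HP with (t := / 2 ^ n); try lra.
  - split; simpl; auto.
  - apply Rinv_0_lt_compat, pow_lt. lra.
  - unfold W. field. apply pow_nonzero. lra.
  - unfold H. field. apply pow_nonzero. lra.
Qed.

(** Compactness in the form of bisection: a bound passes from the four quarters to the whole, and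
    continuity bounds [u] near each point. *)
Lemma rect_bounded (u : C -> R) (a b c d : R) :
  a <= b -> c <= d -> (forall z, rect a b c d z -> rcont u z) ->
  exists M, forall z, rect a b c d z -> u z <= M.
Proof.
  intros Hab Hcd Hu.
  apply (rect_bisection (fun a b c d => exists M, forall z, rect a b c d z -> u z <= M)); auto.
  - intros a' b' c' d' _ H1 _ _ H2 _ [M1 HM1] [M2 HM2] [M3 HM3] [M4 HM4].
    exists (Rmax (Rmax M1 M2) (Rmax M3 M4)). intros z [Z1 Z2].
    assert (L1 := Rmax_l (Rmax M1 M2) (Rmax M3 M4)). assert (L2 := Rmax_r (Rmax M1 M2) (Rmax M3 M4)).
    assert (L3 := Rmax_l M1 M2). assert (L4 := Rmax_r M1 M2).
    assert (L5 := Rmax_l M3 M4). assert (L6 := Rmax_r M3 M4).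
    destruct (Rle_dec (Re z) ((a' + b') / 2)); destruct (Rle_dec (Im z) ((c' + d') / 2)).
    + assert (u z <= M1) by (apply HM1; split; lra). lra.
    + assert (u z <= M3) by (apply HM3; split; lra). lra.
    + assert (u z <= M2) by (apply HM2; split; lra). lra.
    + assert (u z <= M4) by (apply HM4; split; lra). lra.
  - intros z Hz. destruct (proj1 (rcont_Cmod u z) (Hu z Hz) 1 Rlt_0_1) as [r [Hr Hr']].
    exists (r / 2). split. lra. intros a' b' c' d' _ _ _ _ _ [Z1 Z2] L1 L2 _ _ _.
    exists (u z + 1). intros y [Y1 Y2].
    assert (B : Cmod (y - z) < r).
    { apply Rle_lt_trans with (1 := Cmod_minus_le _ _).
      assert (Rabs (Re y - Re z) < r / 2) by (apply Rabs_def1; lra).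
      assert (Rabs (Im y - Im z) < r / 2) by (apply Rabs_def1; lra). lra. }
    specialize (Hr' y B). apply Rabs_def2 in Hr'. lra.
Qed.

(** If the supremum [S] were not attained, [1 / (S - u)] would be continuous, hence bounded, and
    this would keep [u] at a positive distance from [S]. *)
Lemma rect_max (u : C -> R) (a b c d : R) :
  a <= b -> c <= d -> (forall z, rect a b c d z -> rcont u z) ->
  exists z0, rect a b c d z0 /\ forall z, rect a b c d z -> u z <= u z0.
Proof.
  intros Hab Hcd Hu. destruct (rect_bounded u a b c d Hab Hcd Hu) as [M HM].
  destruct (completeness (fun r => exists z, rect a b c d z /\ r = u z)) as [S [HS1 HS2]].
  - exists M. intros r [z [Hz ->]]. auto.
  - exists (u (a, c)), (a, c). split; auto. split; simpl; lra.
  - assert (HS : forall z, rect a b c d z -> u z <= S).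
    { intros z Hz. apply HS1. now exists z. }
    apply NNPP. intros HN.
    assert (Hlt : forall z, rect a b c d z -> u z < S).
    { intros z Hz. destruct (HS z Hz) as [ | E]; auto. exfalso. apply HN.
      exists z. rewrite E. auto. }
    destruct (rect_bounded (fun z => / (S - u z)) a b c d Hab Hcd) as [N HNb].
    { intros z Hz. apply cont_Rinv. apply cont_Rminus; auto. apply continuous_const.
      specialize (Hlt z Hz). lra. }
    assert (HNp : 0 < N).
    { apply Rlt_le_trans with (/ (S - u (a, c))).
      apply Rinv_0_lt_compat. assert (u (a, c) < S); [ | lra]. apply Hlt. split; simpl; lra.
      apply HNb. split; simpl; lra. }
    assert (S <= S - / N); [ | assert (0 < / N) by (now apply Rinv_0_lt_compat); lra].
    apply HS2. intros r [z [Hz ->]]. specialize (Hlt z Hz).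
    assert (/ N <= / / (S - u z)).
    { apply Rinv_le_contravar; auto. apply Rinv_0_lt_compat. lra. }
    rewrite Rinv_inv in H. lra.
Qed.

Lemma rect_mod_lower_bound (f : C -> C) (a b c d : R) :
  a <= b -> c <= d -> (forall z, rect a b c d z -> ccont f z /\ f z <> 0) ->
  exists m, 0 < m /\ forall z, rect a b c d z -> m <= Cmod (f z).
Proof.
  intros Hab Hcd Hf.
  destruct (rect_max (fun z => / Cmod (f z)) a b c d Hab Hcd) as [z0 [Hz0 Hm]].
  { intros z Hz. destruct (Hf z Hz) as [H1 H2]. apply cont_Rinv. now apply cont_Cmod.
    intros E. apply H2. now apply Cmod_eq_0. }
  assert (Hpos : forall z, rect a b c d z -> 0 < Cmod (f z)).
  { intros z Hz. apply Cmod_gt_0. now apply Hf. }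
  exists (Cmod (f z0)). split; auto. intros z Hz.
  specialize (Hm z Hz). apply Rinv_le_contravar in Hm.
  rewrite !Rinv_inv in Hm. exact Hm. apply Rinv_0_lt_compat; auto.
Qed.

Definition on_frame (a b c d : R) (z : C) : Prop :=
  rect a b c d z /\ (Re z = a \/ Re z = b \/ Im z = c \/ Im z = d).

(** Each side of the frame is a degenerate rectangle, so the bound on rectangles applies four
    times. *)
Lemma frame_mod_lower_bound (f : C -> C) (a b c d : R) :
  a <= b -> c <= d -> (forall z, on_frame a b c d z -> ccont f z /\ f z <> 0) ->
  exists m, 0 < m /\ forall z, on_frame a b c d z -> m <= Cmod (f z).
Proof.
  intros Hab Hcd Hf.
  destruct (rect_mod_lower_bound f a a c d) as [m1 [P1 H1]]; try lra.
  { intros z Hz. apply Hf. unfold on_frame, rect in *. lra. }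
  destruct (rect_mod_lower_bound f b b c d) as [m2 [P2 H2]]; try lra.
  { intros z Hz. apply Hf. unfold on_frame, rect in *. lra. }
  destruct (rect_mod_lower_bound f a b c c) as [m3 [P3 H3]]; try lra.
  { intros z Hz. apply Hf. unfold on_frame, rect in *. lra. }
  destruct (rect_mod_lower_bound f a b d d) as [m4 [P4 H4]]; try lra.
  { intros z Hz. apply Hf. unfold on_frame, rect in *. lra. }
  destruct (pos_below4 m1 m2 m3 m4) as [m [Pm Hm]]; auto. exists m. split; auto.
  intros z [[Z1 Z2] [E | [E | [E | E]]]].
  - assert (m1 <= Cmod (f z)) by (apply H1; split; lra). lra.
  - assert (m2 <= Cmod (f z)) by (apply H2; split; lra). lra.
  - assert (m3 <= Cmod (f z)) by (apply H3; split; lra). lra.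
  - assert (m4 <= Cmod (f z)) by (apply H4; split; lra). lra.
Qed.

Lemma RInt_near_const (g : R -> R) (a b K M : R) :
  a <= b -> ex_RInt g a b -> (forall x, a <= x <= b -> Rabs (g x - K) <= M) ->
  Rabs (RInt g a b - K * (b - a)) <= M * (b - a).
Proof.
  intros Hab Hg HM.
  assert (L : (K - M) * (b - a) <= RInt g a b).
  { replace ((K - M) * (b - a)) with (RInt (fun _ => K - M) a b).
    apply RInt_le; auto. apply ex_RInt_const. intros x Hx.
    assert (H := HM x ltac:(lra)). apply Rabs_le_between in H. lra.
    rewrite RInt_const. unfold scal; simpl; unfold mult; simpl. ring. }
  assert (U : RInt g a b <= (K + M) * (b - a)).
  { replace ((K + M) * (b - a)) with (RInt (fun _ => K + M) a b).
    apply RInt_le; auto. apply ex_RInt_const. intros x Hx.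
    assert (H := HM x ltac:(lra)). apply Rabs_le_between in H. lra.
    rewrite RInt_const. unfold scal; simpl; unfold mult; simpl. ring. }
  apply Rabs_le_between. lra.
Qed.

Lemma cont_horizontal (f : C -> C) (x y : R) :
  ccont f (x, y) -> continuous (fun s => Im (f (s, y))) x.
Proof.
  intros H. apply cont_Im_comp.
  apply (continuous_comp (V := C_UniformSpace) (fun s => (s, y)) f); auto.
  apply cont_pair. apply continuous_id. apply continuous_const.
Qed.

Lemma cont_vertical (f : C -> C) (x y : R) :
  ccont f (x, y) -> continuous (fun t => Re (f (x, t))) y.
Proof.
  intros H. apply cont_Re_comp.
  apply (continuous_comp (V := C_UniformSpace) (fun t => (x, t)) f); auto.
  apply cont_pair. apply continuous_const. apply continuous_id.
Qed.

Lemma ex_RInt_horizontal (f : C -> C) (a b y : R) :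
  a <= b -> (forall x, a <= x <= b -> ccont f (x, y)) -> ex_RInt (fun x => Im (f (x, y))) a b.
Proof.
  intros Hab H. apply (ex_RInt_continuous (V := R_CompleteNormedModule)). intros x Hx.
  rewrite Rmin_left, Rmax_right in Hx by lra. now apply cont_horizontal, H.
Qed.

Lemma ex_RInt_vertical (f : C -> C) (x c d : R) :
  c <= d -> (forall y, c <= y <= d -> ccont f (x, y)) -> ex_RInt (fun y => Re (f (x, y))) c d.
Proof.
  intros Hcd H. apply (ex_RInt_continuous (V := R_CompleteNormedModule)). intros y Hy.
  rewrite Rmin_left, Rmax_right in Hy by lra. now apply cont_vertical, H.
Qed.

(** The imaginary part of the integral of [f] over the boundary of the rectangle. *)
Definition frame_flux (f : C -> C) (a b c d : R) : R :=
  (RInt (fun y => Re (f (b, y))) c d - RInt (fun y => Re (f (a, y))) c d) -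
  (RInt (fun x => Im (f (x, d))) a b - RInt (fun x => Im (f (x, c))) a b).

(** The flux is additive over the quarters, and four bounds with ratio [t / 2] add up to the bound
    with ratio [t]. On a small rectangle [f] is affine up to [e] times the size, and an affine
    function has no flux. *)
Lemma goursat (f : C -> C) (a b c d : R) :
  a <= b -> c <= d -> (forall z, rect a b c d z -> exists l, holo f z l) ->
  RInt (fun y => Re (f (b, y))) c d - RInt (fun y => Re (f (a, y))) c d =
  RInt (fun x => Im (f (x, d))) a b - RInt (fun x => Im (f (x, c))) a b.
Proof.
  intros Hab Hcd Hf.
  assert (Cf : forall z, rect a b c d z -> ccont f z).
  { intros z Hz. destruct (Hf z Hz) as [l Hl]. now apply holo_cont in Hl. }
  assert (Xh : forall x1 x2 y, a <= x1 -> x1 <= x2 -> x2 <= b -> c <= y <= d ->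
     ex_RInt (fun x => Im (f (x, y))) x1 x2).
  { intros. apply ex_RInt_horizontal; auto. intros. apply Cf. split; simpl; lra. }
  assert (Xv : forall x y1 y2, c <= y1 -> y1 <= y2 -> y2 <= d -> a <= x <= b ->
     ex_RInt (fun y => Re (f (x, y))) y1 y2).
  { intros. apply ex_RInt_vertical; auto. intros. apply Cf. split; simpl; lra. }
  set (S := (b - a) + (d - c)).
  assert (HS : 0 <= S) by (unfold S; lra).
  assert (Main : forall e, 0 < e -> Rabs (frame_flux f a b c d) <= 4 * e * (S * S)).
  { intros e He.
    assert (HP : forall t, 0 <= t -> b - a = t * (b - a) -> d - c = t * (d - c) ->
      Rabs (frame_flux f a b c d) <= 4 * e * (t * S * (t * S))).
    2: { replace S with (1 * S) by ring. apply HP; lra. }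
    apply (rect_bisection (fun a' b' c' d' => forall t, 0 <= t ->
      b' - a' = t * (b - a) -> d' - c' = t * (d - c) ->
      Rabs (frame_flux f a' b' c' d') <= 4 * e * (t * S * (t * S)))); auto.
    - intros a' b' c' d' A1 A2 A3 C1 C2 C3 P1 P2 P3 P4 t Ht Et1 Et2.
      specialize (P1 (t / 2) ltac:(lra) ltac:(lra) ltac:(lra)).
      specialize (P2 (t / 2) ltac:(lra) ltac:(lra) ltac:(lra)).
      specialize (P3 (t / 2) ltac:(lra) ltac:(lra) ltac:(lra)).
      specialize (P4 (t / 2) ltac:(lra) ltac:(lra) ltac:(lra)).
      assert (E : frame_flux f a' b' c' d' =
        frame_flux f a' ((a' + b') / 2) c' ((c' + d') / 2) +
        frame_flux f ((a' + b') / 2) b' c' ((c' + d') / 2) +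
        frame_flux f a' ((a' + b') / 2) ((c' + d') / 2) d' +
        frame_flux f ((a' + b') / 2) b' ((c' + d') / 2) d').
      { unfold frame_flux.
        assert (V : forall x, a <= x <= b -> RInt (fun y => Re (f (x, y))) c' ((c' + d') / 2) +
          RInt (fun y => Re (f (x, y))) ((c' + d') / 2) d' = RInt (fun y => Re (f (x, y))) c' d').
        { intros. apply (RInt_Chasles (V := R_CompleteNormedModule)); apply Xv; lra. }
        assert (H : forall y, c <= y <= d -> RInt (fun x => Im (f (x, y))) a' ((a' + b') / 2) +
          RInt (fun x => Im (f (x, y))) ((a' + b') / 2) b' = RInt (fun x => Im (f (x, y))) a' b').
        { intros. apply (RInt_Chasles (V := R_CompleteNormedModule)); apply Xh; lra. }
        rewrite <- (V a'), <- (V b'), <- (H c'), <- (H d') by lra. ring. }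
      rewrite E.
      apply Rle_trans with (1 := Rabs_triang _ _).
      apply Rle_trans with (1 := Rplus_le_compat_r _ _ _ (Rabs_triang _ _)).
      apply Rle_trans with (1 := Rplus_le_compat_r _ _ _ (Rplus_le_compat_r _ _ _ (Rabs_triang _ _))).
      lra.
    - intros z Hz. destruct (Hf z Hz) as [l Hl].
      destruct (holo_elim _ _ _ Hl e He) as [r [Hr H]].
      exists (r / 2). split. lra.
      intros a' b' c' d' _ A1 A3 C1 C3 Hzz L1 L2 _ _ _ t Ht Et1 Et2.
      assert (Ea : a' <= b') by (destruct Hzz; lra). assert (Ec : c' <= d') by (destruct Hzz; lra).
      assert (D : forall y, rect a' b' c' d' y ->
        Cmod (f y - f z - l * (y - z)) <= e * (t * S)).
      { intros y [Y1 Y2]. destruct Hzz as [Z1 Z2].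
        assert (B : Cmod (y - z) <= t * S).
        { apply Rle_trans with (1 := Cmod_minus_le _ _).
          assert (Rabs (Re y - Re z) <= b' - a') by (apply Rabs_le; lra).
          assert (Rabs (Im y - Im z) <= d' - c') by (apply Rabs_le; lra).
          unfold S. lra. }
        apply Rle_trans with (e * Cmod (y - z)). apply H.
        assert (t * S = (b' - a') + (d' - c')) by (unfold S; lra). lra.
        apply Rmult_le_compat_l; lra. }
      (* Both differences of opposite sides are compared with the same number
         [Re l * (b' - a') * (d' - c')], which cancels in the flux. *)
      assert (V : Rabs (RInt (fun y => Re (f (b', y)) - Re (f (a', y))) c' d' - Re l * (b' - a') * (d' - c'))
         <= 2 * (e * (t * S)) * (d' - c')).
      { apply RInt_near_const; auto.
        { apply (ex_RInt_minus (V := R_NormedModule) (fun y => Re (f (b', y))) (fun y => Re (f (a', y))));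
          apply Xv; lra. }
        intros y Hy.
        assert (D1 := D (b', y) ltac:(split; simpl; lra)). assert (D2 := D (a', y) ltac:(split; simpl; lra)).
        apply (Rle_trans _ _ _ (Re_le_Cmod _)) in D1. apply (Rle_trans _ _ _ (Re_le_Cmod _)) in D2.
        apply Rabs_le_between in D1. apply Rabs_le_between in D2. apply Rabs_le_between.
        simpl in D1, D2 |- *. unfold Re, Im in *. lra. }
      assert (U : Rabs (RInt (fun x => Im (f (x, d')) - Im (f (x, c'))) a' b' - Re l * (d' - c') * (b' - a'))
         <= 2 * (e * (t * S)) * (b' - a')).
      { apply RInt_near_const; auto.
        { apply (ex_RInt_minus (V := R_NormedModule) (fun x => Im (f (x, d'))) (fun x => Im (f (x, c'))));
          apply Xh; lra. }
        intros x Hx.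
        assert (D1 := D (x, d') ltac:(split; simpl; lra)). assert (D2 := D (x, c') ltac:(split; simpl; lra)).
        apply (Rle_trans _ _ _ (Im_le_Cmod _)) in D1. apply (Rle_trans _ _ _ (Im_le_Cmod _)) in D2.
        apply Rabs_le_between in D1. apply Rabs_le_between in D2. apply Rabs_le_between.
        simpl in D1, D2 |- *. unfold Re, Im in *. lra. }
      rewrite (RInt_minus (V := R_CompleteNormedModule) (fun y => Re (f (b', y))) (fun y => Re (f (a', y)))) in V
        by (apply Xv; lra).
      rewrite (RInt_minus (V := R_CompleteNormedModule) (fun x => Im (f (x, d'))) (fun x => Im (f (x, c')))) in U
        by (apply Xh; lra).
      unfold minus, plus, opp in U, V; simpl in U, V.
      unfold frame_flux. apply Rabs_le_between in U. apply Rabs_le_between in V.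
      assert (t * S = (b' - a') + (d' - c')) by (unfold S; lra).
      assert (0 <= e * (t * S) * (t * S)).
      { rewrite Rmult_assoc. apply Rmult_le_pos. lra. nra. }
      apply Rabs_le_between. nra. }
  assert (Z : frame_flux f a b c d = 0).
  { apply NNPP. intros N. assert (P := Rabs_pos_lt _ N).
    set (q := Rabs (frame_flux f a b c d)) in *.
    (* This choice of [e] bounds the flux by half of itself; the summand [1] covers [S = 0]. *)
    specialize (Main (q / (8 * (S * S + 1)))).
    assert (Q : 0 < 8 * (S * S + 1)) by nra.
    specialize (Main ltac:(now apply Rdiv_lt_0_compat)).
    assert (4 * (q / (8 * (S * S + 1))) * (S * S) = q / 2 * (S * S / (S * S + 1))) by (field; nra).
    assert (S * S / (S * S + 1) <= 1) by (apply Rle_div_l; nra).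
    nra. }
  unfold frame_flux in Z. lra.
Qed.

(** * Mean values and the maximum principle *)

Lemma cexp_periodic (s : R) : cexp (s, 2 * PI) = cexp (s, 0).
Proof. unfold cexp; simpl. now rewrite cos_2PI, sin_2PI, cos_0, sin_0. Qed.

Lemma holo_comp_exp (f : C -> C) (z0 z l : C) :
  holo f (z0 + cexp z)%C l -> holo (fun y => f (z0 + cexp y)%C) z (l * cexp z)%C.
Proof.
   apply (holo_comp (fun y => z0 + cexp y)%C f); auto.
  eapply holo_eq. apply holo_plus. apply holo_const. apply holo_cexp. ring.
Qed.

(** In the coordinate [ln r + i t] the circles about [z0] are vertical segments, and by periodicity
    the two horizontal sides cancel, so Goursat's theorem makes the integral independent of [r]. Its
    limit for small radii comes from continuity at [z0]. *)
Lemma circle_mean (f : C -> C) (z0 : C) (R0 r : R) :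
  0 < R0 -> ccont f z0 ->
  (forall y, 0 < Cmod (y - z0) <= R0 -> exists l, holo f y l) ->
  0 < r <= R0 ->
  RInt (fun t => Re (f (z0 + cexp (ln r, t))%C)) 0 (2 * PI) = 2 * PI * Re (f z0).
Proof.
  intros HR Hc Hh Hr. assert (HPI := PI_RGT_0).
  set (g := fun z => f (z0 + cexp z)%C).
  assert (Hg : forall z, Re z <= ln r -> exists l, holo g z l).
  { intros z Hz. destruct (Hh (z0 + cexp z)%C) as [l Hl].
    - replace (z0 + cexp z - z0)%C with (cexp z) by ring. rewrite Cmod_cexp.
      split. apply exp_pos. apply Rle_trans with r; [ | lra].
      rewrite <- (exp_ln r) by lra. destruct Hz as [Hz | Hz]. left. now apply exp_increasing. rewrite Hz. lra.
    - exists (l * cexp z)%C. now apply holo_comp_exp. }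
  assert (Hconst : forall s, s <= ln r ->
    RInt (fun t => Re (g (s, t))) 0 (2 * PI) = RInt (fun t => Re (g (ln r, t))) 0 (2 * PI)).
  { intros s Hs. assert (G := goursat g s (ln r) 0 (2 * PI) Hs ltac:(lra)).
    assert (E : RInt (fun x => Im (g (x, 2 * PI))) s (ln r) = RInt (fun x => Im (g (x, 0))) s (ln r)).
    { apply RInt_ext. intros x _. unfold g. now rewrite cexp_periodic. }
     specialize (G ltac:(intros z [Z1 Z2]; apply Hg; lra)). lra. }
  change (RInt (fun t => Re (g (ln r, t))) 0 (2 * PI) = 2 * PI * Re (f z0)).
  apply Rminus_diag_uniq. apply NNPP. intros N. apply Rabs_pos_lt in N.
  set (q := Rabs (RInt (fun t => Re (g (ln r, t))) 0 (2 * PI) - 2 * PI * Re (f z0))) in *.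
  destruct (proj1 (ccont_Cmod f z0) Hc (q / (4 * PI))) as [d [Hd H]].
  { apply Rdiv_lt_0_compat; lra. }
  set (s := Rmin (ln r) (ln (d / 2))).
  assert (Hs1 : s <= ln r) by apply Rmin_l. assert (Hs2 : s <= ln (d / 2)) by apply Rmin_r.
  assert (Hs3 : exp s < d).
  { apply Rle_lt_trans with (d / 2); [ | lra]. rewrite <- (exp_ln (d / 2)) by lra.
    destruct Hs2 as [Hs2 | Hs2]. left. now apply exp_increasing. rewrite Hs2. lra. }
  assert (I : Rabs (RInt (fun t => Re (g (s, t))) 0 (2 * PI) - Re (f z0) * (2 * PI - 0))
     <= q / (4 * PI) * (2 * PI - 0)).
  { apply RInt_near_const. lra.
    - apply ex_RInt_vertical. lra. intros y Hy. destruct (Hg (s, y)) as [l Hl]. auto.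
      eapply holo_cont; eauto.
    - intros t _. left.
      apply Rle_lt_trans with (2 := H (z0 + cexp (s, t))%C
         ltac:(replace (z0 + cexp (s, t) - z0)%C with (cexp (s, t)) by ring; rewrite Cmod_cexp; auto)).
      apply (Re_le_Cmod (f (z0 + cexp (s, t)) - f z0)%C). }
  rewrite (Hconst s Hs1) in I.
  replace (Re (f z0) * (2 * PI - 0)) with (2 * PI * Re (f z0)) in I by ring. fold q in I.
  replace (q / (4 * PI) * (2 * PI - 0)) with (q / 2) in I by (field; lra). lra.
Qed.

(** The squared distance to a fixed point, restricted to a circle, is such a trigonometric
    polynomial. *)
Lemma RInt_trig_poly (K p q : R) :
  is_RInt (fun t => K + p * cos t + q * sin t) 0 (2 * PI) (2 * PI * K).
Proof.
  assert (H : is_RInt (fun t => K + p * cos t + q * sin t) 0 (2 * PI)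
    (minus ((fun t => K * t + p * sin t - q * cos t) (2 * PI)) ((fun t => K * t + p * sin t - q * cos t) 0))).
  { apply (is_RInt_derive (V := R_CompleteNormedModule) (fun t => K * t + p * sin t - q * cos t) (fun t => K + p * cos t + q * sin t)).
    - intros x _. auto_derive; auto. ring.
    - intros x _. apply cont_Rplus; [apply cont_Rplus; [apply continuous_const | ] | ];
      (apply cont_Rmult; [apply continuous_const | apply continuity_pt_filterlim]).
      apply continuity_cos. apply continuity_sin. }
  unfold minus, plus, opp in H; simpl in H.
  rewrite cos_2PI, sin_2PI, cos_0, sin_0 in H.
  replace (2 * PI * K) with (K * (2 * PI) + p * 0 - q * 1 + - (K * 0 + p * 0 - q * 1)) by ring.
  exact H.
Qed.

(** A point [zs] at which [f] is only continuous is allowed, so that difference quotients are covered. *)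
Lemma max_principle (f : C -> C) (zs : C) (a b c d B : R) :
  a <= b -> c <= d ->
  (forall z, rect a b c d z -> ccont f z) ->
  (forall z, a < Re z < b -> c < Im z < d -> z <> zs -> exists l, holo f z l) ->
  (forall z, on_frame a b c d z -> Re (f z) <= B) ->
  forall z, rect a b c d z -> Re (f z) <= B.
Proof.
  intros Hab Hcd Hc Hh HB z1 Hz1. apply Rnot_lt_le. intros Hlt.
  assert (HPI := PI_RGT_0).
  set (D := (b - a) ^ 2 + (d - c) ^ 2 + 1).
  assert (HD : 0 < D) by (unfold D; nra).
  set (e := (Re (f z1) - B) / (2 * D)).
  assert (He : 0 < e) by (apply Rdiv_lt_0_compat; lra).
  pose (dd := fun z => (Re z - Re z1) * (Re z - Re z1) + (Im z - Im z1) * (Im z - Im z1)).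
  (* Adding [e] times the squared distance to [z1] makes the function strictly subharmonic. Since
     [e * D] is half of the supposed excess over [B], the maximum still lies off the frame. *)
  pose (v := fun z => Re (f z) + e * dd z).
  destruct (rect_max v a b c d Hab Hcd) as [m [Hm Hmax]].
  { intros z Hz. apply cont_Rplus. apply cont_Re_comp, Hc, Hz.
    apply cont_Rmult. apply continuous_const.
    apply (continuous_ext (fun z => Cmod (z - z1) * Cmod (z - z1))).
    intros y. exact (Cmod_sqr (y - z1)).
    assert (rcont (fun y => Cmod (y - z1)) z).
    { apply (cont_Cmod (fun y => y - z1)%C), cont_minus. apply continuous_id. apply cont_cconst. }
    now apply cont_Rmult. }
  assert (HDd : forall z, rect a b c d z -> dd z <= D).
  { intros z [Z1 Z2]. destruct Hz1 as [Y1 Y2]. unfold dd, D.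
    assert (forall p q L, - L <= p - q <= L -> (p - q) * (p - q) <= L ^ 2) by (intros; nra).
    assert (E1 := H (Re z) (Re z1) (b - a) ltac:(lra)).
    assert (E2 := H (Im z) (Im z1) (d - c) ltac:(lra)). lra. }
  assert (HeD : e * D = (Re (f z1) - B) / 2) by (unfold e; field; lra).
  assert (Hm1 : B + e * D < v m).
  { specialize (Hmax z1 Hz1). unfold v at 1, dd in Hmax.
    lra. }
  assert (Hin : a < Re m < b /\ c < Im m < d).
  { assert (~ on_frame a b c d m).
    { intros F. specialize (HB m F). specialize (HDd m Hm). unfold v in Hm1. nra. }
    assert (K := Hm). destruct K as [M1 M2].
    assert (Re m <> a) by (intros E; apply H; split; auto).
    assert (Re m <> b) by (intros E; apply H; split; auto).
    assert (Im m <> c) by (intros E; apply H; split; auto).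
    assert (Im m <> d) by (intros E; apply H; split; auto).
    repeat split; lra. }
  destruct (pos_below4 (Re m - a) (b - Re m) (Im m - c) (d - Im m)) as [r1 [P1 Hr1]]; try lra.
  assert (Hr : exists r, 0 < r < r1 /\ forall y, 0 < Cmod (y - m) <= r -> y <> zs).
  { destruct (classic (zs = m)) as [E | N].
    - exists (r1 / 2). split. lra. intros y [Hy _] E'. subst.
      replace (m - m)%C with (RtoC 0) in Hy by ring. rewrite Cmod_0 in Hy. lra.
    - assert (0 < Cmod (zs - m)).
      { apply Cmod_gt_0. intros E. apply N. replace zs with (zs - m + m)%C by ring. rewrite E. ring. }
      destruct (pos_below2 (r1 / 2) (Cmod (zs - m) / 2)) as [r [Pr Hr]]; [lra | lra | ].
      exists r. split. lra.
      intros y [_ Hy] E. subst. lra. }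
  destruct Hr as [r [Hr Hzs]].
  assert (Hdisc : forall y, Cmod (y - m) <= r -> a < Re y < b /\ c < Im y < d).
  { intros y Hy. assert (E1 := Re_minus_le y m). assert (E2 := Im_minus_le y m).
    apply Rabs_le_between in E1. apply Rabs_le_between in E2. lra. }
  assert (Mean := circle_mean f m r r ltac:(lra) (Hc m Hm)).
  specialize (Mean ltac:(intros y Hy; destruct (Hdisc y ltac:(lra)); apply Hh; auto) ltac:(lra)).
  set (K := Re (f m) - e * r ^ 2).
  set (p := - (2 * e * r * (Re m - Re z1))). set (q := - (2 * e * r * (Im m - Im z1))).
  assert (Hcirc : forall t, Cmod (m + cexp (ln r, t) - m)%C = r).
  { intros t. replace (m + cexp (ln r, t) - m)%C with (cexp (ln r, t)) by ring.
    rewrite Cmod_cexp. apply exp_ln. lra. }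
  (* Maximality of [v] at [m] bounds [Re f] on the circle by a trigonometric polynomial with mean
     [Re (f m) - e * r ^ 2], which is less than the mean value property requires. *)
  assert (Hle : RInt (fun t => Re (f (m + cexp (ln r, t))%C)) 0 (2 * PI) <= 2 * PI * K).
  { rewrite <- (is_RInt_unique _ _ _ _ (RInt_trig_poly K p q)).
    apply RInt_le. lra.
    - apply (ex_RInt_vertical (fun z => f (m + cexp z)%C)). lra.
      intros y _. apply (continuous_comp (U := C_UniformSpace) (V := C_UniformSpace) (fun z => m + cexp z)%C f).
      apply cont_plus. apply cont_cconst. apply cont_cexp, continuous_id.
      apply Hc. destruct (Hdisc (m + cexp (ln r, y))%C). rewrite Hcirc. lra. split; lra.
    - eexists. apply RInt_trig_poly.
    - intros t _.
      assert (Hd := Hdisc (m + cexp (ln r, t))%C ltac:(rewrite Hcirc; lra)).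
      assert (Hv := Hmax (m + cexp (ln r, t))%C ltac:(split; lra)).
      unfold v, dd in Hv.
      change (Re (m + cexp (ln r, t))) with (Re m + exp (ln r) * cos t) in Hv.
      change (Im (m + cexp (ln r, t))) with (Im m + exp (ln r) * sin t) in Hv.
      rewrite exp_ln in Hv by lra.
      assert (T : cos t * cos t + sin t * sin t = 1).
      { rewrite <- (sin2_cos2 t). unfold Rsqr. ring. }
      unfold K, p, q.
      assert (E : (Re m + r * cos t - Re z1) * (Re m + r * cos t - Re z1) +
        (Im m + r * sin t - Im z1) * (Im m + r * sin t - Im z1) =
        (Re m - Re z1) * (Re m - Re z1) + (Im m - Im z1) * (Im m - Im z1) +
        2 * r * ((Re m - Re z1) * cos t + (Im m - Im z1) * sin t) + r ^ 2 * (cos t * cos t + sin t * sin t)) by ring.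
      rewrite E, T in Hv. lra. }
   unfold K in Hle.
  assert (P2 : 0 < e * r ^ 2) by (apply Rmult_lt_0_compat; [ | apply pow_lt]; lra).
  assert (0 < 2 * PI * (e * r ^ 2)) by (apply Rmult_lt_0_compat; lra). lra.
Qed.

(** The maximum principle for the real part of [Cconj (f z) * f], where [z] is the point at which
    the modulus is to be bounded. *)
Lemma max_modulus (f : C -> C) (zs : C) (a b c d B : R) :
  a <= b -> c <= d -> 0 <= B ->
  (forall z, rect a b c d z -> ccont f z) ->
  (forall z, a < Re z < b -> c < Im z < d -> z <> zs -> exists l, holo f z l) ->
  (forall z, on_frame a b c d z -> Cmod (f z) <= B) ->
  forall z, rect a b c d z -> Cmod (f z) <= B.
Proof.
  intros Hab Hcd HB0 Hc Hh HB z Hz.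
  assert (H := max_principle (fun y => (Cconj (f z) * f y)%C) zs a b c d (Cmod (f z) * B) Hab Hcd).
  assert (Cmod (f z) * Cmod (f z) <= Cmod (f z) * B); [ | nra].
  rewrite Cmod_sqr. replace (Re (f z) * Re (f z) + Im (f z) * Im (f z)) with (Re (Cconj (f z) * f z))
    by (simpl; unfold Re, Im; ring).
  apply H; auto.
  - intros y Hy. apply cont_mult; auto. apply cont_cconst.
  - intros y Y1 Y2 N. destruct (Hh y Y1 Y2 N) as [l Hl]. eexists. apply holo_scal. eauto.
  - intros y Hy. apply Rle_trans with (1 := RRle_abs _). apply Rle_trans with (1 := Re_le_Cmod _).
    rewrite Cmod_mult, Cmod_conj. apply Rmult_le_compat_l; auto. apply Cmod_ge_0.
Qed.

(** * Derivative estimates *)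

Lemma Cmod_le_of_sqr (y z : C) :
  Re y * Re y + Im y * Im y <= Re z * Re z + Im z * Im z -> Cmod y <= Cmod z.
Proof.
  rewrite <- !Cmod_sqr. intros H.
  apply Rsqr_incr_0; auto using Cmod_ge_0.
Qed.

Lemma Cminus_neq_0 (y z : C) : y <> z -> (y - z)%C <> 0.
Proof. apply Cminus_eq_contra. Qed.

(** Borel-Caratheodory: if [g = -i (F - F z0)] then [Re g <= 2 M], so [g / (4 M - g)] maps the square into the unit disk and Schwarz' lemma applies. *)
Lemma derivative_bound_interior (F : C -> C) (z0 l : C) (r M : R) :
  0 < r -> 0 < M ->
  (forall z, rect (Re z0 - r) (Re z0 + r) (Im z0 - r) (Im z0 + r) z ->
     (exists l, holo F z l) /\ Rabs (Im (F z)) <= M) ->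
  holo F z0 l -> Cmod l <= 4 * M / r.
Proof.
  intros Hr HM HF Hl.
  set (sq := rect (Re z0 - r) (Re z0 + r) (Im z0 - r) (Im z0 + r)) in *.
  pose (G := fun z => (- Ci * (F z - F z0))%C).
  assert (ReG : forall z, Re (G z) = Im (F z) - Im (F z0)).
  { intros z. simpl. unfold Re, Im. ring. }
  assert (Hz0 : sq z0) by (unfold sq, rect; lra).
  assert (HG2 : forall z, sq z -> Re (G z) <= 2 * M).
  { intros z Hz. rewrite ReG. destruct (HF z Hz) as [_ H1]. destruct (HF z0 Hz0) as [_ H2].
    apply Rabs_le_between in H1. apply Rabs_le_between in H2. lra. }
  assert (HG : forall z m, holo F z m -> holo G z (- Ci * m)%C).
  { intros z m Hm. apply holo_scal. eapply holo_eq. apply holo_minus. exact Hm. apply holo_const. ring. }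
  pose (phi := fun z => (G z / (RtoC (4 * M) - G z))%C).
  assert (Hden : forall z, sq z -> (RtoC (4 * M) - G z)%C <> 0).
  { intros z Hz E. specialize (HG2 z Hz). apply (f_equal Re) in E.
    change (Re (RtoC (4 * M) - G z)) with (4 * M - Re (G z)) in E.
    change (Re 0) with 0 in E. lra. }
  assert (Hphi1 : forall z, sq z -> Cmod (phi z) <= 1).
  { intros z Hz. unfold phi, Cdiv. rewrite Cmod_mult, Cmod_inv by auto.
    assert (P : 0 < Cmod (RtoC (4 * M) - G z)) by now apply Cmod_gt_0, Hden.
    apply Rle_div_l; auto. rewrite Rmult_1_l.
    apply Cmod_le_of_sqr. specialize (HG2 z Hz).
    change (Re (RtoC (4 * M) - G z)) with (4 * M - Re (G z)).
    change (Im (RtoC (4 * M) - G z)) with (0 - Im (G z)). nra. }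
  assert (Hphi : forall z m, sq z -> holo F z m ->
     holo phi z ((- Ci * m * (RtoC (4 * M) - G z) - G z * (0 - - Ci * m)) / ((RtoC (4 * M) - G z) * (RtoC (4 * M) - G z)))%C).
  { intros z m Hz Hm. apply (holo_div G (fun y => RtoC (4 * M) - G y)%C).
    - now apply HG.
    - apply (holo_minus (fun _ => RtoC (4 * M)) G). apply holo_const. now apply HG.
    - now apply Hden. }
  assert (G0 : G z0 = RtoC 0) by (unfold G; ring).
  assert (HM4 : RtoC (4 * M) <> 0). { intros E. apply RtoC_inj in E. lra. }
  assert (phi0 : phi z0 = RtoC 0).
  { unfold phi. rewrite G0. apply Cmult_0_l. }
  destruct (Hphi z0 l Hz0 Hl) as [q [Hqc [Hq0 Hq]]].
  rewrite phi0 in Hq.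
  assert (Hqdiv : forall y, y <> z0 -> q y = (phi y / (y - z0))%C).
  { intros y N. unfold Cdiv.
    rewrite (Hq y), Cplus_0_l, <- Cmult_assoc, Cinv_r, Cmult_1_r; auto. now apply Cminus_neq_0. }
  assert (Hqh : forall y, sq y -> y <> z0 -> exists m, holo q y m).
  { intros y Hy N. destruct (HF y Hy) as [[m Hm] _]. eexists.
    apply (holo_ext_near (fun z => phi z / (z - z0))%C q y _ (Cmod (y - z0))).
    - now apply Cmod_gt_0, Cminus_neq_0.
    - intros z Hz. symmetry. apply Hqdiv. intros E. subst z. rewrite Cmod_minus_sym in Hz. lra.
    - apply holo_div. now apply Hphi; eauto. apply holo_minus. apply holo_id. apply holo_const.
      now apply Cminus_neq_0. }
  (* The quotient of [phi] by [z - z0] extends continuously to [z0], the exceptional point of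
     [max_modulus]. On the frame [Cmod (phi z) <= 1] and [r <= Cmod (z - z0)]. *)
  assert (B : Cmod (q z0) <= / r).
  { apply (max_modulus q z0 (Re z0 - r) (Re z0 + r) (Im z0 - r) (Im z0 + r)); try lra.
    - left. now apply Rinv_0_lt_compat.
    - intros z Hz. destruct (classic (z = z0)) as [-> | N]; auto.
      destruct (Hqh z Hz N) as [m Hm]. eapply holo_cont; eauto.
    - intros z Z1 Z2 N. apply Hqh; auto. unfold sq, rect. lra.
    - intros z [Hz Hf].
      assert (Hrz : r <= Cmod (z - z0)).
      { assert (E1 := Re_minus_le z z0). assert (E2 := Im_minus_le z z0).
        apply Rabs_le_between in E1. apply Rabs_le_between in E2.
        destruct Hf as [Hf | [Hf | [Hf | Hf]]]; lra. }
      assert (N : z <> z0).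
      { intros E. subst z. lra. }
      rewrite Hqdiv by auto. unfold Cdiv. rewrite Cmod_mult, Cmod_inv by now apply Cminus_neq_0.
      rewrite <- (Rmult_1_l (/ r)). apply Rmult_le_compat.
      apply Cmod_ge_0. left. apply Rinv_0_lt_compat. lra. now apply Hphi1.
      apply Rinv_le_contravar; lra.
    - unfold rect. lra. }
  rewrite Hq0, G0 in B.
  replace ((- Ci * l * (RtoC (4 * M) - 0) - 0 * (0 - - Ci * l)) / ((RtoC (4 * M) - 0) * (RtoC (4 * M) - 0)))%C
    with (- (Ci * (l / (RtoC (4 * M)))))%C in B.
  2: { field. exact HM4. }
  rewrite Cmod_opp, Cmod_mult in B. unfold Cdiv in B. rewrite Cmod_mult, Cmod_inv, Cmod_R in B by auto.
  rewrite (Rabs_pos_eq (4 * M)) in B by lra.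
  rewrite Cmod_Ci, Rmult_1_l in B.
  apply Rle_div_l in B; [ | lra]. lra.
Qed.

(** Comparison with the harmonic barrier [M / rho ^ 2 * ((x - x0) ^ 2 - y ^ 2) + 2 * M / rho * y]:
    it is nonnegative on the bottom side, at least [M] on the other three, and at most
    [2 * M * y / rho] above [x0]. *)
Lemma boundary_zero_upper (F : C -> C) (x0 rho M : R) :
  0 < rho -> 0 <= M ->
  (forall z, rect (x0 - rho) (x0 + rho) 0 rho z -> ccont F z /\ Im (F z) <= M) ->
  (forall z, rect (x0 - rho) (x0 + rho) 0 rho z -> 0 < Im z -> exists l, holo F z l) ->
  (forall x, x0 - rho <= x <= x0 + rho -> Im (F (x, 0)) <= 0) ->
  forall y, 0 <= y <= rho -> Im (F (x0, y)) <= 2 * M * y / rho.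
Proof.
  intros Hr HM HF Hh Hb y Hy.
  pose (f := fun z => (- Ci * F z +
     (RtoC (- (M / (rho * rho))) * ((z - RtoC x0) * (z - RtoC x0)) + RtoC (2 * M / rho) * (Ci * z)))%C).
  assert (Ref : forall z, Re (f z) = Im (F z) -
    M / (rho * rho) * ((Re z - x0) * (Re z - x0) - Im z * Im z) - 2 * M / rho * Im z).
  { intros z. simpl. unfold Re, Im. ring. }
  assert (H := max_principle f 0 (x0 - rho) (x0 + rho) 0 rho 0 ltac:(lra) ltac:(lra)).
  assert (HMrr : 0 <= M / (rho * rho)) by (apply Rdiv_le_0_compat; nra).
  assert (EM : M = M / (rho * rho) * (rho * rho)) by (field; lra).
  assert (EM' : M / rho = M / (rho * rho) * rho) by (field; lra).
  assert (K : Re (f (x0, y)) <= 0).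
  { apply H.
    - intros z Hz. destruct (HF z Hz) as [Hc _]. apply cont_plus.
      apply cont_mult; auto using cont_cconst.
      assert (ccont (fun z => z - RtoC x0)%C z).
      { apply cont_minus. apply continuous_id. apply cont_cconst. }
      apply cont_plus. apply cont_mult. apply cont_cconst. now apply cont_mult.
      apply cont_mult. apply cont_cconst. apply cont_mult. apply cont_cconst. apply continuous_id.
    - intros z Z1 Z2 _. destruct (Hh z) as [l Hl]. split; lra. lra.
      eexists. apply holo_plus. apply holo_scal. exact Hl.
      apply holo_plus. apply holo_scal.
      assert (D : holo (fun z => z - RtoC x0)%C z (1 - 0)%C).
      { apply holo_minus. apply holo_id. apply holo_const. }
      apply holo_mult; exact D.
      apply holo_scal, holo_scal, holo_id.
    - intros z [Hz Hf]. rewrite Ref. destruct (HF z Hz) as [_ Hle]. destruct Hz as [Z1 Z2].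
      unfold Rdiv in *. set (k := M * / (rho * rho)) in *.
      replace (2 * M * / rho * Im z) with (2 * (k * rho) * Im z) by (rewrite <- EM'; ring).
      destruct Hf as [Hf | [Hf | [Hf | Hf]]].
      + rewrite Hf. assert (0 <= k * (Im z * (2 * rho - Im z))) by (apply Rmult_le_pos; nra). lra.
      + rewrite Hf. assert (0 <= k * (Im z * (2 * rho - Im z))) by (apply Rmult_le_pos; nra). lra.
      + rewrite Hf. assert (0 <= k * ((Re z - x0) * (Re z - x0))) by (apply Rmult_le_pos; [lra | apply Rle_0_sqr]).
        assert (Im (F z) <= 0). { replace z with (Re z, 0). apply Hb; auto. rewrite <- Hf. now destruct z. }
        lra.
      + rewrite Hf. assert (0 <= k * ((Re z - x0) * (Re z - x0))) by (apply Rmult_le_pos; [lra | apply Rle_0_sqr]). lra.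
    - split; simpl; lra. }
  rewrite Ref in K. simpl in K.
  assert (0 <= M / (rho * rho) * (y * y)) by (apply Rmult_le_pos; nra).
   lra.
Qed.

Lemma boundary_zero_bound (F : C -> C) (x0 rho M : R) :
  0 < rho ->
  (forall z, rect (x0 - rho) (x0 + rho) 0 rho z -> ccont F z /\ Rabs (Im (F z)) <= M) ->
  (forall z, rect (x0 - rho) (x0 + rho) 0 rho z -> 0 < Im z -> exists l, holo F z l) ->
  (forall x, x0 - rho <= x <= x0 + rho -> Im (F (x, 0)) = 0) ->
  forall y, 0 <= y <= rho -> Rabs (Im (F (x0, y))) <= 2 * M * y / rho.
Proof.
  intros Hr HF Hh Hb y Hy.
  assert (HM : 0 <= M).
  { destruct (HF (x0, 0)) as [_ H]. split; simpl; lra.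
    apply Rle_trans with (2 := H), Rabs_pos. }
  apply Rabs_le. split.
  - assert (H := boundary_zero_upper (fun z => - (1) * F z)%C x0 rho M Hr HM).
    assert (E : forall z, Im (- (1) * F z)%C = - Im (F z)).
    { intros z. simpl. unfold Re, Im. ring. }
    assert (Im (- (1) * F (x0, y))%C <= 2 * M * y / rho); [ | rewrite E in H0; lra].
    apply H; auto.
    + intros z Hz. destruct (HF z Hz) as [Hc Hle]. split.
      apply cont_mult; auto. apply cont_cconst. rewrite E.
      apply Rabs_le_between in Hle. lra.
    + intros z Hz Hz'. destruct (Hh z Hz Hz') as [l Hl]. eexists. apply holo_scal. exact Hl.
    + intros x Hx. rewrite E, Hb; auto. lra.
  - apply boundary_zero_upper; auto.
    + intros z Hz. destruct (HF z Hz) as [Hc Hle]. split; auto.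
      apply Rabs_le_between in Hle. lra.
    + intros x Hx. rewrite Hb; auto. lra.
Qed.

(** On the square of half-side [Im z0 / 2] about [z0] the barrier bounds the imaginary part by a
    multiple of [M * Im z0 / rho], so the small height cancels in the interior estimate. The height
    is at most [rho / 3] so that the rectangles of half-width and height [rho / 2] used for the
    points of this square suffice and fit. *)
Lemma derivative_bound_boundary (F : C -> C) (z0 l : C) (rho M : R) :
  0 < M -> 0 < Im z0 <= rho / 3 ->
  (forall z, rect (Re z0 - rho) (Re z0 + rho) 0 rho z -> ccont F z /\ Rabs (Im (F z)) <= M) ->
  (forall z, rect (Re z0 - rho) (Re z0 + rho) 0 rho z -> 0 < Im z -> exists l, holo F z l) ->
  (forall x, Re z0 - rho <= x <= Re z0 + rho -> Im (F (x, 0)) = 0) ->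
  holo F z0 l -> Cmod l <= 48 * M / rho.
Proof.
  intros HM Hz0 HF Hh Hb Hl. set (x0 := Re z0) in *. set (y0 := Im z0) in *.
  assert (Hr : 0 < rho) by lra.
  replace (48 * M / rho) with (4 * (6 * M * y0 / rho) / (y0 / 2)) by (field; lra).
  apply (derivative_bound_interior F z0); auto. lra.
  { apply Rdiv_lt_0_compat; auto. apply Rmult_lt_0_compat; lra. }
  fold x0. fold y0. intros z [Z1 Z2]. split.
  - apply Hh. split; lra. lra.
  - assert (H := boundary_zero_bound F (Re z) (rho / 2) M ltac:(lra)).
    specialize (H ltac:(intros y [Y1 Y2]; apply HF; split; lra)).
    specialize (H ltac:(intros y [Y1 Y2]; apply Hh; split; lra)).
    specialize (H ltac:(intros y Y; apply Hb; lra) (Im z) ltac:(lra)).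
    replace (Re z, Im z) with z in H by now destruct z.
    apply Rle_trans with (1 := H).
    replace (2 * M * Im z / (rho / 2)) with (4 * M / rho * Im z) by (field; lra).
    replace (6 * M * y0 / rho) with (4 * M / rho * (3 / 2 * y0)) by (field; lra).
    apply Rmult_le_compat_l; [ | lra]. left. apply Rdiv_lt_0_compat; lra.
Qed.

(** * Images of neighbourhoods of boundary points *)

Lemma Cmod_triangle_minus (x y z : C) : Cmod (x - z) <= Cmod (x - y) + Cmod (y - z).
Proof. replace (x - z)%C with ((x - y) + (y - z))%C by ring. apply Cmod_triangle. Qed.

Lemma Cmod_minus_0_iff (y z : C) : y <> z -> 0 < Cmod (y - z).
Proof. intros N. now apply Cmod_gt_0, Cminus_neq_0. Qed.

(** A quantitative open mapping theorem. If [v] were omitted, the modulus of [1 / (f - v)] would be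
    largest on the frame, but there [f] is at distance at least [m - Cmod (v - f z0)] from [v],
    which exceeds the distance at [z0]. *)
Lemma rect_covers_disk (f : C -> C) (z0 v : C) (a b c d m : R) :
  a <= b -> c <= d -> rect a b c d z0 ->
  (forall z, rect a b c d z -> ccont f z) ->
  (forall z, a < Re z < b -> c < Im z < d -> exists l, holo f z l) ->
  (forall z, on_frame a b c d z -> m <= Cmod (f z - f z0)) ->
  Cmod (v - f z0) < m / 2 ->
  exists z, rect a b c d z /\ f z = v.
Proof.
  intros Hab Hcd Hz0 Hc Hh Hm Hv. apply NNPP. intros HN.
  assert (N : forall z, rect a b c d z -> f z <> v).
  { eauto. }
  assert (Hv0 := Cmod_ge_0 (v - f z0)).
  assert (B := max_modulus (fun z => 1 / (f z - v))%C 0 a b c d (/ (m - Cmod (v - f z0))) Hab Hcd).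
  assert (P : 0 < Cmod (f z0 - v)) by (apply Cmod_minus_0_iff, N; auto).
  assert (K : Cmod (1 / (f z0 - v)) <= / (m - Cmod (v - f z0))).
  { apply B; auto.
    - left. apply Rinv_0_lt_compat. lra.
    - intros z Hz. apply (cont_div (fun _ => RtoC 1) (fun z => f z - v)%C). apply cont_cconst.
      apply cont_minus; auto. apply cont_cconst. now apply Cminus_neq_0, N.
    - intros z Z1 Z2 _. destruct (Hh z Z1 Z2) as [l Hl]. eexists.
      apply (holo_div (fun _ => RtoC 1) (fun z => f z - v)%C). apply holo_const.
      apply holo_minus. exact Hl. apply holo_const. apply Cminus_neq_0, N. split; lra.
    - intros z Hz. assert (Hzr : rect a b c d z) by apply Hz.
      unfold Cdiv. rewrite Cmult_1_l, Cmod_inv by now apply Cminus_neq_0, N.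
      apply Rinv_le_contravar. lra.
      specialize (Hm z Hz). assert (T := Cmod_triangle_minus (f z) v (f z0)). lra. }
  unfold Cdiv in K. rewrite Cmult_1_l, Cmod_inv in K by now apply Cminus_neq_0, N.
  apply Rinv_le_contravar in K; [ | now apply Rinv_0_lt_compat].
  rewrite !Rinv_inv in K. rewrite (Cmod_minus_sym (f z0)) in K. lra.
Qed.

(** A square about [z0] attains all values near [g z0]. If [g (t, 0)] were [g z0], these would
    include [g (t, y)] for small [y], whereas [(t, y)] lies below the square, against
    injectivity. *)
Lemma boundary_avoids_image (g : C -> C) (t : R) (z0 : C) :
  (forall z, ccont g z) -> (forall z, 0 < Im z -> exists l, holo g z l) ->
  (forall z z', 0 < Im z -> 0 < Im z' -> g z = g z' -> z = z') ->
  0 < Im z0 -> g (t, 0) <> g z0.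
Proof.
  intros Hc Hh Hi Hz0 E. set (r := Im z0 / 2).
  destruct (frame_mod_lower_bound (fun z => g z - g z0)%C (Re z0 - r) (Re z0 + r) (Im z0 - r) (Im z0 + r))
    as [m [Hm Hb]]; try (unfold r; lra).
  { intros z [[Z1 Z2] Hf]. split. apply cont_minus; auto using cont_cconst.
    apply Cminus_neq_0. intros E'. apply Hi in E'; unfold r in *; try lra. subst. lra. }
  destruct (proj1 (ccont_Cmod g (t, 0)) (Hc _) (m / 2)) as [d [Hd H]]. lra.
  destruct (pos_below2 (d / 2) (r / 2)) as [y [Y3 [Y1 Y2]]]; [lra | unfold r; lra | ].
  destruct (rect_covers_disk g z0 (g (t, y)) (Re z0 - r) (Re z0 + r) (Im z0 - r) (Im z0 + r) m)
    as [z [[Z1 Z2] Hz]]; try (unfold r; lra); auto.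
  - unfold rect, r. lra.
  - intros z Z1 Z2. apply Hh. unfold r in *. lra.
  - rewrite <- E. apply H.
    rewrite Cmod_vertical, Rabs_pos_eq; lra.
  - apply Hi in Hz; simpl; auto; [ | unfold r in *; lra].
    subst z. simpl in Z2. unfold r in *. lra.
Qed.

(** If [v] is omitted, then [(F - conj v) / (F - v)] has modulus 1 on the bottom side and at most 2 on the other sides, which bounds how close [F] can get to [v]. *)
Lemma half_cover_step (F : C -> C) (a b h m : R) (q v v' z' : C) :
  a <= b -> 0 <= h -> Im q = 0 ->
  (forall z, rect a b 0 h z -> ccont F z) ->
  (forall z, a < Re z < b -> 0 < Im z < h -> exists l, holo F z l) ->
  (forall z, on_frame a b 0 h z -> Im z = 0 /\ Im (F z) = 0 \/ m <= Cmod (F z - q)) ->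
  rect a b 0 h z' -> F z' = v' -> 0 < Im v' ->
  Cmod (v - q) < m / 4 -> 0 < Im v -> Cmod (v' - v) <= Im v' / 3 ->
  exists z, rect a b 0 h z /\ F z = v.
Proof.
  intros Hab Hh0 Hq Hc Hh Hm Hz' Ev' Iv' Hv Iv Hvv. apply NNPP. intros HN.
  assert (N : forall z, rect a b 0 h z -> F z <> v).
  { eauto. }
  assert (B := max_modulus (fun z => (F z - Cconj v) / (F z - v))%C 0 a b 0 h 2 Hab Hh0 ltac:(lra)).
  assert (K : Cmod ((F z' - Cconj v) / (F z' - v)) <= 2).
  { apply B; auto.
    - intros z Hz. apply (cont_div (fun z => F z - Cconj v)%C (fun z => F z - v)%C).
      apply cont_minus; auto using cont_cconst. apply cont_minus; auto using cont_cconst.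
      now apply Cminus_neq_0, N.
    - intros z Z1 Z2 _. destruct (Hh z Z1 Z2) as [l Hl]. eexists.
      apply (holo_div (fun z => F z - Cconj v)%C (fun z => F z - v)%C).
      apply holo_minus. exact Hl. apply holo_const.
      apply holo_minus. exact Hl. apply holo_const. apply Cminus_neq_0, N. split; lra.
    - intros z Hz. assert (Hzr : rect a b 0 h z) by apply Hz.
      assert (P := Cmod_minus_0_iff _ _ (N z Hzr)).
      unfold Cdiv. rewrite Cmod_mult, Cmod_inv by now apply Cminus_neq_0, N.
      apply Rle_div_l; auto.
      destruct (Hm z Hz) as [[_ I0] | Hmz].
      + assert (Cmod (F z - Cconj v) <= Cmod (F z - v)); [ | lra].
        apply Cmod_le_of_sqr. simpl. unfold Re, Im in *. rewrite I0. lra.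
      + assert (T1 := Cmod_triangle_minus (F z) v q).
        assert (T2 := Cmod_triangle_minus (F z) v (Cconj v)).
        assert (T3 : Cmod (v - Cconj v) <= 2 * Cmod (v - q)).
        { apply Rle_trans with (1 := Cmod_le_Re_Im _).
          assert (I := Im_minus_le v q).
           apply Rabs_le_between in I.
          change (Re (v - Cconj v)) with (Re v - Re v). change (Im (v - Cconj v)) with (Im v - - Im v).
          rewrite Rminus_diag, Rabs_R0, Rabs_pos_eq; lra. }
        lra. }
  rewrite Ev' in K.
  assert (Nv : v' <> v) by (rewrite <- Ev'; now apply N).
  unfold Cdiv in K. rewrite Cmod_mult, Cmod_inv in K by now apply Cminus_neq_0.
  apply Rle_div_l in K; [ | now apply Cmod_minus_0_iff].
  (* The bound now reads [Cmod (v' - Cconj v) <= 2 * Cmod (v' - v)], but the left side is at least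
     [Im v' + Im v] and the right side at most [2 / 3 * Im v']. *)
  assert (I := Im_minus_le v' (Cconj v)). change (Im (Cconj v)) with (- Im v) in I.
  apply Rabs_le_between in I. lra.
Qed.

(** Continuation along the segment from the attained value [v'] to [v]. The imaginary part never
    drops below [mu] there and the steps have length at most [mu / 3], as [half_cover_step] demands;
    the segment stays within [m / 4] of [q] by convexity. *)
Lemma half_cover_box (F : C -> C) (a b h m : R) (q v v' z' : C) :
  a <= b -> 0 <= h -> Im q = 0 ->
  (forall z, rect a b 0 h z -> ccont F z) ->
  (forall z, a < Re z < b -> 0 < Im z < h -> exists l, holo F z l) ->
  (forall z, on_frame a b 0 h z -> Im z = 0 /\ Im (F z) = 0 \/ m <= Cmod (F z - q)) ->
  rect a b 0 h z' -> F z' = v' -> 0 < Im v' -> Cmod (v' - q) < m / 4 ->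
  Cmod (v - q) < m / 4 -> 0 < Im v ->
  exists z, rect a b 0 h z /\ F z = v.
Proof.
  intros Hab Hh0 Hq Hc Hh Hm Hz' Ev' Iv' Hv' Hv Iv.
  destruct (pos_below2 (Im v') (Im v)) as [mu [Hmu [L1 L2]]]; auto.
  destruct (nfloor_ex (3 * Cmod (v - v') / mu)) as [n Hn].
  { apply Rdiv_le_0_compat; auto. assert (H := Cmod_ge_0 (v - v')). lra. }
  set (N := INR (S n)).
  assert (HN : 0 < N) by (apply lt_0_INR; lia).
  assert (HN2 : Cmod (v - v') / N <= mu / 3).
  { apply Rle_div_l; auto. unfold N. rewrite S_INR. destruct Hn as [_ Hn].
    apply Rlt_div_l in Hn; auto. lra. }
  pose (p := fun k : nat => (v' + RtoC (INR k / N) * (v - v'))%C).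
  assert (Hk : forall k, (k <= S n)%nat -> 0 <= INR k / N <= 1).
  { split. apply Rdiv_le_0_compat; auto. apply pos_INR.
    apply Rle_div_l; auto. rewrite Rmult_1_l. now apply le_INR. }
  assert (Hp : forall k, (k <= S n)%nat -> Cmod (p k - q) < m / 4 /\ mu <= Im (p k)).
  { intros k Hkn. specialize (Hk k Hkn). set (s := INR k / N) in *. split.
    - unfold p. fold s. replace (v' + RtoC s * (v - v') - q)%C with
        (RtoC (1 - s) * (v' - q) + RtoC s * (v - q))%C by (rewrite RtoC_minus; ring).
      apply Rle_lt_trans with (1 := Cmod_triangle _ _).
      rewrite !Cmod_mult, !Cmod_R, !Rabs_pos_eq by lra.
      destruct (Req_dec s 0) as [-> | Ns]. lra.
      assert (s * Cmod (v - q) < s * (m / 4)) by (apply Rmult_lt_compat_l; lra).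
      assert ((1 - s) * Cmod (v' - q) <= (1 - s) * (m / 4)) by (apply Rmult_le_compat_l; lra). lra.
    - change (mu <= Im v' + (s * (Im v - Im v') + 0 * (Re v - Re v'))).
      assert (0 <= (1 - s) * (Im v' - mu)) by (apply Rmult_le_pos; lra).
      assert (0 <= s * (Im v - mu)) by (apply Rmult_le_pos; lra). lra. }
  assert (Main : forall k, (k <= S n)%nat -> exists z, rect a b 0 h z /\ F z = p k).
  { induction k as [ | k IH]; intros Hkn.
    - exists z'. split; auto. rewrite Ev'. unfold p. simpl INR.
      replace (0 / N) with 0 by (field; lra). ring.
    - destruct (IH ltac:(lia)) as [z [Hz Ez]].
      destruct (Hp k ltac:(lia)) as [P1 P2]. destruct (Hp (S k) Hkn) as [P3 P4].
      apply (half_cover_step F a b h m q (p (S k)) (p k) z); auto; try lra.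
      unfold p. rewrite S_INR.
      replace (v' + RtoC (INR k / N) * (v - v') - (v' + RtoC ((INR k + 1) / N) * (v - v')))%C
        with (RtoC (- / N) * (v - v'))%C.
      2: { replace (- / N) with (INR k / N - (INR k + 1) / N) by (field; lra). rewrite RtoC_minus. ring. }
      rewrite Cmod_mult, Cmod_R, Rabs_Ropp, Rabs_pos_eq by (left; now apply Rinv_0_lt_compat).
      unfold p in P2. lra. }
  destruct (Main (S n) (le_n _)) as [z [Hz Ez]]. exists z. split; auto.
  rewrite Ez. unfold p. fold N. replace (N / N) with 1 by (field; lra). ring.
Qed.

Lemma IVT_between (u : R -> R) (a b y : R) :
  a < b -> (forall x, a <= x <= b -> continuous u x) -> (u a - y) * (u b - y) < 0 ->
  exists x, a < x < b /\ u x = y.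
Proof.
  intros Hab Hu Hy.
  assert (Hc : forall k x, a <= x <= b -> continuity_pt (fun x => k * (u x - y)) x).
  { intros k x Hx. apply continuity_pt_filterlim. apply (cont_Rmult (fun _ => k) (fun x => u x - y)).
    apply continuous_const. apply (cont_Rminus u (fun _ => y)); auto. apply continuous_const. }
  assert (H : exists x, a <= x <= b /\ u x = y).
  { destruct (Rlt_dec (u a - y) 0) as [La | La].
    - assert (0 < u b - y) by nra.
      destruct (IVT_interv _ a b (Hc 1) Hab ltac:(lra) ltac:(lra)) as [x [Hx E]].
      exists x. lra.
    - assert (u a - y <> 0) by (intros E; rewrite E in Hy; lra).
      assert (u b - y < 0) by nra.
      destruct (IVT_interv _ a b (Hc (-1)) Hab ltac:(lra) ltac:(lra)) as [x [Hx E]].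
      exists x. lra. }
  destruct H as [x [Hx E]]. exists x.
  assert (x <> a) by (intros ->; nra). assert (x <> b) by (intros ->; nra). lra.
Qed.

Lemma cont_bottom (F : C -> C) (x : R) : ccont F (x, 0) -> continuous (U := C_UniformSpace) (fun t : R => F (t, 0)) x.
Proof.
   apply (continuous_comp (V := C_UniformSpace) (fun s : R => (s, 0)) F); auto.
  apply cont_pair. apply continuous_id. apply continuous_const.
Qed.

(** On the bottom side the values are real and run through [q], while the other three sides stay
    away from it: by [0 < Im (F z)] above the axis and by the sign condition at the two corners. A
    point just above a preimage of [q] provides the first attained value for [half_cover_box]. *)
Lemma half_cover (F : C -> C) (a b q : R) :
  a < b -> (forall z, ccont F z) ->
  (forall z, 0 < Im z -> (exists l, holo F z l) /\ 0 < Im (F z)) ->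
  (forall x, a <= x <= b -> Im (F (x, 0)) = 0) ->
  (Re (F (a, 0)) - q) * (Re (F (b, 0)) - q) < 0 ->
  exists e, 0 < e /\ forall v, 0 < Im v -> Cmod (v - RtoC q) < e ->
    exists z, a <= Re z <= b /\ 0 < Im z /\ F z = v.
Proof.
  intros Hab Hc Hh Hb Hq.
  assert (Hside : forall x, a <= x <= b -> Re (F (x, 0)) - q <> 0 ->
    forall z, rect x x 0 1 z -> ccont (fun z => F z - RtoC q)%C z /\ (F z - RtoC q)%C <> 0).
  { intros x Hx Nx z [Z1 Z2]. split. apply cont_minus; auto using cont_cconst.
    assert (Ez : z = (x, Im z)) by (destruct z; simpl in *; f_equal; lra).
    intros E. destruct (Req_dec (Im z) 0) as [E0 | E0].
    - rewrite E0 in Ez. subst z. apply Nx. apply (f_equal Re) in E. exact E.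
    - destruct (Hh z) as [_ P]. lra. apply (f_equal Im) in E.
      change (Im (F z - RtoC q)) with (Im (F z) - 0) in E. change (Im (RtoC 0)) with 0 in E. lra. }
  destruct (rect_mod_lower_bound (fun z => F z - RtoC q)%C a a 0 1) as [m1 [P1 M1]]; try lra.
  { apply Hside. lra. intros E. rewrite E in Hq. lra. }
  destruct (rect_mod_lower_bound (fun z => F z - RtoC q)%C b b 0 1) as [m2 [P2 M2]]; try lra.
  { apply Hside. lra. intros E. rewrite E in Hq. lra. }
  destruct (rect_mod_lower_bound (fun z => F z - RtoC q)%C a b 1 1) as [m3 [P3 M3]]; try lra.
  { intros z [Z1 Z2]. split. apply cont_minus; auto using cont_cconst.
    intros E. destruct (Hh z) as [_ P]. lra. apply (f_equal Im) in E.
    change (Im (F z - RtoC q)) with (Im (F z) - 0) in E. change (Im (RtoC 0)) with 0 in E. lra. }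
  destruct (pos_below4 m1 m2 m3 m3) as [m [Hm [L1 [L2 [L3 _]]]]]; auto.
  destruct (IVT_between (fun x => Re (F (x, 0))) a b q Hab) as [t [Ht Et]]; auto.
  { intros x _. apply cont_Re_comp, cont_bottom, Hc. }
  destruct (proj1 (ccont_Cmod F (t, 0)) (Hc _) (m / 4)) as [d [Hd H]]. lra.
  destruct (pos_below2 (d / 2) 1) as [y [Y3 [Y1 Y2]]]; [lra | lra | ].
  assert (EF : F (t, 0) = RtoC q).
  { apply C_eq; simpl. exact Et. apply Hb. lra. }
  assert (Hty : Cmod (F (t, y) - RtoC q) < m / 4).
  { rewrite <- EF. apply H.
    rewrite Cmod_vertical, Rabs_pos_eq; lra. }
  destruct (Hh (t, y)) as [_ Pty]. simpl; lra.
  exists (m / 4). split. lra. intros v Iv Hv.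
  destruct (half_cover_box F a b 1 m (RtoC q) v (F (t, y)) (t, y)) as [z [[Z1 Z2] Ez]]; auto; try lra.
  - intros z Z1 Z2. apply Hh. lra.
  - intros z [[Z1 Z2] Hf]. destruct (Req_dec (Im z) 0) as [E0 | E0].
    + left. split; auto. replace z with (Re z, 0) by (destruct z; simpl in *; f_equal; lra). now apply Hb.
    + right. destruct Hf as [Hf | [Hf | [Hf | Hf]]]; try lra.
      * apply Rle_trans with m1; auto. apply M1. unfold rect. lra.
      * apply Rle_trans with m2; [lra | ]. apply M2. unfold rect. lra.
      * apply Rle_trans with m3; [lra | ]. apply M3. unfold rect. lra.
  - split; simpl; lra.
  - exists z. destruct (Rle_lt_or_eq_dec 0 (Im z)) as [ | E]; auto. lra.
     replace z with (Re z, 0) in Ez by (destruct z; simpl in *; f_equal; lra).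
    rewrite <- Ez, Hb in Iv; lra.
Qed.

(** The sign condition is open and survives a small shrinking. This separates intervals with a
    common endpoint and keeps crossings off the ends of an arc. *)
Lemma sign_change_shrink (u : R -> R) (a b q : R) :
  a < b -> continuous u a -> continuous u b -> (u a - q) * (u b - q) < 0 ->
  exists a' b', a < a' /\ a' < b' /\ b' < b /\ (u a' - q) * (u b' - q) < 0.
Proof.
  intros Hab Ha Hb Hq.
  assert (N1 : u a - q <> 0) by nra. assert (N2 : u b - q <> 0) by nra.
  assert (C1 : forall x, continuous u x -> u x - q <> 0 ->
    exists d, 0 < d /\ forall y, Rabs (y - x) < d -> 0 < (u y - q) * (u x - q)).
  { intros x Hx Nx. assert (P : 0 < Rabs (u x - q)) by now apply Rabs_pos_lt.
    destruct (Hx (fun v => Rabs (v - u x) < Rabs (u x - q))) as [d Hd].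
    { exists (mkposreal _ P). intros v Hv. exact Hv. }
    exists d. split. apply cond_pos. intros y Hy. specialize (Hd y Hy).
    destruct (Rle_dec 0 (u x - q)).
    - rewrite Rabs_pos_eq with (x := u x - q) in Hd by auto. apply Rabs_def2 in Hd. nra.
    - rewrite (Rabs_left (u x - q)) in Hd by lra. apply Rabs_def2 in Hd. nra. }
  destruct (C1 a Ha N1) as [d1 [P1 H1]]. destruct (C1 b Hb N2) as [d2 [P2 H2]].
  destruct (pos_below4 d1 d2 (b - a) 1) as [m [P3 [L1 [L2 [L3 _]]]]]; try lra.
  exists (a + m / 3), (b - m / 3). repeat split; try lra.
  specialize (H1 (a + m / 3)). specialize (H2 (b - m / 3)).
  rewrite Rabs_pos_eq in H1 by lra. rewrite Rabs_left in H2 by lra.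
  set (A0 := u a - q) in *.
  destruct (Rlt_dec A0 0).
  - nra.
  - nra.
Qed.

(** Above each interval [F] attains every value of the upper half plane close to [q]. Since the
    first interval is shrunk beforehand, the two preimages of [q + i e] are distinct. *)
Lemma no_double_crossing (F : C -> C) (a b a' b' q : R) :
  (forall z, ccont F z) ->
  (forall z, 0 < Im z -> (exists l, holo F z l) /\ 0 < Im (F z)) ->
  (forall z z', 0 < Im z -> 0 < Im z' -> F z = F z' -> z = z') ->
  a < b -> b <= a' -> a' < b' ->
  (forall x, a <= x <= b -> Im (F (x, 0)) = 0) ->
  (forall x, a' <= x <= b' -> Im (F (x, 0)) = 0) ->
  (Re (F (a, 0)) - q) * (Re (F (b, 0)) - q) < 0 ->
  (Re (F (a', 0)) - q) * (Re (F (b', 0)) - q) < 0 -> False.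
Proof.
  intros Hc Hh Hi Hab Hba Hab' Hb Hb' Hq Hq'.
  assert (Cu : forall x, continuous (fun x => Re (F (x, 0))) x).
  { intros x. apply cont_Re_comp, cont_bottom, Hc. }
  destruct (sign_change_shrink _ a b q Hab (Cu a) (Cu b) Hq) as [c [d [L1 [L2 [L3 Hq2]]]]].
  destruct (half_cover F c d q) as [e1 [E1 H1]]; auto. { intros; apply Hb; lra. }
  destruct (half_cover F a' b' q) as [e2 [E2 H2]]; auto.
  destruct (pos_below2 (e1 / 2) (e2 / 2)) as [e [M3 [M1 M2]]]; [lra | lra | ].
  assert (Ev : Cmod ((q, e) - RtoC q) <= e).
  { rewrite Cmod_vertical, Rabs_pos_eq; lra. }
  destruct (H1 (q, e)) as [z [Z1 [Z2 Z3]]]; try (simpl; lra).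
  destruct (H2 (q, e)) as [z' [Z1' [Z2' Z3']]]; try (simpl; lra).
  rewrite <- Z3' in Z3. apply Hi in Z3; auto. subst z'. lra.
Qed.

(** * Convex quadrilaterals *)

Lemma idx_eq_dec (i j : idx) : {i = j} + {i <> j}.
Proof. decide equality. Defined.

Lemma idx_injective_surjective (s : idx -> idx) :
  (forall i j, s i = s j -> i = j) -> forall j, exists i, s i = j.
Proof.
  intros Hs j.
  assert (N : forall i k, i <> k -> s i <> s k) by (intros i k N E; apply N; auto).
  assert (N12 := N i1 i2 ltac:(discriminate)). assert (N13 := N i1 i3 ltac:(discriminate)).
  assert (N14 := N i1 i4 ltac:(discriminate)). assert (N23 := N i2 i3 ltac:(discriminate)).
  assert (N24 := N i2 i4 ltac:(discriminate)). assert (N34 := N i3 i4 ltac:(discriminate)).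
  apply NNPP. intros H.
  assert (E1 : s i1 <> j) by eauto. assert (E2 : s i2 <> j) by eauto.
  assert (E3 : s i3 <> j) by eauto. assert (E4 : s i4 <> j) by eauto.
  destruct (s i1), (s i2); try congruence; destruct (s i3); try congruence;
  destruct (s i4); try congruence; destruct j; congruence.
Qed.

Lemma idx_positive_lower_bound (D : idx -> R) (P : idx -> Prop) :
  (forall v, P v -> 0 < D v) -> exists e, 0 < e /\ forall v, P v -> e < D v.
Proof.
  intros H.
  assert (K : forall v, exists e, 0 < e /\ (P v -> e < D v)).
  { intros v. destruct (classic (P v)) as [p | p].
    - specialize (H v p). exists (D v / 2). lra.
    - exists 1. split. lra. contradiction. }
  destruct (K i1) as [e1 [P1 H1]]. destruct (K i2) as [e2 [P2 H2]].
  destruct (K i3) as [e3 [P3 H3]]. destruct (K i4) as [e4 [P4 H4]].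
  destruct (pos_below4 e1 e2 e3 e4) as [m [Pm Hm]]; auto. exists m. split; auto.
  intros v p. destruct v; [specialize (H1 p) | specialize (H2 p) | specialize (H3 p) | specialize (H4 p)]; lra.
Qed.

(** The signed distance from the line through the side, times the length of the side; without
    normalisation it is affine in [u]. *)
Definition side_height (x : idx -> C) (i : idx) (u : C) : R := orient (x i) (x (nxt i)) u.

(** Maps the line through [x i] and [x (nxt i)] to the real axis and the side containing the quadrilateral to the upper half plane. *)
Definition side_map (x : idx -> C) (i : idx) (u : C) : C :=
  ((u - x i) * Cconj (x (nxt i) - x i))%C.

Definition on_boundary (x : idx -> C) (u : C) : Prop :=
  (forall i, 0 <= side_height x i u) /\ exists i, side_height x i u = 0.

Lemma Im_side_map (x : idx -> C) (i : idx) (u : C) : Im (side_map x i u) = side_height x i u.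
Proof. unfold side_map, side_height, orient. simpl. unfold Re, Im. ring. Qed.

Lemma side_height_end (x : idx -> C) (i : idx) :
  side_height x i (x i) = 0 /\ side_height x i (x (nxt i)) = 0.
Proof. unfold side_height, orient. split; ring. Qed.

Lemma nxt_neq (i : idx) : nxt i <> i.
Proof. destruct i; discriminate. Qed.

Section Quadrilateral.
Variable x : idx -> C.
Hypothesis Hx : ccw_convex x.

Lemma side_height_vertex_zero (i v : idx) :
  side_height x i (x v) = 0 -> v = i \/ v = nxt i.
Proof.
  intros H. destruct (idx_eq_dec v i); auto. destruct (idx_eq_dec v (nxt i)); auto.
  specialize (Hx i v n n0). unfold side_height in H. lra.
Qed.

Lemma side_height_vertex_nonneg (i v : idx) : 0 <= side_height x i (x v).
Proof.
  destruct (side_height_end x i) as [E1 E2].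
  destruct (idx_eq_dec v i) as [-> | ]; [lra | ]. destruct (idx_eq_dec v (nxt i)) as [-> | ]; [lra | ].
  left. now apply Hx.
Qed.

(** A vertex is determined by the two sides through it: [x i = x j] puts [x j] on both sides that
    contain [x i]. *)
Lemma vertices_injective (i j : idx) : x i = x j -> i = j.
Proof.
  intros E.
  assert (A : forall k, i = k \/ i = nxt k -> j = k \/ j = nxt k).
  { intros k Hk. apply side_height_vertex_zero. rewrite <- E.
    destruct (side_height_end x k). destruct Hk; subst; auto. }
  assert (B : forall k, nxt k = i -> j = k \/ j = nxt k) by (intros k Hk; apply A; auto).
  assert (D := A i (or_introl eq_refl)).
  destruct i, j; auto; destruct D as [D | D]; try discriminate D.
  - destruct (B i4 eq_refl); discriminate.
  - destruct (B i1 eq_refl); discriminate.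
  - destruct (B i2 eq_refl); discriminate.
  - destruct (B i3 eq_refl); discriminate.
Qed.

Lemma side_map_injective (i : idx) (u v : C) : side_map x i u = side_map x i v -> u = v.
Proof.
  unfold side_map. intros E.
  assert (N : (x (nxt i) - x i)%C <> 0).
  { apply Cminus_neq_0. intros E'. apply vertices_injective in E'. now apply (nxt_neq i). }
  assert (N' : Cconj (x (nxt i) - x i) <> 0).
  { intros E'. apply N. apply Cmod_eq_0. rewrite <- Cmod_conj, E'. apply Cmod_0. }
  apply NNPP. intros Nuv.
  assert (K : ((u - v) * Cconj (x (nxt i) - x i))%C = 0).
  { replace (u - v)%C with ((u - x i) - (v - x i))%C by ring.
    replace (((u - x i) - (v - x i)) * Cconj (x (nxt i) - x i))%C with
      ((u - x i) * Cconj (x (nxt i) - x i) - (v - x i) * Cconj (x (nxt i) - x i))%C by ring.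
    rewrite E. ring. }
  revert K. apply Cmult_neq_0; auto. now apply Cminus_neq_0.
Qed.

Lemma side_length_pos (i : idx) : 0 < Re (side_map x i (x (nxt i))).
Proof.
  replace (Re (side_map x i (x (nxt i)))) with (Cmod (x (nxt i) - x i) * Cmod (x (nxt i) - x i)).
  - assert (P : 0 < Cmod (x (nxt i) - x i)); [ | nra].
    apply Cmod_minus_0_iff. intros E'. apply vertices_injective in E'. now apply (nxt_neq i).
  - rewrite Cmod_sqr. simpl. ring.
Qed.

Lemma side_map_start (i : idx) : side_map x i (x i) = 0.
Proof. unfold side_map. ring. Qed.

Lemma side_height_combination (i : idx) (t1 t2 t3 t4 : R) :
  t1 + t2 + t3 + t4 = 1 ->
  side_height x i (t1 * x i1 + t2 * x i2 + t3 * x i3 + t4 * x i4)%C =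
  t1 * side_height x i (x i1) + t2 * side_height x i (x i2) +
  t3 * side_height x i (x i3) + t4 * side_height x i (x i4).
Proof.
  intros Ht. replace t4 with (1 - t1 - t2 - t3) by lra.
  unfold side_height, orient. simpl. unfold Re, Im. ring.
Qed.

Lemma quadrilateral_height_nonneg (i : idx) (u : C) :
  quadrilateral x u -> 0 <= side_height x i u.
Proof.
  intros [t1 [t2 [t3 [t4 [T1 [T2 [T3 [T4 [T ->]]]]]]]]].
  rewrite side_height_combination by auto.
  assert (N := side_height_vertex_nonneg i).
  assert (0 <= t1 * side_height x i (x i1)) by now apply Rmult_le_pos.
  assert (0 <= t2 * side_height x i (x i2)) by now apply Rmult_le_pos.
  assert (0 <= t3 * side_height x i (x i3)) by now apply Rmult_le_pos.
  assert (0 <= t4 * side_height x i (x i4)) by now apply Rmult_le_pos. lra.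
Qed.

(** By Cramer's rule the barycentric coordinates are quotients of signed areas. *)
Lemma triangle_barycentric (y1 y2 y3 u : C) :
  0 < orient y1 y2 y3 -> 0 <= orient y1 y2 u -> 0 <= orient y2 y3 u -> 0 <= orient y3 y1 u ->
  exists t1 t2 t3, 0 <= t1 /\ 0 <= t2 /\ 0 <= t3 /\ t1 + t2 + t3 = 1 /\
    u = (t1 * y1 + t2 * y2 + t3 * y3)%C.
Proof.
   set (A := orient y1 y2 y3) in *.
  exists (orient y2 y3 u / A), (orient y3 y1 u / A), (orient y1 y2 u / A).
  split; [ | split; [ | split]]; try now apply Rdiv_le_0_compat.
  split.
  - replace (orient y2 y3 u / A + orient y3 y1 u / A + orient y1 y2 u / A) with
      ((orient y2 y3 u + orient y3 y1 u + orient y1 y2 u) / A) by (field; lra).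
    replace (orient y2 y3 u + orient y3 y1 u + orient y1 y2 u) with A. field; lra.
    unfold A, orient. ring.
  - apply C_eq.
    + apply Rmult_eq_reg_r with A; [ | lra]. simpl.
      transitivity (orient y2 y3 u * Re y1 + orient y3 y1 u * Re y2 + orient y1 y2 u * Re y3);
        [unfold A, orient, Re, Im; ring | unfold Re, Im; field; lra].
    + apply Rmult_eq_reg_r with A; [ | lra]. simpl.
      transitivity (orient y2 y3 u * Im y1 + orient y3 y1 u * Im y2 + orient y1 y2 u * Im y3);
        [unfold A, orient, Re, Im; ring | unfold Re, Im; field; lra].
Qed.

(** The diagonal between [x i1] and [x i3] cuts the quadrilateral into two triangles, and the sign
    of [orient (x i3) (x i1) u] tells which of them contains [u]. *)
Lemma height_nonneg_quadrilateral (u : C) :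
  (forall i, 0 <= side_height x i u) -> quadrilateral x u.
Proof.
  intros H. unfold side_height in H.
  destruct (Rle_dec 0 (orient (x i3) (x i1) u)) as [D | D].
  - destruct (triangle_barycentric (x i1) (x i2) (x i3) u) as [t1 [t2 [t3 [T1 [T2 [T3 [T ->]]]]]]]; auto.
    { apply (Hx i1 i3); discriminate. }
    exists t1, t2, t3, 0. repeat split; auto; try lra. ring.
  - destruct (triangle_barycentric (x i1) (x i3) (x i4) u) as [t1 [t3 [t4 [T1 [T3 [T4 [T ->]]]]]]]; auto.
    { replace (orient (x i1) (x i3) (x i4)) with (orient (x i3) (x i4) (x i1)) by (unfold orient; ring).
      apply (Hx i3 i1); discriminate. }
    { replace (orient (x i1) (x i3) u) with (- orient (x i3) (x i1) u) by (unfold orient; ring). lra. }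
    exists t1, 0, t3, t4. repeat split; auto; try lra. ring.
Qed.

Lemma cont_side_height {U : UniformSpace} (i : idx) (f : U -> C) (z : U) :
  continuous (U := C_UniformSpace) f z -> continuous (fun y => side_height x i (f y)) z.
Proof.
  intros Hf. apply (continuous_ext (fun y => Im (side_map x i (f y)))).
  intros y. apply Im_side_map.
  apply cont_Im_comp. apply cont_mult; auto using cont_cconst.
  apply cont_minus; auto using cont_cconst.
Qed.

Lemma height_pos_interior (u : C) :
  (forall i, 0 < side_height x i u) -> Defs.interior (quadrilateral x) u.
Proof.
  intros H. unfold Defs.interior.
  assert (L : forall i, locally u (fun v => 0 < side_height x i v)).
  { intros i. assert (c : rcont (fun v : C => side_height x i v) u).
    { apply (cont_side_height i (fun v : C => v)), continuous_id. }
    apply (c (fun r => 0 < r)).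
    apply (open_gt 0). apply H. }
  assert (L' := filter_and _ _ (filter_and _ _ (L i1) (L i2)) (filter_and _ _ (L i3) (L i4))).
  revert L'. apply filter_imp. intros v [[A1 A2] [A3 A4]].
  apply height_nonneg_quadrilateral. intros i; left; destruct i; auto.
Qed.

(** From a point of height [0], any small displacement in the direction [- i n], with [n] the vector
    of the side, makes the height negative and leaves the quadrilateral. *)
Lemma interior_height_pos (i : idx) (u : C) :
  Defs.interior (quadrilateral x) u -> 0 < side_height x i u.
Proof.
  intros H. apply locally_C_Cmod in H. destruct H as [d [Hd H]].
  assert (Hu : 0 <= side_height x i u).
  { apply quadrilateral_height_nonneg, H. replace (u - u)%C with (RtoC 0) by ring. now rewrite Cmod_0. }
  destruct Hu as [ | E]; auto.
  set (n := (x (nxt i) - x i)%C).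
  assert (P : 0 < Cmod n).
  { apply Cmod_minus_0_iff. intros E'. apply vertices_injective in E'. now apply (nxt_neq i). }
  set (s := d / (2 * Cmod n)).
  assert (Hs : 0 < s) by (apply Rdiv_lt_0_compat; lra).
  assert (K := quadrilateral_height_nonneg i (u - RtoC s * (Ci * n))%C).
  assert (Q : side_height x i (u - RtoC s * (Ci * n))%C = side_height x i u - s * (Cmod n * Cmod n)).
  { rewrite Cmod_sqr. unfold side_height, orient, n. simpl. unfold Re, Im. ring. }
  rewrite Q, <- E in K.
  assert (0 < s * (Cmod n * Cmod n)) by (apply Rmult_lt_0_compat; [ | apply Rmult_lt_0_compat]; assumption).
  assert (0 <= 0 - s * (Cmod n * Cmod n)); [ | lra]. apply K, H.
  replace (u - RtoC s * (Ci * n) - u)%C with (- (RtoC s * (Ci * n)))%C by ring.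
  rewrite Cmod_opp, !Cmod_mult, Cmod_R, Rabs_pos_eq by lra.
  rewrite Cmod_Ci. replace (s * (1 * Cmod n)) with (d / 2) by (unfold s; field; lra). lra.
Qed.

(** A convex combination that lies on a side has weight [0] at the vertices off this side. Two sides
    have at most one vertex in common, so at most one weight survives. *)
Lemma two_sides_vertex (i j : idx) (u : C) :
  quadrilateral x u -> side_height x i u = 0 -> side_height x j u = 0 -> i <> j ->
  exists v, u = x v.
Proof.
  intros [t1 [t2 [t3 [t4 [T1 [T2 [T3 [T4 [T Eu]]]]]]]]] Hi Hj Nij.
  pose (t := fun v => match v with i1 => t1 | i2 => t2 | i3 => t3 | i4 => t4 end).
  assert (K : forall k, side_height x k u = 0 -> forall v, v <> k -> v <> nxt k -> t v = 0).
  { intros k Hk v N1 N2. rewrite Eu, side_height_combination in Hk by auto.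
    assert (N := side_height_vertex_nonneg k).
    assert (P1 := Rmult_le_pos _ _ T1 (N i1)). assert (P2 := Rmult_le_pos _ _ T2 (N i2)).
    assert (P3 := Rmult_le_pos _ _ T3 (N i3)). assert (P4 := Rmult_le_pos _ _ T4 (N i4)).
    assert (Z : t v * side_height x k (x v) = 0) by (destruct v; simpl; lra).
    apply Rmult_integral in Z. destruct Z as [Z | Z]; auto.
    apply side_height_vertex_zero in Z. tauto. }
  assert (Z : forall v, v <> i /\ v <> nxt i \/ v <> j /\ v <> nxt j -> t v = 0).
  { intros v [[A B] | [A B]]; eauto. }
  assert (Q : forall v, (forall v', v' <> v -> t v' = 0) -> u = x v).
  { intros v Hv. assert (V1 := Hv i1). assert (V2 := Hv i2). assert (V3 := Hv i3). assert (V4 := Hv i4).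
    simpl in V1, V2, V3, V4. rewrite Eu.
    destruct v.
    - rewrite V2, V3, V4 in * by discriminate. replace t1 with 1 by lra. ring.
    - rewrite V1, V3, V4 in * by discriminate. replace t2 with 1 by lra. ring.
    - rewrite V1, V2, V4 in * by discriminate. replace t3 with 1 by lra. ring.
    - rewrite V1, V2, V3 in * by discriminate. replace t4 with 1 by lra. ring. }
  assert (W : exists v, forall v', v' <> v -> v' <> i /\ v' <> nxt i \/ v' <> j /\ v' <> nxt j).
  (* The common vertex of two consecutive sides. Opposite sides have none, all weights are forced to
     vanish, and any index serves. *)
  { exists (if idx_eq_dec i (nxt j) then i else j).
     destruct i, j; simpl in *; try congruence; destruct v'; try congruence;
    (left; split; discriminate) || (right; split; discriminate). }
  destruct W as [v Hv]. exists v. auto.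
Qed.

End Quadrilateral.

(** * Paths in the boundary of a quadrilateral *)

Lemma continuous_neq_0_near (V : R -> R) (c : R) :
  continuous V c -> V c <> 0 -> exists d, 0 < d /\ forall s, Rabs (s - c) < d -> V s <> 0.
Proof.
  intros Hc N.
  destruct (Hc (fun v => v <> 0)) as [d Hd].
  { assert (P : 0 < Rabs (V c)) by now apply Rabs_pos_lt.
    exists (mkposreal _ P). intros v Hv E. change (Rabs (v - V c) < Rabs (V c)) in Hv.
    rewrite E, Rminus_0_l, Rabs_Ropp in Hv. lra. }
  exists d. split. apply cond_pos. now apply Hd.
Qed.

Lemma last_zero (V : R -> R) (a b : R) :
  a <= b -> (forall s, a <= s <= b -> continuous V s) -> V a = 0 -> V b <> 0 ->
  exists c, a <= c < b /\ V c = 0 /\ forall s, c < s <= b -> V s <> 0.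
Proof.
  intros Hab Hc Ha Hb.
  destruct (completeness (fun s => a <= s <= b /\ V s = 0)) as [c [C1 C2]].
  - exists b. intros s [Hs _]. lra.
  - exists a. lra.
  - assert (Hac : a <= c) by (apply C1; split; auto; lra).
    assert (Hcb : c <= b) by (apply C2; intros s [Hs _]; lra).
    assert (Z : V c = 0).
    { apply NNPP. intros N. destruct (continuous_neq_0_near V c) as [d [Hd H]]; auto.
      assert (c <= c - d); [ | lra]. apply C2. intros s [Hs Zs].
      apply Rnot_lt_le. intros L. apply (H s); auto.
      assert (s <= c) by (apply C1; auto). apply Rabs_def1; lra. }
    exists c. repeat split; auto.
    + destruct Hcb as [ | ->]; auto. contradiction.
    + intros s Hs E. assert (s <= c); [ | lra]. apply C1. lra.
Qed.

Lemma first_zero (V : R -> R) (a b : R) :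
  a <= b -> (forall s, a <= s <= b -> continuous V s) -> V a <> 0 -> V b = 0 ->
  exists c, a < c <= b /\ V c = 0 /\ forall s, a <= s < c -> V s <> 0.
Proof.
  intros Hab Hc Ha Hb.
  destruct (last_zero (fun s => V (- s)) (- b) (- a)) as [c [C1 [C2 C3]]]; try rewrite ?Ropp_involutive; auto.
  - lra.
  - intros s Hs. apply (continuous_comp Ropp V).
    apply (continuous_opp (V := R_NormedModule) (fun s => s)), continuous_id. apply Hc. lra.
  - exists (- c). repeat split; auto; try lra. intros s Hs. rewrite <- (Ropp_involutive s). apply C3. lra.
Qed.

Section BoundaryPath.
Variable x : idx -> C.
Hypothesis Hx : ccw_convex x.
Variable P : R -> C.
Hypothesis Pc : forall s, 0 <= s <= 1 -> continuous (U := C_UniformSpace) P s.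
Hypothesis Pb : forall s, 0 <= s <= 1 -> on_boundary x (P s).

(** One continuous function that vanishes exactly at the vertices, so that [last_zero] and
    [first_zero] find the visits of the path to vertices. *)
Let vdist (u : C) : R :=
  Cmod (u - x i1) * Cmod (u - x i2) * (Cmod (u - x i3) * Cmod (u - x i4)).

Lemma vdist_zero (u : C) : vdist u = 0 <-> exists v, u = x v.
Proof.
  unfold vdist. split.
  - intros H. assert (K : forall v, Cmod (u - x v) = 0 -> exists v, u = x v).
    { intros v Hv. exists v. apply Cmod_eq_0 in Hv. now apply Ceq_minus. }
    apply Rmult_integral in H. destruct H as [H | H]; apply Rmult_integral in H; destruct H; eauto.
  - intros [v ->]. assert (E : Cmod (x v - x v) = 0).
    { replace (x v - x v)%C with (RtoC 0) by ring. apply Cmod_0. }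
    destruct v; rewrite E; ring.
Qed.

Lemma vdist_path_cont (s : R) : 0 <= s <= 1 -> continuous (fun s => vdist (P s)) s.
Proof.
  intros Hs. assert (K : forall v, continuous (fun s => Cmod (P s - x v)) s).
  { intros v. apply (cont_Cmod (fun s => P s - x v)%C). apply cont_minus; auto using cont_cconst. }
   apply (cont_Rmult (fun s => Cmod (P s - x i1) * Cmod (P s - x i2))
    (fun s => Cmod (P s - x i3) * Cmod (P s - x i4))).
  - apply (cont_Rmult (fun s => Cmod (P s - x i1)) (fun s => Cmod (P s - x i2))); auto.
  - apply (cont_Rmult (fun s => Cmod (P s - x i3)) (fun s => Cmod (P s - x i4))); auto.
Qed.

Lemma boundary_quadrilateral (u : C) : on_boundary x u -> quadrilateral x u.
Proof. intros [H _]. now apply height_nonneg_quadrilateral. Qed.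

(** Sides meet only in vertices. At the last time [c] on side [j] before a supposed departure all
    other heights are nonzero and remain so for a while, whereas just after [c] the path has to lie
    on some side. *)
Lemma path_stays_on_side (a b : R) (j : idx) :
  0 <= a -> a <= b -> b <= 1 -> (forall s, a <= s <= b -> vdist (P s) <> 0) ->
  side_height x j (P a) = 0 -> side_height x j (P b) = 0.
Proof.
  intros Ha Hab Hb Hv Hj. apply NNPP. intros N.
  destruct (last_zero (fun s => side_height x j (P s)) a b) as [c [C1 [C2 C3]]]; auto.
  { intros s Hs. apply cont_side_height, Pc. lra. }
  pose (D := fun i : idx => if idx_eq_dec i j then 1 else side_height x i (P c)).
  assert (HD : forall i, D i <> 0).
  { intros i. unfold D. destruct (idx_eq_dec i j). lra. intros E.
    apply (Hv c). lra. apply vdist_zero.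
    apply (two_sides_vertex x Hx i j); auto. apply boundary_quadrilateral, Pb. lra. }
  assert (K : forall i, exists d, 0 < d /\ forall s, c < s <= b -> s < c + d -> side_height x i (P s) <> 0).
  { intros i. destruct (idx_eq_dec i j) as [-> | Nij].
    - exists 1. split. lra. intros s Hs _. now apply C3.
    - specialize (HD i). unfold D in HD. destruct (idx_eq_dec i j); [contradiction | ].
      destruct (continuous_neq_0_near (fun s => side_height x i (P s)) c) as [d [Hd H]]; auto.
      { apply cont_side_height, Pc. lra. }
      exists d. split; auto. intros s Hs L. apply H. apply Rabs_def1; lra. }
  destruct (K i1) as [d1 [P1 H1]]. destruct (K i2) as [d2 [P2 H2]].
  destruct (K i3) as [d3 [P3 H3]]. destruct (K i4) as [d4 [P4 H4]].
  destruct (pos_below4 d1 d2 d3 d4) as [m' [Hm' Lm']]; auto.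
  destruct (pos_below2 m' (b - c)) as [m [Hm Lm]]; auto. lra.
  destruct (Pb (c + m / 2)) as [_ [i Hi]]. lra.
  destruct i; [apply (H1 (c + m / 2)) | apply (H2 (c + m / 2)) | apply (H3 (c + m / 2)) | apply (H4 (c + m / 2))];
    auto; lra.
Qed.

(** The interval between the last visit to a vertex before [t] and the first one after [t]. Inside
    it the path cannot change sides, and continuity extends this to its ends, which are therefore
    vertices of side [j]. *)
Lemma path_gap (t : R) (j : idx) :
  (exists v, P 0 = x v) -> (exists v, P 1 = x v) -> 0 <= t <= 1 ->
  ~ (exists v, P t = x v) -> side_height x j (P t) = 0 ->
  exists a b, 0 <= a /\ a < t /\ t < b /\ b <= 1 /\
    (forall s, a <= s <= b -> side_height x j (P s) = 0) /\
    (P a = x j \/ P a = x (nxt j)) /\ (P b = x j \/ P b = x (nxt j)).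
Proof.
  intros H0 H1 Ht Nt Hj.
  assert (Nt' : vdist (P t) <> 0) by now rewrite vdist_zero.
  destruct (last_zero (fun s => vdist (P s)) 0 t) as [a [A1 [A2 A3]]]; auto; try lra.
  { intros s Hs. apply vdist_path_cont. lra. } { now apply vdist_zero. }
  destruct (first_zero (fun s => vdist (P s)) t 1) as [b [B1 [B2 B3]]]; auto; try lra.
  { intros s Hs. apply vdist_path_cont. lra. } { now apply vdist_zero. }
  exists a, b.
  assert (Hin : forall s, a < s < b -> side_height x j (P s) = 0).
  { intros s Hs. destruct (Rle_dec t s) as [L | L].
    - apply (path_stays_on_side t s); auto; try lra. intros r Hr.
      apply B3; lra.
    - apply NNPP. intros N. destruct (Pb s) as [_ [i Hi]]. lra.
      assert (E := path_stays_on_side s t i ltac:(lra) ltac:(lra) ltac:(lra)).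
      specialize (E ltac:(intros r Hr; apply A3; lra) Hi).
      destruct (idx_eq_dec i j) as [-> | Nij]. contradiction.
      apply Nt. apply (two_sides_vertex x Hx i j); auto. apply boundary_quadrilateral, Pb. lra. }
  assert (Hcl : forall s, a <= s <= b -> side_height x j (P s) = 0).
  { intros s Hs. destruct (classic (a < s < b)) as [I | I]; auto.
    apply NNPP. intros N.
    destruct (continuous_neq_0_near (fun s => side_height x j (P s)) s) as [d [Hd H]]; auto.
    { apply cont_side_height, Pc. lra. }
    destruct (pos_below2 d (b - a)) as [m [L3 [L1 L2]]]; auto. lra.
    assert (E : s = a \/ s = b) by lra. destruct E as [-> | ->].
    - apply (H (a + m / 2)). apply Rabs_def1; lra. apply Hin. lra.
    - apply (H (b - m / 2)). apply Rabs_def1; lra. apply Hin. lra. }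
  assert (Hend : forall s, a <= s <= b -> vdist (P s) = 0 -> P s = x j \/ P s = x (nxt j)).
  { intros s Hs Z. apply vdist_zero in Z. destruct Z as [v Z].
    specialize (Hcl s Hs). rewrite Z in Hcl.
    apply side_height_vertex_zero in Hcl; auto. destruct Hcl; subst; auto. }
  repeat split; try lra; auto; apply Hend; auto; lra.
Qed.

(** The distance to the first vertex takes every intermediate value, in particular one smaller than
    the distance to any other vertex. *)
Lemma path_leaves_vertices (v v' : idx) :
  P 0 = x v -> P 1 = x v' -> v <> v' -> exists t, 0 < t < 1 /\ ~ exists u, P t = x u.
Proof.
  intros H0 H1 N.
  destruct (idx_positive_lower_bound (fun u => Cmod (x u - x v)) (fun u => u <> v)) as [e [He H]].
  { intros u Nu. apply Cmod_minus_0_iff. intros E. apply vertices_injective in E; auto. }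
  destruct (IVT_between (fun s => Cmod (P s - x v)) 0 1 e) as [t [Ht Et]]; try lra.
  - intros s Hs. apply (cont_Cmod (fun s => P s - x v)%C). apply cont_minus; auto using cont_cconst.
  - rewrite H0, H1. replace (x v - x v)%C with (RtoC 0) by ring. rewrite Cmod_0.
    specialize (H v' (not_eq_sym N)). nra.
  - exists t. split; auto. intros [u Hu]. rewrite Hu in Et.
    destruct (idx_eq_dec u v) as [-> | Nu].
    + replace (x v - x v)%C with (RtoC 0) in Et by ring. rewrite Cmod_0 in Et. lra.
    + specialize (H u Nu). lra.
Qed.

(** Otherwise the height over side [j] would take a positive value below all nonzero heights of
    vertices, at a point that is neither a vertex nor on the side. *)
Lemma path_on_one_side (j : idx) (t0 : R) :
  0 <= t0 <= 1 -> side_height x j (P t0) = 0 ->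
  (forall s, 0 <= s <= 1 -> (exists v, P s = x v) \/ side_height x j (P s) = 0) ->
  forall s, 0 <= s <= 1 -> side_height x j (P s) = 0.
Proof.
  intros Ht0 Z0 H s Hs. apply NNPP. intros N.
  assert (N' : 0 < side_height x j (P s)).
  { destruct (Pb s Hs) as [Q _]. specialize (Q j). lra. }
  destruct (idx_positive_lower_bound (fun u => side_height x j (x u)) (fun u => side_height x j (x u) <> 0)) as [e [He HE]].
  { intros u Nu. assert (Q := side_height_vertex_nonneg x Hx j u). lra. }
  destruct (pos_below2 e (side_height x j (P s) / 2)) as [e' [L3 [L1 L2]]]; auto. lra.
  assert (K : exists r, 0 <= r <= 1 /\ side_height x j (P r) = e').
  { destruct (Rtotal_order t0 s) as [L | [-> | L]]; [ | lra | ].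
    - destruct (IVT_between (fun s => side_height x j (P s)) t0 s e') as [r [Hr Er]]; auto.
      { intros r Hr. apply cont_side_height, Pc. lra. } { nra. } exists r. lra.
    - destruct (IVT_between (fun s => side_height x j (P s)) s t0 e') as [r [Hr Er]]; auto.
      { intros r Hr. apply cont_side_height, Pc. lra. } { nra. } exists r. lra. }
  destruct K as [r [Hr Er]]. destruct (H r Hr) as [[v Hv] | Z]; [ | lra].
  rewrite Hv in Er. assert (Nz : side_height x j (x v) <> 0) by lra. specialize (HE v Nz). lra.
Qed.

End BoundaryPath.

Definition side_mid (x : idx -> C) (j : idx) : R := Re (side_map x j (x (nxt j))) / 2.

(** The bounds [0 < a] and [b < 1] keep the crossing off the ends of the arc, one of which may be
    infinity. *)
Definition crosses (x : idx -> C) (P : R -> C) (j : idx) (q a b : R) : Prop :=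
  0 < a /\ a < b /\ b < 1 /\ (forall s, a <= s <= b -> side_height x j (P s) = 0) /\
  (Re (side_map x j (P a)) - q) * (Re (side_map x j (P b)) - q) < 0.

Lemma cont_side_map {U : UniformSpace} (x : idx -> C) (j : idx) (f : U -> C) (z : U) :
  continuous (U := C_UniformSpace) f z -> continuous (U := C_UniformSpace) (fun y => side_map x j (f y)) z.
Proof.
  intros Hf. apply cont_mult; auto using cont_cconst.
  apply cont_minus; auto using cont_cconst.
Qed.

Lemma crosses_shrink (x : idx -> C) (P : R -> C) (j : idx) (q a b : R) :
  (forall s, 0 <= s <= 1 -> continuous (U := C_UniformSpace) P s) ->
  0 <= a -> a < b -> b <= 1 -> (forall s, a <= s <= b -> side_height x j (P s) = 0) ->
  (Re (side_map x j (P a)) - q) * (Re (side_map x j (P b)) - q) < 0 ->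
  exists a' b', crosses x P j q a' b' /\ a < a' /\ b' < b.
Proof.
  intros Pc Ha Hab Hb Hs Hq.
  destruct (sign_change_shrink (fun s => Re (side_map x j (P s))) a b q) as [a' [b' [L1 [L2 [L3 Hq']]]]]; auto.
  - apply cont_Re_comp, cont_side_map, Pc. lra.
  - apply cont_Re_comp, cont_side_map, Pc. lra.
  - exists a', b'. repeat split; auto; try lra. intros s Hs'. apply Hs. lra.
Qed.

(** Between two successive visits to vertices the path stays on side [j]. A return to the same
    vertex would cross a value between this vertex and [P t] on the way out and again on the way
    back, which the hypothesis on crossings forbids; so the path joins both ends of the side and
    passes its midpoint. *)
Lemma path_crosses_side (x : idx -> C) (P : R -> C) (t : R) (j : idx) :
  ccw_convex x ->
  (forall s, 0 <= s <= 1 -> continuous (U := C_UniformSpace) P s) ->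
  (forall s, 0 <= s <= 1 -> on_boundary x (P s)) ->
  (forall q a b a' b', crosses x P j q a b -> crosses x P j q a' b' -> b <= a' -> False) ->
  (exists v, P 0 = x v) -> (exists v, P 1 = x v) -> 0 <= t <= 1 ->
  ~ (exists v, P t = x v) -> side_height x j (P t) = 0 ->
  exists a b, crosses x P j (side_mid x j) a b.
Proof.
  intros Hx Pc Pb Hno H0 H1 Ht Nt Hj.
  destruct (path_gap x Hx P Pc Pb t j) as [a [b [A1 [A2 [A3 [A4 [A5 [A6 A7]]]]]]]]; auto.
  assert (Hneq : forall v, Re (side_map x j (P t)) <> Re (side_map x j (x v)) \/
            side_height x j (x v) <> 0).
  { intros v. destruct (Req_dec (side_height x j (x v)) 0) as [Z | Z]; auto. left. intros E.
    apply Nt. exists v. apply (side_map_injective x Hx j). apply C_eq; auto.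
    rewrite !Im_side_map. congruence. }
  destruct (side_height_end x j) as [E1 E2].
  assert (Same : P a <> P b).
  { intros E. set (r := Re (side_map x j (P t))). set (v0 := Re (side_map x j (P a))).
    assert (Nr : r <> v0).
    { unfold r, v0. destruct A6 as [A6 | A6]; rewrite A6.
      destruct (Hneq j); auto; lra. destruct (Hneq (nxt j)); auto; lra. }
    assert (Q : (v0 - (r + v0) / 2) * (r - (r + v0) / 2) < 0).
    { nra. }
    destruct (crosses_shrink x P j ((r + v0) / 2) a t) as [c [d [K1 [K2 K3]]]]; auto; try lra.
    { intros s Hs. apply A5. lra. }
    destruct (crosses_shrink x P j ((r + v0) / 2) t b) as [c' [d' [K1' [K2' K3']]]]; auto; try lra.
    { intros s Hs. apply A5. lra. }
    { rewrite <- E. fold r v0. lra. }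
    apply (Hno _ _ _ _ _ K1 K1'). lra. }
  assert (L := side_length_pos x Hx j).
  assert (S : Re (side_map x j (x j)) = 0) by (rewrite side_map_start; reflexivity).
  destruct (crosses_shrink x P j (side_mid x j) a b) as [c [d [K _]]]; eauto; try lra.
  unfold side_mid. destruct A6 as [A6 | A6], A7 as [A7 | A7]; rewrite A6, A7 in *; try congruence; rewrite S; nra.
Qed.

(** * Boundary correspondence *)

(** Indexed by the vertex at which the image of the arc starts, so that it should lie on the line with index [nxt k]. *)
Definition arc (z4 : R) (k : idx) (t : R) : Prop :=
  match k with
  | i1 => 1 <= t | i2 => t <= 0 | i3 => 0 <= t <= z4 | i4 => z4 <= t <= 1
  end.

(** Increasing in [s] for every [k]. Infinity corresponds to [s = 1] for [i1] and to [s = 0] for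
    [i2], where division by zero returns a meaningless value that [arc_path] overrides. *)
Definition arc_param (z4 : R) (k : idx) (s : R) : R :=
  match k with
  | i1 => / (1 - s) | i2 => 1 - / s | i3 => z4 * s | i4 => z4 + (1 - z4) * s
  end.

Lemma arc_param_increasing (z4 : R) (k : idx) (s t : R) :
  0 < z4 < 1 -> 0 < s -> s < t -> t < 1 -> arc_param z4 k s < arc_param z4 k t.
Proof.
  intros Hz Hs Hst Ht. destruct k; simpl.
  - apply Rinv_lt_contravar; [apply Rmult_lt_0_compat | ]; lra.
  - assert (/ t < / s) by (apply Rinv_lt_contravar; [apply Rmult_lt_0_compat | ]; lra). lra.
  - apply Rmult_lt_compat_l; lra.
  - apply Rplus_lt_compat_l, Rmult_lt_compat_l; lra.
Qed.

Lemma arc_param_range (z4 : R) (k : idx) (s : R) :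
  0 < z4 < 1 -> 0 < s < 1 ->
  match k with
  | i1 => 1 < arc_param z4 k s | i2 => arc_param z4 k s < 0
  | i3 => 0 < arc_param z4 k s < z4 | i4 => z4 < arc_param z4 k s < 1
  end.
Proof.
  intros Hz Hs. destruct k; simpl.
  - rewrite <- Rinv_1 at 1. apply Rinv_lt_contravar; lra.
  - assert (/ 1 < / s) by (apply Rinv_lt_contravar; lra). lra.
  - nra.
  - nra.
Qed.

Lemma arc_param_cont (z4 : R) (k : idx) (s : R) :
  s <> 0 \/ k <> i2 -> s <> 1 \/ k <> i1 -> continuous (arc_param z4 k) s.
Proof.
  intros H0 H1.
  assert (I : continuous (fun s : R => s) s) by apply continuous_id.
  assert (C : forall c : R, continuous (fun _ : R => c) s) by (intros; apply continuous_const).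
  destruct k; unfold arc_param.
  - apply (cont_Rinv (fun s => 1 - s)). apply (cont_Rminus (fun _ => 1)); auto.
    destruct H1; [lra | congruence].
  - apply (cont_Rminus (fun _ => 1) (fun s => / s)); auto. apply cont_Rinv; auto.
    destruct H0; [lra | congruence].
  - apply (cont_Rmult (fun _ => z4)); auto.
  - apply (cont_Rplus (fun _ => z4) (fun s => (1 - z4) * s)); auto.
    apply (cont_Rmult (fun _ => 1 - z4)); auto.
Qed.

Lemma arc_param_surjective (z4 : R) (k : idx) (a b t : R) :
  0 < z4 < 1 -> 0 < a -> a < b -> b < 1 ->
  arc_param z4 k a <= t <= arc_param z4 k b ->
  exists s, a <= s <= b /\ arc_param z4 k s = t.
Proof.
  intros Hz Ha Hab Hb Ht.
  destruct (Req_dec (arc_param z4 k a) t) as [E | Na]. { exists a. lra. }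
  destruct (Req_dec (arc_param z4 k b) t) as [E | Nb]. { exists b. lra. }
  destruct (IVT_between (arc_param z4 k) a b t) as [s [Hs E]]; auto.
  - intros s Hs. apply arc_param_cont; left; lra.
  - assert (0 < (t - arc_param z4 k a) * (arc_param z4 k b - t)); [ | lra].
    apply Rmult_lt_0_compat; lra.
  - exists s. lra.
Qed.

Lemma arc_param_onto_arc (z4 : R) (k : idx) (t : R) :
  0 < z4 < 1 -> arc z4 k t ->
  exists s, 0 <= s <= 1 /\ (k = i1 -> s < 1) /\ (k = i2 -> 0 < s) /\ arc_param z4 k s = t.
Proof.
  intros Hz Ht. destruct k; simpl in Ht |- *.
  - assert (P : 0 < / t) by (apply Rinv_0_lt_compat; lra).
    assert (Q : / t <= 1) by (rewrite <- Rinv_1; apply Rinv_le_contravar; lra).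
    exists (1 - / t). repeat split; try lra; try discriminate.
    replace (1 - (1 - / t)) with (/ t) by ring. apply Rinv_inv.
  - assert (P : 0 < / (1 - t)) by (apply Rinv_0_lt_compat; lra).
    assert (Q : / (1 - t) <= 1) by (rewrite <- Rinv_1; apply Rinv_le_contravar; lra).
    exists (/ (1 - t)). repeat split; try lra; try discriminate. rewrite Rinv_inv. ring.
  - exists (t / z4). repeat split; try discriminate.
    apply Rdiv_le_0_compat; lra. apply Rle_div_l; lra. field; lra.
  - exists ((t - z4) / (1 - z4)). repeat split; try discriminate.
    apply Rdiv_le_0_compat; lra. apply Rle_div_l; lra. field; lra.
Qed.

Section Correspondence.
Variable x : idx -> C.
Hypothesis Hx : ccw_convex x.
Variable g : C -> C.
Variable z4 : R.
Hypothesis Hz4 : 0 < z4 < 1.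
Hypothesis gc : forall z, ccont g z.
Hypothesis gh : forall z, 0 < Im z -> exists l, holo g z l.
Hypothesis gi : forall z z', 0 < Im z -> 0 < Im z' -> g z = g z' -> z = z'.
Hypothesis gU : forall u, Defs.interior (quadrilateral x) u <-> exists z, 0 < Im z /\ g z = u.
Hypothesis ginf : forall e, 0 < e -> exists M, forall z, 0 <= Im z -> M < Cmod z -> Cmod (g z - x i2) < e.
Hypothesis g1 : g (1, 0) = x i1.
Hypothesis g0 : g (0, 0) = x i3.
Hypothesis g4 : g (z4, 0) = x i4.

Lemma side_height_image_pos (j : idx) (z : C) : 0 < Im z -> 0 < side_height x j (g z).
Proof. intros Hz. apply interior_height_pos; auto. apply gU. eauto. Qed.

(** Heights of boundary values are limits of positive heights. If none vanished, the value would be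
    interior, hence attained in the half plane, against [boundary_avoids_image]. *)
Lemma real_points_on_boundary (t : R) : on_boundary x (g (t, 0)).
Proof.
  assert (H : forall j, 0 <= side_height x j (g (t, 0))).
  { intros j. apply Rnot_lt_le. intros N.
    assert (Cj : rcont (fun z => side_height x j (g z)) (t, 0)) by apply cont_side_height, gc.
    destruct (proj1 (rcont_Cmod _ _) Cj (- side_height x j (g (t, 0)))) as [d [Hd H]]. lra.
    specialize (H (t, d / 2)).
    assert (P := side_height_image_pos j (t, d / 2) ltac:(simpl; lra)).
    assert (K : Cmod ((t, d / 2) - (t, 0)) < d).
    { rewrite Cmod_vertical, Rabs_pos_eq; lra. }
    specialize (H K). apply Rabs_def2 in H. lra. }
  split; auto. apply NNPP. intros N.
  assert (I : Defs.interior (quadrilateral x) (g (t, 0))).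
  { apply height_pos_interior; auto. intros i. destruct (H i) as [ | E]; auto.
    exfalso. apply N. exists i. auto. }
  apply gU in I. destruct I as [z0 [Hz0 E]].
  apply (boundary_avoids_image g t z0); auto.
Qed.

(** Filling in [x i2] at the parameter of infinity makes all four arcs continuous paths over the
    closed unit interval. *)
Definition arc_path (k : idx) (s : R) : C :=
  match k with
  | i1 => if Rlt_dec s 1 then g (arc_param z4 k s, 0) else x i2
  | i2 => if Rlt_dec 0 s then g (arc_param z4 k s, 0) else x i2
  | _ => g (arc_param z4 k s, 0)
  end.

Lemma arc_path_eq (k : idx) (s : R) :
  (k = i1 -> s < 1) -> (k = i2 -> 0 < s) -> arc_path k s = g (arc_param z4 k s, 0).
Proof.
  intros H1 H2. unfold arc_path. destruct k; auto.
  destruct (Rlt_dec s 1); auto. exfalso; auto.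
  destruct (Rlt_dec 0 s); auto. exfalso; auto.
Qed.

Lemma arc_path_boundary (k : idx) (s : R) : on_boundary x (arc_path k s).
Proof.
  assert (V : forall v, on_boundary x (x v)).
  { split. intros i. now apply side_height_vertex_nonneg.
    exists v. apply side_height_end. }
  unfold arc_path. destruct k; try destruct (Rlt_dec _ _); auto using real_points_on_boundary.
Qed.

Lemma arc_path_cont_at_infinity (u : R -> R) (P : R -> C) (s0 : R) :
  P s0 = x i2 ->
  (forall M, exists d, 0 < d /\ forall s, Rabs (s - s0) < d -> P s = x i2 \/ P s = g (u s, 0) /\ M < Rabs (u s)) ->
  continuous (U := C_UniformSpace) P s0.
Proof.
  intros E H Q HQ. rewrite E in HQ. apply locally_C_Cmod in HQ. destruct HQ as [e [He HQ]].
  destruct (ginf e He) as [M HM]. destruct (H M) as [d [Hd Hs]].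
  exists (mkposreal d Hd). intros s Bs. apply HQ.
  destruct (Hs s Bs) as [-> | [-> L]].
  - replace (x i2 - x i2)%C with (RtoC 0) by ring. now rewrite Cmod_0.
  - apply HM. simpl; lra. apply Rlt_le_trans with (1 := L). apply (Re_le_Cmod (u s, 0)).
Qed.

Lemma arc_path_cont (k : idx) (s : R) : 0 <= s <= 1 -> continuous (U := C_UniformSpace) (arc_path k) s.
Proof.
  intros Hs.
  assert (K : s <> 0 \/ k <> i2 -> s <> 1 \/ k <> i1 ->
    continuous (U := C_UniformSpace) (fun s => g (arc_param z4 k s, 0)) s).
  { intros A B. apply (continuous_comp (arc_param z4 k) (fun t => g (t, 0))).
    now apply arc_param_cont. apply cont_bottom, gc. }
  destruct k.
  - destruct (Req_dec s 1) as [-> | N].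
    + apply (arc_path_cont_at_infinity (arc_param z4 i1)).
      unfold arc_path. destruct (Rlt_dec 1 1); auto; lra.
      intros M. assert (P : 0 < Rabs M + 1) by (assert (Q := Rabs_pos M); lra).
      exists (/ (Rabs M + 1)). split. now apply Rinv_0_lt_compat.
      intros s L. unfold arc_path. destruct (Rlt_dec s 1); auto. right. split; auto.
      apply Rabs_def2 in L. simpl. apply Rlt_le_trans with (2 := RRle_abs _).
      apply Rle_lt_trans with (1 := RRle_abs _).
      assert (Rabs M + 1 < / (1 - s)); [ | lra].
      rewrite <- (Rinv_inv (Rabs M + 1)). apply Rinv_lt_contravar; [ | lra].
      apply Rmult_lt_0_compat. lra. now apply Rinv_0_lt_compat.
    + apply (continuous_ext_loc (U := C_UniformSpace) _ (fun s => g (arc_param z4 i1 s, 0))).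
      2: { apply K; auto. right; discriminate. }
      assert (P : 0 < 1 - s) by lra. exists (mkposreal _ P). intros y Hy.
      apply Rabs_def2 in Hy. unfold minus, plus, opp in Hy; simpl in Hy.
      symmetry. apply arc_path_eq; intros; [lra | discriminate].
  - destruct (Req_dec s 0) as [-> | N].
    + apply (arc_path_cont_at_infinity (arc_param z4 i2)).
      unfold arc_path. destruct (Rlt_dec 0 0); auto; lra.
      intros M. assert (P : 0 < Rabs M + 1) by (assert (Q := Rabs_pos M); lra).
      (* One more than for [i1], because the parameter is [1 - / s] instead of a reciprocal. *)
      exists (/ (Rabs M + 2)). split. apply Rinv_0_lt_compat; lra.
      intros s L. unfold arc_path. destruct (Rlt_dec 0 s); auto. right. split; auto.
       apply Rabs_def2 in L. simpl.
      rewrite Rabs_minus_sym. apply Rlt_le_trans with (2 := RRle_abs _).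
      apply Rle_lt_trans with (1 := RRle_abs _).
      assert (Rabs M + 2 < / s); [ | lra].
      rewrite <- (Rinv_inv (Rabs M + 2)). apply Rinv_lt_contravar; [ | lra].
      apply Rmult_lt_0_compat. lra. apply Rinv_0_lt_compat; lra.
    + apply (continuous_ext_loc (U := C_UniformSpace) _ (fun s => g (arc_param z4 i2 s, 0))).
      2: { apply K; auto. right; discriminate. }
      assert (P : 0 < s) by lra. exists (mkposreal _ P). intros y Hy.
      apply Rabs_def2 in Hy. unfold minus, plus, opp in Hy; simpl in Hy.
      symmetry. apply arc_path_eq; intros; [discriminate | lra].
  - apply K; right; discriminate.
  - apply K; right; discriminate.
Qed.

Lemma arc_path_start (k : idx) : arc_path k 0 = x k.
Proof.
  unfold arc_path, arc_param. destruct k.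
  - destruct (Rlt_dec 0 1); [ | lra]. rewrite Rminus_0_r, Rinv_1. exact g1.
  - destruct (Rlt_dec 0 0); auto; lra.
  - rewrite Rmult_0_r. exact g0.
  - rewrite Rmult_0_r, Rplus_0_r. exact g4.
Qed.

Lemma arc_path_end (k : idx) : arc_path k 1 = x (nxt k).
Proof.
  unfold arc_path, arc_param. destruct k; simpl nxt.
  - destruct (Rlt_dec 1 1); auto; lra.
  - destruct (Rlt_dec 0 1); [ | lra]. rewrite Rinv_1, Rminus_diag. exact g0.
  - rewrite Rmult_1_r. exact g4.
  - replace (z4 + (1 - z4) * 1) with 1 by ring. exact g1.
Qed.

Lemma crossing_on_real_line (k j : idx) (q a b : R) :
  crosses x (arc_path k) j q a b ->
  arc_param z4 k a < arc_param z4 k b /\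
  (forall t, arc_param z4 k a <= t <= arc_param z4 k b -> Im (side_map x j (g (t, 0))) = 0) /\
  (Re (side_map x j (g (arc_param z4 k a, 0))) - q) * (Re (side_map x j (g (arc_param z4 k b, 0))) - q) < 0.
Proof.
  intros [A1 [A2 [A3 [A4 A5]]]].
  assert (E : forall s, a <= s <= b -> arc_path k s = g (arc_param z4 k s, 0)).
  { intros s Hs. apply arc_path_eq; intros; lra. }
  split; [ | split].
  - apply arc_param_increasing; auto.
  - intros t Ht. destruct (arc_param_surjective z4 k a b t) as [s [Hs <-]]; auto.
    rewrite Im_side_map, <- E; auto.
  - rewrite <- !E; auto; lra.
Qed.

(** Real intervals that do not overlap are excluded by [no_double_crossing]. Overlap cannot occur
    either: the open arcs are disjoint, and on a single arc the parametrisation is increasing. *)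
Lemma crossings_disjoint (k k' j : idx) (q a b a' b' : R) :
  crosses x (arc_path k) j q a b -> crosses x (arc_path k') j q a' b' ->
  k <> k' \/ b <= a' -> False.
Proof.
  intros K K' H.
  assert (No : forall A B A' B', A < B -> B <= A' -> A' < B' ->
    (forall t, A <= t <= B -> Im (side_map x j (g (t, 0))) = 0) ->
    (forall t, A' <= t <= B' -> Im (side_map x j (g (t, 0))) = 0) ->
    (Re (side_map x j (g (A, 0))) - q) * (Re (side_map x j (g (B, 0))) - q) < 0 ->
    (Re (side_map x j (g (A', 0))) - q) * (Re (side_map x j (g (B', 0))) - q) < 0 -> False).
  { intros A B A' B' L1 L2 L3 S S' Q Q'.
    apply (no_double_crossing (fun z => side_map x j (g z)) A B A' B' q); auto.
    - intros z. apply cont_side_map, gc.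
    - intros z Hz. split.
      + destruct (gh z Hz) as [l Hl]. eexists.
        apply (holo_mult (fun z => g z - x j)%C (fun _ => Cconj (x (nxt j) - x j))).
        apply holo_minus. exact Hl. apply holo_const. apply holo_const.
      + rewrite Im_side_map. now apply side_height_image_pos.
    - intros z z' Hz Hz' E. apply side_map_injective in E; auto. }
  destruct (crossing_on_real_line _ _ _ _ _ K) as [L [S Q]].
  destruct (crossing_on_real_line _ _ _ _ _ K') as [L' [S' Q']].
  destruct K as [A1 [A2 [A3 _]]]. destruct K' as [A1' [A2' [A3' _]]].
  destruct (Rle_dec (arc_param z4 k b) (arc_param z4 k' a')) as [O | O].
  { apply (No _ _ _ _ L O L' S S' Q Q'). }
  destruct (Rle_dec (arc_param z4 k' b') (arc_param z4 k a)) as [O' | O'].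
  { apply (No _ _ _ _ L' O' L S' S Q' Q). }
  destruct (idx_eq_dec k k') as [<- | N].
  - destruct H as [H | [H | ->]]; [congruence | | lra].
    assert (arc_param z4 k b < arc_param z4 k a') by (apply arc_param_increasing; lra). lra.
  - assert (R1 := arc_param_range z4 k a Hz4 ltac:(lra)). assert (R2 := arc_param_range z4 k b Hz4 ltac:(lra)).
    assert (R3 := arc_param_range z4 k' a' Hz4 ltac:(lra)). assert (R4 := arc_param_range z4 k' b' Hz4 ltac:(lra)).
    destruct k, k'; try congruence; lra.
Qed.

Lemma arc_crosses (k j : idx) (s : R) :
  0 <= s <= 1 -> ~ (exists v, arc_path k s = x v) -> side_height x j (arc_path k s) = 0 ->
  exists a b, crosses x (arc_path k) j (side_mid x j) a b.
Proof.
  intros Hs Ns Hj. apply path_crosses_side with s; auto.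
  - now apply arc_path_cont.
  - intros r _. apply arc_path_boundary.
  - intros q a b a' b' K K' L. apply (crossings_disjoint k k j q a b a' b'); auto.
  - eexists. apply arc_path_start.
  - eexists. apply arc_path_end.
Qed.

(** Each arc crosses the midpoint of some side [sigma k], and no midpoint is crossed by two arcs. So
    [sigma] is injective on four indices, hence onto; every side is used up and no arc can touch a
    second one outside the vertices. *)
Theorem boundary_correspondence (k : idx) (t : R) :
  arc z4 k t -> side_height x k (g (t, 0)) = 0.
Proof.
  assert (E : forall k, exists j, exists a b, crosses x (arc_path k) j (side_mid x j) a b).
  { intros k'. destruct (path_leaves_vertices x Hx (arc_path k') (arc_path_cont k') k' (nxt k'))
      as [s [Hs Ns]]; auto using arc_path_start, arc_path_end.
    { apply not_eq_sym, nxt_neq. }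
    destruct (arc_path_boundary k' s) as [_ [j Hj]]. exists j. apply (arc_crosses k' j s); auto. lra. }
  apply choice in E. destruct E as [sigma Hs].
  assert (U : forall k k' j, (exists a b, crosses x (arc_path k) j (side_mid x j) a b) ->
    (exists a b, crosses x (arc_path k') j (side_mid x j) a b) -> k = k').
  { intros k1 k2 j [a [b K]] [a' [b' K']]. apply NNPP. intros N.
    apply (crossings_disjoint _ _ _ _ _ _ _ _ K K'). auto. }
  assert (Hinj : forall i j, sigma i = sigma j -> i = j).
  { intros i j Eij. apply (U i j (sigma i)); auto. rewrite Eij. auto. }
  assert (Uniq : forall j, (exists a b, crosses x (arc_path k) j (side_mid x j) a b) -> j = sigma k).
  { intros j K. destruct (idx_injective_surjective sigma Hinj j) as [k' <-]. f_equal.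
    apply (U k' k (sigma k')); auto. }
  assert (Side : forall s, 0 <= s <= 1 -> side_height x (sigma k) (arc_path k s) = 0).
  { destruct (Hs k) as [a [b [A1 [A2 [A3 [A4 _]]]]]].
    apply (path_on_one_side x Hx (arc_path k) (arc_path_cont k)) with (t0 := a); auto.
    - intros; apply arc_path_boundary.
    - lra.
    - apply A4. lra.
    - intros s Hss. destruct (classic (exists v, arc_path k s = x v)) as [V | V]; auto.
      destruct (arc_path_boundary k s) as [_ [j Hj]].
      rewrite <- (Uniq j); auto. apply (arc_crosses k j s); auto. }
  (* Side [sigma k] contains the two ends [x k] and [x (nxt k)] of the path, and only side [k]
     contains both. *)
  assert (Ek : sigma k = k).
  { assert (S0 := Side 0 ltac:(lra)). assert (S1 := Side 1 ltac:(lra)).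
    rewrite arc_path_start in S0. rewrite arc_path_end in S1.
    apply side_height_vertex_zero in S0; auto. apply side_height_vertex_zero in S1; auto.
    destruct S0 as [S0 | S0]; auto. revert S0 S1. generalize (sigma k).
    intros m -> S1. destruct m, S1; discriminate. }
  intros Ht. destruct (arc_param_onto_arc z4 k t Hz4 Ht) as [s [S1 [S2 [S3 <-]]]].
  rewrite <- arc_path_eq by auto. rewrite <- Ek at 1. auto.
Qed.

End Correspondence.

(** * Lipschitz bounds and a linear ODE *)

Lemma holo_is_derive_Re (H : C -> C) (s : R) (m : C) :
  holo H (RtoC s) m -> is_derive (fun r : R => Re (H (RtoC r))) s (Re m).
Proof.
  intros Hh. apply is_derive_Reals. intros e He.
  destruct (holo_elim _ _ _ Hh (e / 2)) as [d [Hd K]]. lra.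
  exists (mkposreal d Hd). intros h Nh Lh.
  assert (Ph : 0 < Rabs h) by now apply Rabs_pos_lt.
  assert (E : (RtoC (s + h) - RtoC s)%C = RtoC h) by (rewrite RtoC_plus; ring).
  specialize (K (RtoC (s + h))). rewrite E, Cmod_R in K. specialize (K Lh).
  assert (R1 := Rle_trans _ _ _ (Re_le_Cmod _) K).
  replace ((Re (H (RtoC (s + h))) - Re (H (RtoC s))) / h - Re m) with
    ((Re (H (RtoC (s + h))) - Re (H (RtoC s)) - (Re m * h - Im m * 0)) / h) by (field; auto).
  unfold Rdiv at 1. rewrite Rabs_mult, Rabs_inv.
  apply Rle_lt_trans with (e / 2); [ | lra]. apply Rle_div_l; auto.
Qed.

Lemma mean_value_open (u du : R -> R) (a b : R) :
  a < b -> (forall t, a < t < b -> is_derive u t (du t)) ->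
  (forall t, a <= t <= b -> continuous u t) ->
  exists t, a < t < b /\ u b - u a = du t * (b - a).
Proof.
  intros Hab Hd Hc.
  assert (pr : forall t, a < t < b -> derivable_pt u t).
  { intros t Ht. exists (du t). apply is_derive_Reals. auto. }
  destruct (MVT u id a b pr (fun t _ => derivable_pt_id t) Hab) as [t [Ht E]].
  - intros t Ht. apply continuity_pt_filterlim. now apply Hc.
  - intros t Ht. apply continuity_pt_id.
  - exists t. rewrite derive_pt_id in E. unfold id in E.
    rewrite Derive_Reals, (is_derive_unique _ _ _ (Hd t Ht)) in E. lra.
Qed.

(** With [c] the total increment, the real mean value theorem for [Re (Cconj c * G)] along the
    segment gives [Cmod c ^ 2 <= Cmod c * B]. Derivatives are taken at inner points only, so the
    ends may lie on the real axis. *)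
Lemma holo_segment_lipschitz (G : C -> C) (z v : C) (B : R) :
  (forall s, 0 <= s <= 1 -> ccont G (z + RtoC s * v)%C) ->
  (forall s, 0 < s < 1 -> exists l, holo G (z + RtoC s * v)%C l /\ Cmod l * Cmod v <= B) ->
  Cmod (G (z + v)%C - G z) <= B.
Proof.
  intros Hc Hh.
  set (c := (G (z + v)%C - G z)%C).
  pose (H := fun y => (Cconj c * G (z + y * v))%C).
  assert (D : forall s, 0 < s < 1 -> exists l, is_derive (fun r : R => Re (H (RtoC r))) s l /\ l <= Cmod c * B).
  { intros s Hs. destruct (Hh s Hs) as [l [Hl Bl]].
    exists (Re (Cconj c * (l * v))%C). split.
    - apply holo_is_derive_Re. apply holo_scal.
      apply (holo_comp (fun y => z + y * v)%C G); auto.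
      eapply holo_eq. apply holo_plus. apply holo_const. apply holo_mult. apply holo_id. apply holo_const.
      cbv beta. ring.
    - apply Rle_trans with (1 := RRle_abs _). apply Rle_trans with (1 := Re_le_Cmod _).
      rewrite !Cmod_mult, Cmod_conj. apply Rmult_le_compat_l; auto. apply Cmod_ge_0. }
  destruct (mean_value_open (fun r => Re (H (RtoC r))) (Derive (fun r => Re (H (RtoC r)))) 0 1)
    as [t [Ht E]]; try lra.
  - intros t Ht. destruct (D t Ht) as [l [Hl _]]. now rewrite (is_derive_unique _ _ _ Hl).
  - intros t Ht. apply cont_Re_comp. apply cont_mult. apply cont_cconst.
    apply (continuous_comp (V := C_UniformSpace) (fun r => z + RtoC r * v)%C G); auto.
    apply cont_plus. apply cont_cconst. apply cont_mult; [ | apply cont_cconst].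
    apply cont_pair. apply continuous_id. apply continuous_const.
  - destruct (D t Ht) as [l [Hl Bl]]. rewrite (is_derive_unique _ _ _ Hl) in E.
    unfold H in E. rewrite Cmult_1_l, Cmult_0_l, Cplus_0_r in E.
    assert (E' : Cmod c * Cmod c = l).
    { rewrite Cmod_sqr. rewrite <- (Rmult_1_r l). rewrite Rminus_0_r in E. rewrite <- E.
       simpl. ring. }
    rewrite <- E' in Bl. assert (P := Cmod_ge_0 c).
    destruct P as [P | P]. now apply Rmult_le_reg_l in Bl.
    rewrite <- P. destruct (Hh (1 / 2)) as [m [_ Hm]]. lra.
    apply Rle_trans with (2 := Hm). apply Rmult_le_pos; apply Cmod_ge_0.
Qed.

(** With the integrating factor [exp (- k * s)], the derivative of the displayed product is
    [(r s - k * u s - e) * exp (- k * s)], which is not positive. *)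
Lemma linear_ode_monotone (u r : R -> R) (k e : R) :
  k <> 0 -> (forall s, is_derive u s (r s)) ->
  (forall s, s <= 0 -> r s - k * u s <= e) ->
  forall s t, s <= t -> t <= 0 -> (u t + e / k) * exp (- k * t) <= (u s + e / k) * exp (- k * s).
Proof.
  intros Hk Hd He s t [Hst | ->] Ht; [ | lra].
  pose (U := fun s => (u s + e / k) * exp (- k * s)).
  pose (dU := fun s => (r s - k * u s - e) * exp (- k * s)).
  assert (D : forall y, is_derive U y (dU y)).
  { intros y. unfold U, dU. specialize (Hd y).
    auto_derive. now exists (r y).
    replace (Derive (fun x => u x) y) with (r y) by (symmetry; apply is_derive_unique; exact Hd).
    field; auto. }
  destruct (mean_value_open U dU s t Hst) as [y [Hy E]].
  - auto.
  - intros y _. apply (ex_derive_continuous (V := R_NormedModule)). now exists (dU y).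
  - fold (U s) (U t). assert (dU y <= 0); [ | nra].
    unfold dU. specialize (He y ltac:(lra)). assert (P := exp_pos (- k * y)). nra.
Qed.

(** For [0 < k] the flow contracts backwards in time, so the accumulated error stays below [e / k]
    on the whole half-line. The lower bound is applied to [u] and to [- u]. *)
Lemma linear_ode_growth (u r : R -> R) (k e : R) :
  0 < k -> (forall s, is_derive u s (r s)) ->
  (forall s, s <= 0 -> Rabs (r s - k * u s) <= e) ->
  forall s, s <= 0 -> Rabs (u s - u 0 * exp (k * s)) <= e / k.
Proof.
  intros Hk Hd He s Hs.
  assert (P : 0 < exp (k * s)) by apply exp_pos.
  assert (I : exp (- k * s) * exp (k * s) = 1).
  { rewrite <- exp_plus. replace (- k * s + k * s) with 0 by ring. apply exp_0. }
  assert (He0 : 0 <= e / k).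
  { apply Rdiv_le_0_compat; auto. apply Rle_trans with (2 := He 0 ltac:(lra)), Rabs_pos. }
  assert (K : forall v q, (forall s, is_derive v s (q s)) -> (forall s, s <= 0 -> q s - k * v s <= e) ->
    v 0 * exp (k * s) - e / k <= v s).
  { intros v q Hv Hq. assert (L := linear_ode_monotone v q k e ltac:(lra) Hv Hq s 0 Hs ltac:(lra)).
    rewrite Rmult_0_r, exp_0, Rmult_1_r in L.
    apply (Rmult_le_compat_r (exp (k * s))) in L; [ | lra].
    rewrite Rmult_assoc, I, Rmult_1_r in L.
    assert (0 <= e / k * exp (k * s)) by (apply Rmult_le_pos; lra). lra. }
  assert (K1 := K u r Hd). specialize (K1 ltac:(intros y Hy; specialize (He y Hy); apply Rabs_le_between in He; lra)).
  assert (K2 := K (fun s => - u s) (fun s => - r s)).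
  specialize (K2 ltac:(intros y; apply (is_derive_opp (V := R_NormedModule) u); auto)).
  specialize (K2 ltac:(intros y Hy; specialize (He y Hy); apply Rabs_le_between in He; lra)).
  apply Rabs_le. lra.
Qed.

(** For [k < 0] any excess over [e / - k] grows exponentially backwards in time, which boundedness
    excludes. *)
Lemma linear_ode_bounded (u r : R -> R) (k e B : R) :
  k < 0 -> (forall s, is_derive u s (r s)) ->
  (forall s, s <= 0 -> Rabs (r s - k * u s) <= e) -> (forall s, s <= 0 -> Rabs (u s) <= B) ->
  forall s, s <= 0 -> Rabs (u s) <= e / - k.
Proof.
  intros Hk Hd He HB s Hs.
  assert (He0 : 0 <= e).
  { apply Rle_trans with (2 := He 0 ltac:(lra)), Rabs_pos. }
  assert (Ek : e / - k = - (e / k)) by (field; lra).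
  assert (Hek : e / k <= 0).
  { assert (0 <= e / - k) by (apply Rdiv_le_0_compat; lra). lra. }
  assert (HB0 : 0 <= B) by (apply Rle_trans with (2 := HB 0 ltac:(lra)), Rabs_pos).
  assert (K : forall v q, (forall s, is_derive v s (q s)) -> (forall s, s <= 0 -> q s - k * v s <= e) ->
    (forall s, s <= 0 -> v s <= B) -> v s <= e / - k).
  { intros v q Hv Hq HBv. apply Rnot_lt_le. intros L.
    set (m := (v s + e / k) * exp (- k * s)).
    assert (Pm : 0 < m) by (apply Rmult_lt_0_compat; [lra | apply exp_pos]).
    (* So far to the left that [B * exp (- k * t) <= m / 2], while monotonicity keeps the product
       above [m]. *)
    set (t := Rmin s (ln (m / (2 * (B + 1))) / - k)).
    assert (Hts : t <= s) by apply Rmin_l. assert (Ht2 : t <= ln (m / (2 * (B + 1))) / - k) by apply Rmin_r.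
    assert (Q := linear_ode_monotone v q k e ltac:(lra) Hv Hq t s Hts Hs). fold m in Q.
    assert (Hexp : exp (- k * t) <= m / (2 * (B + 1))).
    { rewrite <- (exp_ln (m / (2 * (B + 1)))) by (apply Rdiv_lt_0_compat; lra).
      assert (- k * t <= ln (m / (2 * (B + 1)))).
      { apply Rle_div_r in Ht2; lra. }
      destruct H as [H | ->]; [left; now apply exp_increasing | lra]. }
    specialize (HBv t ltac:(lra)). assert (P := exp_pos (- k * t)).
    assert ((v t + e / k) * exp (- k * t) <= B * (m / (2 * (B + 1)))).
    { apply Rle_trans with (B * exp (- k * t)). apply Rmult_le_compat_r; lra.
      apply Rmult_le_compat_l; lra. }
    assert (B * (m / (2 * (B + 1))) <= m / 2).
    { replace (B * (m / (2 * (B + 1)))) with (m / 2 * (B / (B + 1))) by (field; lra).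
      assert (B / (B + 1) <= 1) by (apply Rle_div_l; lra). nra. }
    lra. }
  assert (K1 := K u r Hd).
  specialize (K1 ltac:(intros y Hy; specialize (He y Hy); apply Rabs_le_between in He; lra)).
  specialize (K1 ltac:(intros y Hy; specialize (HB y Hy); apply Rabs_le_between in HB; lra)).
  assert (K2 := K (fun s => - u s) (fun s => - r s)).
  specialize (K2 ltac:(intros y; apply (is_derive_opp (V := R_NormedModule) u); auto)).
  specialize (K2 ltac:(intros y Hy; specialize (He y Hy); apply Rabs_le_between in He; lra)).
  specialize (K2 ltac:(intros y Hy; specialize (HB y Hy); apply Rabs_le_between in HB; lra)).
  apply Rabs_le. lra.
Qed.

(** * Thin quadrilaterals *)

(** This is [phi] in the single complex variable [PI * (tau + i * sigma)], so that ends become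
    strips of width [PI]; the real part tends to [-oo] at the marked point, also at infinity. *)
Definition end_map (q : bpoint) (delta : R) (z : C) : C :=
  match q with
  | Bfin r => (RtoC r + RtoC delta * cexp z)%C
  | Binf => (- (RtoC (/ delta) * cexp (- z)))%C
  end.

Lemma phi_end_map (q : bpoint) (delta tau sigma : R) :
  delta <> 0 -> phi q delta tau sigma = end_map q delta (PI * tau, PI * sigma).
Proof.
  intros Hd. unfold phi, end_map.
  replace (PI * (tau + Ci * sigma))%C with ((PI * tau, PI * sigma) : C).
   now rewrite RtoC_inv by auto.
  apply C_eq; simpl; ring.
Qed.

(** Both the distance of [end_map] from the marked point (from [0] in the case of infinity) and the
    modulus of its derivative. *)
Definition end_radius (q : bpoint) (delta x : R) : R :=
  match q with Bfin _ => delta * exp x | Binf => / delta * exp (- x) end.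

Lemma end_radius_pos (q : bpoint) (delta x : R) : 0 < delta -> 0 < end_radius q delta x.
Proof.
  intros Hd. destruct q; simpl; apply Rmult_lt_0_compat; auto using exp_pos, Rinv_0_lt_compat.
Qed.

Lemma Im_end_map (q : bpoint) (delta : R) (z : C) :
  Im (end_map q delta z) = end_radius q delta (Re z) * sin (Im z).
Proof.
  destruct q; simpl; unfold Im, Re; simpl. ring. rewrite sin_neg. ring.
Qed.

Lemma Re_end_map (q : bpoint) (delta : R) (z : C) :
  Re (end_map q delta z) = match q with
    | Bfin r => r + end_radius q delta (Re z) * cos (Im z)
    | Binf => - (end_radius q delta (Re z) * cos (Im z)) end.
Proof.
  destruct q; simpl; unfold Im, Re; simpl. ring. rewrite cos_neg. ring.
Qed.

Lemma end_map_dist (q : bpoint) (delta : R) (z : C) :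
  0 < delta ->
  match q with
  | Bfin r => Cmod (end_map q delta z - RtoC r) = end_radius q delta (Re z)
  | Binf => Cmod (end_map q delta z) = end_radius q delta (Re z)
  end.
Proof.
  intros Hd. destruct q; unfold end_map, end_radius.
  - replace (RtoC r + RtoC delta * cexp z - RtoC r)%C with (RtoC delta * cexp z)%C by ring.
    rewrite Cmod_mult, Cmod_R, Cmod_cexp, Rabs_pos_eq; lra.
  - assert (P : 0 < / delta) by now apply Rinv_0_lt_compat.
    rewrite Cmod_opp, Cmod_mult, Cmod_R, Cmod_cexp, Rabs_pos_eq by lra. reflexivity.
Qed.

Lemma holo_end_map (q : bpoint) (delta : R) (z : C) :
  0 < delta -> exists l, holo (end_map q delta) z l /\ Cmod l = end_radius q delta (Re z).
Proof.
   destruct q; unfold end_map, end_radius.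
  - exists (0 + RtoC delta * cexp z)%C. split.
    apply (holo_plus (fun _ => RtoC r)). apply holo_const. apply holo_scal, holo_cexp.
    rewrite Cplus_0_l, Cmod_mult, Cmod_R, Cmod_cexp, Rabs_pos_eq; lra.
  - exists (RtoC (/ delta) * cexp (- z))%C.
    assert (P : 0 < / delta) by now apply Rinv_0_lt_compat. split.
    + apply holo_ext with (f := fun y => (RtoC (- / delta) * cexp (RtoC (-1) * y))%C).
      { intros y. rewrite RtoC_opp. replace (RtoC (-1) * y)%C with (- y)%C. ring.
        apply C_eq; simpl; unfold Re, Im; ring. }
      eapply holo_eq. apply holo_scal. apply (holo_comp (fun y => RtoC (-1) * y)%C cexp).
      apply holo_scal, holo_id. apply holo_cexp.
      replace (RtoC (-1) * z)%C with (- z)%C by (apply C_eq; simpl; unfold Re, Im; ring).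
      rewrite RtoC_opp. ring.
    + rewrite Cmod_mult, Cmod_R, Cmod_cexp, Rabs_pos_eq by lra. reflexivity.
Qed.

Lemma exp_le_1 (x : R) : x <= 0 -> exp x <= 1.
Proof.
  intros Hx. rewrite <- exp_0. destruct Hx as [Hx | ->]. left. now apply exp_increasing. lra.
Qed.

Lemma exp_ge_1 (x : R) : 0 <= x -> 1 <= exp x.
Proof.
  intros Hx. rewrite <- exp_0. destruct Hx as [Hx | <-]. left. now apply exp_increasing. lra.
Qed.

Lemma Cmod_ge_minus (y z w : C) : Cmod (z - w) - Cmod (y - z) <= Cmod (y - w).
Proof.
  assert (H := Cmod_triangle_minus z y w). rewrite (Cmod_minus_sym z y) in H. lra.
Qed.

Definition marked (z4 m : R) : Prop := m = 0 \/ m = z4 \/ m = 1.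

Section ThinQuadrilateral.
Variable g : C -> C.
Variables z4 eps M : R.
Variables a b : idx -> R.
Hypothesis gc : forall z, ccont g z.
Hypothesis gh : forall z, 0 < Im z -> exists l, holo g z l.
Hypothesis Hz4 : 0 < z4 < 1.
Hypothesis Heps : 0 < eps.
Hypothesis HM : 0 < M.
Hypothesis Hband : forall k z, Rabs (Im (g z) - eps * (a k * Re (g z) + b k)) <= M * eps.
Hypothesis Hline : forall k t, arc z4 k t ->
  Im (g (t, 0)) = eps * (a (nxt k) * Re (g (t, 0)) + b (nxt k)).

(** The derivative of [F k] dominates that of [g]. At height at least [d / 6] the interior estimate
    applies to a square of half-side [Im z / 2]. Below that height the real interval of half-length
    [d / 2] about [Re z] avoids the marked points, hence lies in one arc; the threshold is a third
    of [d / 2], as the boundary estimate requires. *)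
Lemma derivative_bound_marked (z l : C) (d : R) :
  0 < Im z -> 0 < d -> (forall m, marked z4 m -> d <= Cmod (z - RtoC m)) ->
  holo g z l -> Cmod l <= 96 * M * eps / d.
Proof.
  intros Hz Hd Hm Hl.
  pose (F := fun k z => ((1 - Ci * RtoC (eps * a k)) * g z - Ci * RtoC (eps * b k))%C).
  assert (ImF : forall k z, Im (F k z) = Im (g z) - eps * (a k * Re (g z) + b k)).
  { intros k y. simpl. unfold Re, Im. ring. }
  assert (HF : forall k y m, holo g y m -> holo (F k) y ((1 - Ci * RtoC (eps * a k)) * m - 0)%C).
  { intros k y m Hy. apply (holo_minus (fun z => (1 - Ci * RtoC (eps * a k)) * g z)%C).
    apply holo_scal. exact Hy. apply holo_const. }
  assert (Hl' : forall k, Cmod l <= Cmod ((1 - Ci * RtoC (eps * a k)) * l - 0)%C).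
  { intros k. replace ((1 - Ci * RtoC (eps * a k)) * l - 0)%C with ((1 - Ci * RtoC (eps * a k)) * l)%C by ring.
    rewrite Cmod_mult. rewrite <- (Rmult_1_l (Cmod l)) at 1.
    apply Rmult_le_compat_r. apply Cmod_ge_0.
    apply Rle_trans with (2 := Re_le_Cmod _). simpl.
    replace (1 + - (0 * (eps * a k) - 1 * 0)) with 1 by ring. rewrite Rabs_R1. lra. }
  assert (HMe : 0 < M * eps) by now apply Rmult_lt_0_compat.
  destruct (Rle_dec (d / 6) (Im z)) as [Hy | Hy].
  - apply Rle_trans with (1 := Hl' i1).
    apply Rle_trans with (4 * (M * eps) / (Im z / 2)).
    + apply (derivative_bound_interior (F i1) z); auto; try lra.
      intros y [Y1 Y2]. split. destruct (gh y) as [m Hm']. lra. exact (ex_intro _ _ (HF _ _ _ Hm')).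
      rewrite ImF. apply Hband.
    + replace (4 * (M * eps) / (Im z / 2)) with (8 * (M * eps) * / Im z) by (field; lra).
      replace (96 * M * eps / d) with (16 * (M * eps) * / (d / 6)) by (field; lra).
      assert (/ Im z <= / (d / 6)) by (apply Rinv_le_contravar; lra).
      assert (0 < / Im z) by now apply Rinv_0_lt_compat.
      apply Rmult_le_compat; lra.
  - assert (Hx : forall m, marked z4 m -> d / 2 < Rabs (Re z - m)).
    { intros m Hmm. specialize (Hm m Hmm).
      assert (K := Rle_trans _ _ _ Hm (Cmod_minus_RtoC_le _ _)).
      rewrite (Rabs_pos_eq (Im z)) in K; lra. }
    assert (Harc : exists k, forall t, Re z - d / 2 <= t <= Re z + d / 2 -> arc z4 k t).
    { assert (X0 := Hx 0 ltac:(left; auto)). assert (X4 := Hx z4 ltac:(right; left; auto)).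
      assert (X1 := Hx 1 ltac:(right; right; auto)).
      assert (S : forall m, d / 2 < Rabs (Re z - m) -> d / 2 < Re z - m \/ Re z - m < - (d / 2)).
      { intros m Q. destruct (Rle_dec 0 (Re z - m)). rewrite Rabs_pos_eq in Q; lra.
        rewrite Rabs_left in Q; lra. }
      apply S in X0. apply S in X4. apply S in X1.
      destruct X0 as [X0 | X0]. destruct X4 as [X4 | X4]. destruct X1 as [X1 | X1].
      exists i1; simpl; intros; lra. exists i4; simpl; intros; lra.
      exists i3; simpl; intros; lra. exists i2; simpl; intros; lra. }
    destruct Harc as [k Hk].
    apply Rle_trans with (1 := Hl' (nxt k)).
    replace (96 * M * eps / d) with (48 * (M * eps) / (d / 2)) by (field; lra).
    apply (derivative_bound_boundary (F (nxt k)) z); auto; try lra.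
    + split. apply cont_minus; auto using cont_cconst. apply cont_mult; auto using cont_cconst.
      rewrite ImF. apply Hband.
    + intros y _ Py. destruct (gh y Py) as [m Hm']. exact (ex_intro _ _ (HF _ _ _ Hm')).
    + intros t Ht. rewrite ImF, (Hline k t); auto. ring.
Qed.

Variable delta : R.
Hypothesis Hdelta : 0 < delta.
Hypothesis Hd4 : 2 * delta <= z4.
Hypothesis Hd1 : 2 * delta <= 1 - z4.

Lemma inv_delta_ge_4 : 4 <= / delta.
Proof. replace 4 with (/ / 4) by (field; lra). apply Rinv_le_contravar; lra. Qed.

Lemma end_radius_fin (r x : R) : x <= 0 -> end_radius (Bfin r) delta x <= delta.
Proof. intros Hx. simpl. assert (E := exp_le_1 x Hx). nra. Qed.

Lemma end_radius_inf (x : R) : x <= 0 -> / delta <= end_radius Binf delta x.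
Proof.
  intros Hx. simpl. assert (E := exp_ge_1 (- x) ltac:(lra)). assert (P := inv_delta_ge_4). nra.
Qed.

Definition strip (i : idx) (z : C) : C := g (end_map (zpt z4 i) delta z).

(** At a finite end the other marked points are at least [2 * delta] away and the radius is at most
    [delta]; at infinity the radius is at least [/ delta >= 4] and all marked points lie in the unit
    disk. *)
Lemma end_map_marked_dist (i : idx) (z : C) (m : R) :
  Re z <= 0 -> marked z4 m ->
  end_radius (zpt z4 i) delta (Re z) / 2 <= Cmod (end_map (zpt z4 i) delta z - RtoC m).
Proof.
  intros Hz Hm. assert (D := end_map_dist (zpt z4 i) delta z Hdelta).
  assert (T : forall r, Cmod (RtoC r - RtoC m) = Rabs (r - m)).
  { intros r. rewrite <- RtoC_minus. apply Cmod_R. }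
  assert (I4 := inv_delta_ge_4).
  assert (Fin : forall r, m = r \/ 2 * delta <= Rabs (r - m) ->
    end_radius (Bfin r) delta (Re z) / 2 <= Cmod (end_map (Bfin r) delta z - RtoC m)).
  { intros r Hr. assert (U := end_radius_fin r (Re z) Hz).
    assert (P' := end_radius_pos (Bfin r) delta (Re z) Hdelta).
    assert (D' := end_map_dist (Bfin r) delta z Hdelta).
    destruct Hr as [-> | Hr]. lra.
    assert (Q := Cmod_ge_minus (end_map (Bfin r) delta z) (RtoC r) (RtoC m)). rewrite T in Q. lra. }
  destruct i; simpl zpt in *.
  - apply Fin. destruct Hm as [-> | [-> | ->]]; auto; right; rewrite Rabs_pos_eq; lra.
  - assert (U := end_radius_inf (Re z) Hz).
    assert (Q := Cmod_triangle_minus (end_map Binf delta z) (RtoC m) 0).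
    replace (end_map Binf delta z - 0)%C with (end_map Binf delta z) in Q by ring.
    replace (RtoC m - 0)%C with (RtoC m) in Q by ring. rewrite Cmod_R, D in Q.
    assert (Rabs m <= 1) by (destruct Hm as [-> | [-> | ->]]; apply Rabs_le; lra). lra.
  - apply Fin. destruct Hm as [-> | [-> | ->]]; auto; right; rewrite Rabs_minus_sym, Rabs_pos_eq; lra.
  - apply Fin. destruct Hm as [-> | [-> | ->]]; auto; right.
    + rewrite Rabs_pos_eq; lra.
    + rewrite Rabs_minus_sym, Rabs_pos_eq; lra.
Qed.

Lemma strip_cont (i : idx) (z : C) : ccont (strip i) z.
Proof.
  destruct (holo_end_map (zpt z4 i) delta z Hdelta) as [l [Hl _]]. apply holo_cont in Hl.
  now apply (continuous_comp (end_map (zpt z4 i) delta) g).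
Qed.

(** Chain rule: the distance [d] to the marked points is at least half the radius, and the radius is
    also the modulus of the derivative of [end_map]. Hence [192], twice [96]. *)
Lemma strip_holo (i : idx) (z : C) :
  Re z <= 0 -> 0 < Im z < PI -> exists l, holo (strip i) z l /\ Cmod l <= 192 * M * eps.
Proof.
  intros Hz Hi. assert (P := end_radius_pos (zpt z4 i) delta (Re z) Hdelta).
  set (r := end_radius (zpt z4 i) delta (Re z)) in *.
  assert (I : 0 < Im (end_map (zpt z4 i) delta z)).
  { rewrite Im_end_map. apply Rmult_lt_0_compat; auto. apply sin_gt_0; lra. }
  destruct (gh _ I) as [l Hl].
  destruct (holo_end_map (zpt z4 i) delta z Hdelta) as [m [Hm Em]].
  exists (l * m)%C. split. now apply (holo_comp (end_map (zpt z4 i) delta) g).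
  assert (B := derivative_bound_marked _ l (r / 2) I ltac:(lra)
    (fun m Hmm => end_map_marked_dist i z m Hz Hmm) Hl).
  rewrite Cmod_mult, Em.
  replace (192 * M * eps) with (96 * M * eps / (r / 2) * r) by (field; lra).
  apply Rmult_le_compat_r; lra.
Qed.

Lemma strip_vertical_lipschitz (i : idx) (s t1 t2 : R) :
  s <= 0 -> 0 <= t1 <= PI -> 0 <= t2 <= PI ->
  Cmod (strip i (s, t1) - strip i (s, t2)) <= 192 * M * eps * Rabs (t1 - t2).
Proof.
  intros Hs H1 H2. destruct (Req_dec t1 t2) as [-> | N].
  { rewrite Rminus_diag, Rabs_R0. replace (strip i (s, t2) - strip i (s, t2))%C with (RtoC 0) by ring.
    rewrite Cmod_0. lra. }
  assert (Em : Cmod (0, (t1 - t2)%R) = Rabs (t1 - t2)).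
  { unfold Cmod. simpl. rewrite <- sqrt_Rsqr_abs. f_equal. unfold Rsqr. ring. }
  replace ((s, t1) : C) with ((s, t2) + (0, (t1 - t2)%R))%C by (apply C_eq; simpl; ring).
  apply holo_segment_lipschitz.
  - intros r _. apply strip_cont.
  - intros r Hr. rewrite Em.
    destruct (strip_holo i ((s, t2) + RtoC r * (0, (t1 - t2)%R))%C) as [l [Hl Bl]].
    + simpl. lra.
    + replace (Im ((s, t2) + RtoC r * (0, (t1 - t2)%R))) with ((1 - r) * t2 + r * t1) by (simpl; unfold Re, Im; simpl; ring).
      destruct (Rtotal_order t1 t2) as [L | [L | L]]; [ | lra | ]; split; nra.
    + exists l. split; auto. apply Rmult_le_compat_r; auto. apply Rabs_pos.
Qed.

(** For angle [0] the end map runs to the right of a finite marked point, and along the far negative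
    axis at infinity: in both cases on the arc that starts at [x i]. Angle [PI] gives the preceding
    arc, hence the index [i] in [strip_top_line]. *)
Lemma strip_bottom_line (i : idx) (s : R) : s <= 0 ->
  Im (strip i (s, 0)) = eps * (a (nxt i) * Re (strip i (s, 0)) + b (nxt i)).
Proof.
  intros Hs. unfold strip. set (q := zpt z4 i).
  assert (E : end_map q delta (s, 0) = (Re (end_map q delta (s, 0)), 0)).
  { apply C_eq; simpl; auto. rewrite Im_end_map. simpl Im. rewrite sin_0. apply Rmult_0_r. }
  rewrite E. apply Hline. rewrite Re_end_map. simpl Re. simpl Im. rewrite cos_0, Rmult_1_r.
  assert (P := end_radius_pos q delta s Hdelta).
  destruct i; unfold q in *; simpl zpt in *; unfold arc;
  try (assert (U := end_radius_fin 1 s Hs)); try (assert (U' := end_radius_fin 0 s Hs));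
  try (assert (U'' := end_radius_fin z4 s Hs)); lra.
Qed.

Lemma strip_top_line (i : idx) (s : R) : s <= 0 ->
  Im (strip i (s, PI)) = eps * (a i * Re (strip i (s, PI)) + b i).
Proof.
  intros Hs. unfold strip. set (q := zpt z4 i).
  assert (E : end_map q delta (s, PI) = (Re (end_map q delta (s, PI)), 0)).
  { apply C_eq; simpl; auto. rewrite Im_end_map. simpl Im. rewrite sin_PI. apply Rmult_0_r. }
  rewrite E.
  assert (K : exists k, nxt k = i /\ arc z4 k (Re (end_map q delta (s, PI)))).
  { rewrite Re_end_map. simpl Re. simpl Im. rewrite cos_PI.
    assert (P := end_radius_pos q delta s Hdelta). assert (I4 := inv_delta_ge_4).
    assert (U1 := end_radius_fin 1 s Hs).
    assert (U4 := end_radius_fin z4 s Hs). assert (Ui := end_radius_inf s Hs).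
    destruct i; unfold q in *; simpl zpt in *;
    [exists i4 | exists i1 | exists i2 | exists i3]; (split; [reflexivity | unfold arc; lra]). }
  destruct K as [k [<- Hk]]. now apply Hline.
Qed.

(** The path goes from [z] straight up by [/ delta] and then parallel to [z] to the reference point.
    Moving up increases the distance to the marked points, and the second segment lies at height at
    least [/ delta]; each segment has length at most [/ delta]. *)
Lemma thick_part_lipschitz (z : C) :
  0 <= Im z -> (forall m, marked z4 m -> delta <= Cmod (z - RtoC m)) -> Cmod z <= / delta ->
  Cmod (g z - g (0, (/ delta)%R)) <= 192 * M * eps / (delta * delta).
Proof.
  intros Hz Hm Hmod. assert (I4 := inv_delta_ge_4).
  assert (Ev : Cmod (0, (/ delta)%R) = / delta).
  { unfold Cmod. simpl. replace (0 * (0 * 1) + / delta * (/ delta * 1)) with (Rsqr (/ delta)) by (unfold Rsqr; ring).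
    rewrite sqrt_Rsqr; lra. }
  assert (V : Cmod (g (z + (0, (/ delta)%R))%C - g z) <= 96 * M * eps / delta * / delta).
  { apply holo_segment_lipschitz. intros; apply gc. intros s Hs.
    assert (Ei : Im (z + RtoC s * (0, (/ delta)%R)) = Im z + s * / delta) by (simpl; unfold Re, Im; simpl; ring).
    assert (Er : Re (z + RtoC s * (0, (/ delta)%R)) = Re z) by (simpl; unfold Re, Im; simpl; ring).
    assert (0 < s * / delta) by (apply Rmult_lt_0_compat; lra).
    destruct (gh (z + RtoC s * (0, (/ delta)%R))%C) as [l Hl]. lra.
    exists l. split; auto. rewrite Ev. apply Rmult_le_compat_r. lra.
    apply (derivative_bound_marked (z + RtoC s * (0, (/ delta)%R))%C); auto. lra.
    intros m Hmm. apply Rle_trans with (1 := Hm m Hmm). apply Cmod_le_of_sqr.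
    change (Re (z - RtoC m)) with (Re z - m). change (Im (z - RtoC m)) with (Im z - 0).
    change (Re (z + RtoC s * (0, (/ delta)%R) - RtoC m)) with (Re (z + RtoC s * (0, (/ delta)%R)) - m).
    change (Im (z + RtoC s * (0, (/ delta)%R) - RtoC m)) with (Im (z + RtoC s * (0, (/ delta)%R)) - 0).
     nra. }
  assert (W : Cmod (g ((0, (/ delta)%R) + z)%C - g (0, (/ delta)%R)) <= 96 * M * eps / delta * / delta).
  { apply holo_segment_lipschitz. intros; apply gc. intros s Hs.
    assert (Ei : Im ((0, (/ delta)%R) + RtoC s * z) = / delta + s * Im z) by (simpl; unfold Re, Im; simpl; ring).
    assert (0 <= s * Im z) by (apply Rmult_le_pos; lra).
    destruct (gh ((0, (/ delta)%R) + RtoC s * z)%C) as [l Hl]. lra.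
    exists l. split; auto.
    assert (Bl : Cmod l <= 96 * M * eps / delta).
    { apply (derivative_bound_marked ((0, (/ delta)%R) + RtoC s * z)%C); auto. lra.
      intros m _. apply Rle_trans with (2 := Im_minus_RtoC_le _ _).
      rewrite Ei, Rabs_pos_eq; lra. }
    apply Rmult_le_compat; auto using Cmod_ge_0. }
  replace ((0, (/ delta)%R) + z)%C with (z + (0, (/ delta)%R))%C in W by ring.
  assert (T := Cmod_triangle_minus (g z) (g (z + (0, (/ delta)%R))%C) (g (0, (/ delta)%R))).
  rewrite (Cmod_minus_sym (g z) (g (z + (0, (/ delta)%R))%C)) in T.
  replace (192 * M * eps / (delta * delta)) with (96 * M * eps / delta * / delta + 96 * M * eps / delta * / delta)
    by (field; lra). lra.
Qed.

Variable i : idx.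
Variables p D : R.
Hypothesis Hcrit : a i * p + b i = a (nxt i) * p + b (nxt i).
Hypothesis HD : forall z, Rabs (Re (g z) - p) <= D.
Hypothesis Heps1 : eps < 1.

(** By the Cauchy-Riemann equations, the derivative of the integral of the real part over the
    cross-section. An average defined through its primitive is differentiable on the whole line, as
    the lemmas on the linear equation require. *)
Definition strip_flux (x : R) : R := Im (strip i (x, PI - eps)) - Im (strip i (x, eps)).

(** This integral of [Re - p] over a cross-section (see [strip_average_eq]) satisfies a linear ODE up to [O(eps^2)]. The strip is narrowed by [eps] on both sides so that Goursat's theorem applies without boundary values. *)
Definition strip_average (s : R) : R :=
  RInt (fun t => Re (strip i (0, t))) eps (PI - eps) - p * (PI - 2 * eps) +
  RInt strip_flux 0 s.

(** The first summand is the oscillation of the real part over a cross-section times its length; the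
    second pays for the missing length [2 * eps]. *)
Definition average_const : R := 192 * M * (PI * PI) + 2 * D.
(** Moving the two ends of the narrowed cross-section to the edges costs [192 * M * eps] times [eps]
    each; the rest comes from replacing the edge values by the average. *)
Definition ode_const : R := 384 * M + average_const * (Rabs (a i) + Rabs (a (nxt i))).

Lemma PI_gt_3 : 3 < PI.
Proof. assert (H := PI2_3_2). lra. Qed.

Lemma strip_flux_cont (x : R) : continuous strip_flux x.
Proof.
  apply (cont_Rminus (fun x => Im (strip i (x, PI - eps))) (fun x => Im (strip i (x, eps))));
  apply cont_horizontal, strip_cont.
Qed.

Lemma strip_average_derive (s : R) :
  is_derive strip_average s (strip_flux s).
Proof.
  evar_last.
  2: { exact (plus_zero_l (strip_flux s)). }
  apply (is_derive_plus (V := R_NormedModule) (fun _ => RInt (fun t => Re (strip i (0, t))) eps (PI - eps) - p * (PI - 2 * eps))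
    (fun s => RInt strip_flux 0 s)).
  apply (is_derive_const (V := R_NormedModule)).
  apply (is_derive_RInt (V := R_NormedModule) strip_flux _ 0).
  - exists (mkposreal 1 Rlt_0_1). intros y _. apply (RInt_correct (V := R_CompleteNormedModule)).
    apply (ex_RInt_continuous (V := R_CompleteNormedModule)). intros x _. apply strip_flux_cont.
  - apply strip_flux_cont.
Qed.

Lemma strip_average_eq (s : R) : s <= 0 ->
  strip_average s = RInt (fun t => Re (strip i (s, t))) eps (PI - eps) - p * (PI - 2 * eps).
Proof.
  intros Hs. assert (HP := PI_gt_3). unfold strip_average.
  assert (G := goursat (strip i) s 0 eps (PI - eps) Hs ltac:(lra)).
  specialize (G ltac:(intros z [Z1 Z2]; destruct (strip_holo i z) as [l [Hl _]]; eauto; lra)).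
  assert (X : forall y, ex_RInt (fun x => Im (strip i (x, y))) s 0).
  { intros y. apply ex_RInt_horizontal; auto. intros; apply strip_cont. }
  rewrite <- (opp_RInt_swap (V := R_CompleteNormedModule) strip_flux s 0).
  2: { apply (ex_RInt_continuous (V := R_CompleteNormedModule)). intros x _. apply strip_flux_cont. }
  unfold strip_flux.
  rewrite (RInt_minus (V := R_CompleteNormedModule) (fun x => Im (strip i (x, PI - eps)))) by apply X.
  unfold minus, plus, opp; simpl. lra.
Qed.

Lemma strip_average_near (s t : R) : s <= 0 -> 0 <= t <= PI ->
  Rabs (strip_average s - PI * (Re (strip i (s, t)) - p)) <= average_const * eps.
Proof.
  intros Hs Ht. assert (HP := PI_gt_3). rewrite strip_average_eq by auto.
  set (n := Re (strip i (s, t)) - p).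
  assert (K : Rabs (RInt (fun t => Re (strip i (s, t))) eps (PI - eps) - Re (strip i (s, t)) * (PI - eps - eps))
    <= 192 * M * eps * PI * (PI - eps - eps)).
  { apply RInt_near_const. lra. apply ex_RInt_vertical. lra. intros; apply strip_cont.
    intros y Hy. apply Rle_trans with (1 := Re_le_Cmod (strip i (s, y) - strip i (s, t))).
    apply Rle_trans with (1 := strip_vertical_lipschitz i s y t Hs ltac:(lra) Ht).
    apply Rmult_le_compat_l. assert (0 < M * eps) by now apply Rmult_lt_0_compat. lra.
    apply Rabs_le; lra. }
  assert (N : Rabs n <= D) by apply HD.
  assert (B : 0 <= 192 * M * eps * PI).
  { assert (0 < M * eps) by now apply Rmult_lt_0_compat. apply Rmult_le_pos; lra. }
  assert (B2 : 192 * M * eps * PI * (PI - eps - eps) <= 192 * M * eps * PI * PI) by (apply Rmult_le_compat_l; lra).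
  replace (Re (strip i (s, t)) * (PI - eps - eps)) with ((n + p) * (PI - 2 * eps)) in K by (unfold n; ring).
  apply Rabs_le_between in K. apply Rabs_le_between in N. unfold average_const.
  assert (E1 : eps * n <= eps * D) by (apply Rmult_le_compat_l; lra).
  assert (E2 : eps * - D <= eps * n) by (apply Rmult_le_compat_l; lra).
  apply Rabs_le_between. lra.
Qed.

(** On the edges the imaginary parts are known by the two lines, and since the lines meet above [p],
    their difference is [eps] times [a i * (n1 - p) - a (nxt i) * (n0 - p)]; both deviations are the
    average divided by [PI], up to [O(eps)]. *)
Lemma strip_average_ode (s : R) : s <= 0 ->
  Rabs (Im (strip i (s, PI - eps)) - Im (strip i (s, eps)) -
        eps * (a i - a (nxt i)) / PI * strip_average s) <= ode_const * (eps * eps).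
Proof.
  intros Hs. assert (HP := PI_gt_3).
  assert (T1 := strip_vertical_lipschitz i s (PI - eps) PI Hs ltac:(lra) ltac:(lra)).
  assert (T2 := strip_vertical_lipschitz i s eps 0 Hs ltac:(lra) ltac:(lra)).
  apply (Rle_trans _ _ _ (Im_minus_le _ _)) in T1. apply (Rle_trans _ _ _ (Im_minus_le _ _)) in T2.
  replace (PI - eps - PI) with (- eps) in T1 by ring. rewrite Rabs_Ropp, (Rabs_pos_eq eps) in T1 by lra.
  rewrite Rminus_0_r, (Rabs_pos_eq eps) in T2 by lra.
  rewrite strip_top_line in T1 by auto. rewrite strip_bottom_line in T2 by auto.
  assert (A1 := strip_average_near s PI Hs ltac:(lra)). assert (A2 := strip_average_near s 0 Hs ltac:(lra)).
  set (N := strip_average s) in *.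
  set (n1 := Re (strip i (s, PI))) in *. set (n0 := Re (strip i (s, 0))) in *.
  set (I1 := Im (strip i (s, PI - eps))) in *. set (I0 := Im (strip i (s, eps))) in *.
  assert (E : I1 - I0 - eps * (a i - a (nxt i)) / PI * N =
    (I1 - eps * (a i * n1 + b i)) - (I0 - eps * (a (nxt i) * n0 + b (nxt i))) +
    eps / PI * (a (nxt i) * (N - PI * (n0 - p)) - a i * (N - PI * (n1 - p)))).
  { replace (b (nxt i)) with (a i * p + b i - a (nxt i) * p) by lra. field. lra. }
  rewrite E.
  apply Rle_trans with (1 := Rabs_triang _ _).
  assert (X : Rabs (a (nxt i) * (N - PI * (n0 - p)) - a i * (N - PI * (n1 - p))) <=
    average_const * eps * (Rabs (a i) + Rabs (a (nxt i)))).
  { apply Rle_trans with (1 := Rabs_triang _ _). rewrite Rabs_Ropp, !Rabs_mult.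
    assert (Rabs (a (nxt i)) * Rabs (N - PI * (n0 - p)) <= Rabs (a (nxt i)) * (average_const * eps)).
    { apply Rmult_le_compat_l; auto using Rabs_pos. }
    assert (Rabs (a i) * Rabs (N - PI * (n1 - p)) <= Rabs (a i) * (average_const * eps)).
    { apply Rmult_le_compat_l; auto using Rabs_pos. }
    lra. }
  assert (Y : Rabs (eps / PI * (a (nxt i) * (N - PI * (n0 - p)) - a i * (N - PI * (n1 - p)))) <=
     eps * (average_const * eps * (Rabs (a i) + Rabs (a (nxt i))))).
  { rewrite Rabs_mult. apply Rmult_le_compat; auto using Rabs_pos.
    rewrite Rabs_pos_eq. apply Rle_div_l; [lra | ]. nra. apply Rdiv_le_0_compat; lra. }
  assert (Z : Rabs (I1 - eps * (a i * n1 + b i) - (I0 - eps * (a (nxt i) * n0 + b (nxt i)))) <= 384 * M * (eps * eps)).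
  { apply Rabs_le_between in T1. apply Rabs_le_between in T2. apply Rabs_le_between. lra. }
  unfold ode_const. lra.
Qed.

(** The error of the equation divided by its rate, and one [average_const] each for passing between
    value and average at [s] and at [0]. *)
Definition strip_const : R := ode_const * PI / Rabs (a i - a (nxt i)) + 2 * average_const.

Lemma strip_near_start (s t : R) :
  a i < a (nxt i) -> s <= 0 -> 0 <= t <= PI -> Rabs (Re (strip i (s, t)) - p) <= strip_const * eps.
Proof.
  intros Ha Hs Ht. assert (HP := PI_gt_3).
  set (k := eps * (a i - a (nxt i)) / PI).
  assert (Hk : k < 0).
  { unfold k. apply Ropp_lt_cancel. rewrite Ropp_0.
    replace (- (eps * (a i - a (nxt i)) / PI)) with (eps * (a (nxt i) - a i) / PI) by (field; lra).
    apply Rdiv_lt_0_compat; [apply Rmult_lt_0_compat | ]; lra. }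
  (* A bound of any size excludes growth at [-oo]; here it comes from the bounded real part of
     [g]. *)
  assert (HBd : forall y, y <= 0 -> Rabs (strip_average y) <= PI * D + average_const * eps).
  { intros y Hy. assert (A := strip_average_near y 0 Hy ltac:(lra)). assert (N := HD (end_map (zpt z4 i) delta (y, 0))).
    fold (strip i (y, 0)) in N.
    replace (strip_average y) with ((strip_average y - PI * (Re (strip i (y, 0)) - p)) + PI * (Re (strip i (y, 0)) - p)) by ring.
    apply Rle_trans with (1 := Rabs_triang _ _). rewrite (Rabs_mult PI), (Rabs_pos_eq PI) by lra.
    assert (PI * Rabs (Re (strip i (y, 0)) - p) <= PI * D) by (apply Rmult_le_compat_l; lra). lra. }
  assert (L := linear_ode_bounded _ _ k _ _ Hk strip_average_derive strip_average_ode HBd s Hs).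
  assert (A := strip_average_near s t Hs Ht).
  assert (Ec : ode_const * (eps * eps) / - k = ode_const * PI / Rabs (a i - a (nxt i)) * eps).
  { rewrite Rabs_left by lra. unfold k. field. lra. }
  assert (Q : Rabs (PI * (Re (strip i (s, t)) - p)) <= (ode_const * PI / Rabs (a i - a (nxt i)) + average_const) * eps).
  { replace (PI * (Re (strip i (s, t)) - p)) with
     (- (strip_average s - PI * (Re (strip i (s, t)) - p)) + strip_average s) by ring.
    apply Rle_trans with (1 := Rabs_triang _ _). rewrite Rabs_Ropp. lra. }
  rewrite Rabs_mult, (Rabs_pos_eq PI) in Q by lra.
  assert (0 <= average_const * eps) by (apply Rle_trans with (2 := A), Rabs_pos).
  assert (P := Rabs_pos (Re (strip i (s, t)) - p)).
  assert (Rabs (Re (strip i (s, t)) - p) <= PI * Rabs (Re (strip i (s, t)) - p)) by nra.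
  unfold strip_const. lra.
Qed.

Lemma strip_near_exponential (s t t0 : R) :
  a (nxt i) < a i -> s <= 0 -> 0 <= t <= PI -> 0 <= t0 <= PI ->
  Rabs (Re (strip i (s, t)) - p -
    (Re (strip i (0, t0)) - p) * exp (eps * (a i - a (nxt i)) / PI * s)) <= strip_const * eps.
Proof.
  intros Ha Hs Ht Ht0. assert (HP := PI_gt_3).
  set (k := eps * (a i - a (nxt i)) / PI).
  assert (Hk : 0 < k) by (apply Rdiv_lt_0_compat; [apply Rmult_lt_0_compat | ]; lra).
  assert (L := linear_ode_growth _ _ k _ Hk strip_average_derive strip_average_ode s Hs).
  assert (A := strip_average_near s t Hs Ht). assert (A0 := strip_average_near 0 t0 ltac:(lra) Ht0).
  assert (Ec : ode_const * (eps * eps) / k = ode_const * PI / Rabs (a i - a (nxt i)) * eps).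
  { rewrite Rabs_pos_eq by lra. unfold k. field. lra. }
  assert (P1 := exp_pos (k * s)).
  (* The discrepancy between value and average at [s = 0] is multiplied by this factor, hence not
     enlarged. *)
  assert (P2 : exp (k * s) <= 1).
  { apply exp_le_1. apply Ropp_le_cancel. rewrite Ropp_0, <- Ropp_mult_distr_r_reverse. apply Rmult_le_pos; lra. }
  set (x := exp (k * s)) in *. set (n := Re (strip i (s, t)) - p) in *. set (n0 := Re (strip i (0, t0)) - p) in *.
  set (N := strip_average s) in *. set (N0 := strip_average 0) in *.
  assert (Q : Rabs (PI * (n - n0 * x)) <= strip_const * eps).
  { replace (PI * (n - n0 * x)) with (- (N - PI * n) + (N - N0 * x) + (N0 - PI * n0) * x) by ring.
    apply Rle_trans with (1 := Rabs_triang _ _).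
    assert (T := Rabs_triang (- (N - PI * n)) (N - N0 * x)). rewrite Rabs_Ropp in T.
    rewrite (Rabs_mult _ x), (Rabs_pos_eq x) by lra.
    assert (Rabs (N0 - PI * n0) * x <= average_const * eps * 1) by (apply Rmult_le_compat; auto using Rabs_pos; lra).
    unfold strip_const. lra. }
  rewrite Rabs_mult, (Rabs_pos_eq PI) in Q by lra.
  assert (P := Rabs_pos (n - n0 * x)). nra.
Qed.

End ThinQuadrilateral.

(** * Gradient curves *)

(** Completeness yields a supremum for each small [eps], between [0] and [B * eps]; a choice
    operator collects them into a function. *)
Lemma sup_tends_to_0_of_linear_bound (E : R -> R -> Prop) (B : R) :
  at_right 0 (fun eps => (exists r, E eps r) /\ forall r, E eps r -> 0 <= r <= B * eps) ->
  sup_tends_to E 0.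
Proof.
  intros [d Hd].
  assert (L : forall eps, 0 < eps -> eps < d -> exists s, is_lub (E eps) s /\ 0 <= s <= B * eps).
  { intros eps H0 H1. destruct (Hd eps) as [[r Hr] HB]; auto.
    { change (Rabs (eps - 0) < d). rewrite Rminus_0_r, Rabs_pos_eq; lra. }
    destruct (completeness (E eps)) as [s Hs].
    - exists (B * eps). intros y Hy. now apply HB.
    - now exists r.
    - exists s. split; auto. destruct Hs as [Hs1 Hs2]. split.
      + apply Rle_trans with r. now apply HB. now apply Hs1.
      + apply Hs2. intros y Hy. now apply HB. }
  exists (fun eps => epsilon (inhabits 0) (fun s => is_lub (E eps) s /\ 0 <= s <= B * eps)).
  assert (K : forall eps, 0 < eps -> eps < d ->
    let s := epsilon (inhabits 0) (fun s => is_lub (E eps) s /\ 0 <= s <= B * eps) in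
    is_lub (E eps) s /\ 0 <= s <= B * eps).
  { intros eps H0 H1. apply epsilon_spec. auto. }
  assert (Near : forall eps : R, ball 0 d eps -> 0 < eps -> eps < d).
  { intros eps Hb H0. change (Rabs (eps - 0) < d) in Hb. rewrite Rminus_0_r, Rabs_pos_eq in Hb; lra. }
  split.
  - exists d. intros eps Hb H0. now apply K; eauto.
  - intros P [e HP].
    destruct (pos_below2 d (e / (Rabs B + 1))) as [m [Pe [L1 L2]]]. apply cond_pos.
    { apply Rdiv_lt_0_compat. apply cond_pos. assert (Q := Rabs_pos B). lra. }
    exists (mkposreal _ Pe). intros eps Hb H0.
    change (Rabs (eps - 0) < m) in Hb. rewrite Rminus_0_r, Rabs_pos_eq in Hb by lra.
    destruct (K eps H0 ltac:(lra)) as [_ Hs]. apply HP.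
    set (s := epsilon _ _) in *. change (Rabs (s - 0) < e). rewrite Rminus_0_r, Rabs_pos_eq by lra.
    assert (Q := Rabs_pos B). assert (Q' := RRle_abs B).
    assert (E1 : eps < e / (Rabs B + 1)) by lra. apply Rlt_div_r in E1; [ | lra]. nra.
Qed.

Lemma is_derive_in_eps (S : R -> Prop) (c : R -> R) (t v e : R) :
  is_derive_in S c t v -> 0 < e ->
  exists d, 0 < d /\ forall y, Rabs (y - t) < d -> S y -> Rabs (c y - c t - (y - t) * v) <= e * Rabs (y - t).
Proof.
  intros [_ H] He.
  assert (Hf : is_filter_lim (within S (locally t)) t).
  { intros P HP. unfold within. revert HP. apply filter_imp. auto. }
  destruct (H t Hf (mkposreal e He)) as [d Hd].
  exists d. split. apply cond_pos. intros y Hy Sy. exact (Hd y Hy Sy).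
Qed.

Lemma exponential_curve (c : R -> R) (k p : R) :
  (forall t, t <= 0 -> is_derive_in (fun t => t <= 0) c t (k * (c t - p))) ->
  forall t, t <= 0 -> c t = p + (c 0 - p) * exp (k * t).
Proof.
  (* Constant continuation past [0] turns the one-sided derivative into continuity at [0]. The mean
     value theorem, applied to [(c' t - p) * exp (- k * t)], then uses derivatives at negative times
     only. *)
  intros Hc. set (c' := fun t => c (Rmin t 0)).
  assert (Ec : forall t, t <= 0 -> c' t = c t) by (intros t Ht; unfold c'; now rewrite Rmin_left).
  assert (D : forall t, t < 0 -> is_derive c' t (k * (c' t - p))).
  { intros t Ht. apply is_derive_Reals. intros e He.
    destruct (is_derive_in_eps _ c t _ (e / 2) (Hc t ltac:(lra))) as [d [Hd H]]. lra.
    destruct (pos_below2 d (- t)) as [m [Pm [L1 L2]]]; [lra | lra | ].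
    exists (mkposreal _ Pm). intros h Nh Lh. simpl in Lh.
    assert (Ph : 0 < Rabs h) by now apply Rabs_pos_lt.
    assert (Uh : h <= Rabs h) by apply RRle_abs.
    rewrite !Ec by lra. specialize (H (t + h)). replace (t + h - t) with h in H by ring.
    specialize (H ltac:(lra) ltac:(lra)).
    replace ((c (t + h) - c t) / h - k * (c t - p)) with ((c (t + h) - c t - h * (k * (c t - p))) / h) by (field; auto).
    unfold Rdiv at 1. rewrite Rabs_mult, Rabs_inv.
    apply Rle_lt_trans with (e / 2); [ | lra]. apply Rle_div_l; auto. }
  assert (C0 : continuous c' 0).
  { intros P [e HP]. destruct (is_derive_in_eps _ c 0 _ 1 (Hc 0 ltac:(lra))) as [d [Hd H]]. lra.
    set (v := k * (c 0 - p)) in *. assert (Pv := Rabs_pos v).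
    destruct (pos_below2 d (e / (Rabs v + 1))) as [m [Pd [L1 L2]]]; auto.
    { apply Rdiv_lt_0_compat. apply cond_pos. lra. }
    exists (mkposreal _ Pd). intros y Hy. apply HP.
    change (Rabs (y - 0) < m) in Hy. rewrite Rminus_0_r in Hy.
    change (Rabs (c' y - c' 0) < e). rewrite (Ec 0) by lra. unfold c'.
    assert (Hm : Rabs (Rmin y 0) <= Rabs y).
    { unfold Rmin. destruct (Rle_dec y 0). lra. rewrite Rabs_R0. apply Rabs_pos. }
    specialize (H (Rmin y 0)). rewrite Rminus_0_r in H. specialize (H ltac:(lra) (Rmin_r _ _)).
    replace (c (Rmin y 0) - c 0) with ((c (Rmin y 0) - c 0 - Rmin y 0 * v) + Rmin y 0 * v) by ring.
    apply Rle_lt_trans with (1 := Rabs_triang _ _). rewrite Rabs_mult.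
    assert (E1 : Rabs y < e / (Rabs v + 1)) by lra. apply Rlt_div_r in E1; [ | lra]. nra. }
  intros t [Ht | ->].
  2: { rewrite Rmult_0_r, exp_0. ring. }
  pose (u := fun t => (c' t - p) * exp (- k * t)).
  destruct (mean_value_open u (fun _ => 0) t 0 Ht) as [y [_ E]].
  - intros y Hy. unfold u. assert (Dy := D y ltac:(lra)). auto_derive. now exists (k * (c' y - p)).
    replace (Derive (fun x => c' x) y) with (k * (c' y - p)) by (symmetry; apply is_derive_unique; exact Dy). ring.
  - intros y Hy. apply (cont_Rmult (fun t => c' t - p) (fun t => exp (- k * t))).
    + apply (cont_Rminus c' (fun _ => p)); [ | apply continuous_const].
      destruct (proj2 Hy) as [L | ->]; auto. apply (ex_derive_continuous (V := R_NormedModule)).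
      exists (k * (c' y - p)). now apply D.
    + apply (ex_derive_continuous (V := R_NormedModule)). auto_derive. auto.
  - unfold u in E. rewrite !Ec in E by lra. rewrite Rmult_0_r, exp_0 in E.
    assert (I : exp (- k * t) * exp (k * t) = 1).
    { rewrite <- exp_plus. replace (- k * t + k * t) with 0 by ring. apply exp_0. }
    assert (E2 : c 0 - p = (c t - p) * exp (- k * t)) by lra.
    rewrite E2, Rmult_assoc, I. ring.
Qed.

(** For [k < 0] the exponential is at least [1] at negative times, so a deviation from [p] at time
    [0] would persist at [-oo]. *)
Lemma exponential_curve_constant (c : R -> R) (k p : R) :
  k < 0 -> is_lim c m_infty p -> (forall t, t <= 0 -> c t = p + (c 0 - p) * exp (k * t)) -> c 0 = p.
Proof.
  intros Hk Hl Hc. apply Rminus_diag_uniq. apply NNPP. intros N. apply Rabs_pos_lt in N.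
  destruct (Hl (fun y => Rabs (y - p) < Rabs (c 0 - p))) as [T HT].
  { exists (mkposreal _ N). intros y Hy. exact Hy. }
  set (t := Rmin (T - 1) 0). assert (L1 : t <= T - 1) by apply Rmin_l. assert (L2 : t <= 0) by apply Rmin_r.
  specialize (HT t ltac:(lra)). rewrite (Hc t L2) in HT.
  replace (p + (c 0 - p) * exp (k * t) - p) with ((c 0 - p) * exp (k * t)) in HT by ring.
  rewrite Rabs_mult, (Rabs_pos_eq (exp (k * t))) in HT by (left; apply exp_pos).
  assert (1 <= exp (k * t)) by (apply exp_ge_1; nra). nra.
Qed.

(** Replaces [w] on the lower half plane by a continuous extension of its boundary values. *)
Definition clamp (w : C -> C) (z : C) : C := w (Re z, Rmax 0 (Im z)).

Lemma clamp_eq (w : C -> C) (z : C) : 0 <= Im z -> clamp w z = w z.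
Proof. intros H. unfold clamp. rewrite Rmax_right by auto. now destruct z. Qed.

Lemma clamp_cont (w : C -> C) :
  (forall z, HHbar z -> filterlim w (within HHbar (locally z)) (locally (w z))) ->
  forall z, ccont (clamp w) z.
Proof.
  intros Hw z.
  assert (Ck : ccont (fun y : C => (Re y, Rmax 0 (Im y)) : C) z).
  { apply cont_pair. apply cont_Re.
    apply (continuous_ext (fun y : C => (Im y + Rabs (Im y)) * / 2)).
    - intros y. unfold Rmax. destruct (Rle_dec 0 (Im y)).
      rewrite Rabs_pos_eq; lra. rewrite Rabs_left; lra.
    - apply (cont_Rmult (fun y : C => Im y + Rabs (Im y)) (fun _ => / 2)); [ | apply continuous_const].
      apply (cont_Rplus Im (fun y : C => Rabs (Im y))). apply cont_Im. apply cont_Rabs, cont_Im. }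
  assert (B : forall y : C, HHbar (Re y, Rmax 0 (Im y))) by (intros y; apply Rmax_l).
  intros P HP. specialize (Hw _ (B z) P HP). specialize (Ck _ Hw).
  unfold filtermap in *. revert Ck. apply filter_imp. intros y Hy. apply Hy. apply B.
Qed.

Lemma clamp_holo (w : C -> C) (z : C) :
  HH z -> ex_derive (K := C_AbsRing) (V := C_NormedModule) w z -> exists l, holo (clamp w) z l.
Proof.
  intros Hz Hw. destruct (holo_of_ex_derive w z Hw) as [l Hl]. exists l.
  apply (holo_ext_near w (clamp w) z l (Im z)); auto.
  intros y Hy. symmetry. apply clamp_eq.
  assert (K := Rle_lt_trans _ _ _ (Im_minus_le _ _) Hy).
  apply Rabs_def2 in K. lra.
Qed.

(** * Bounds over the indices and over the quadrilateral *)

Lemma idx_upper_bound (D : idx -> idx -> R) : exists M, 0 < M /\ forall i j, D i j <= M.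
Proof.
  assert (H1 : forall F : idx -> R, exists M, 0 < M /\ forall i, F i <= M).
  { intros F. exists (Rabs (F i1) + Rabs (F i2) + Rabs (F i3) + Rabs (F i4) + 1).
    assert (P1 := Rabs_pos (F i1)). assert (P2 := Rabs_pos (F i2)).
    assert (P3 := Rabs_pos (F i3)). assert (P4 := Rabs_pos (F i4)).
    split. lra. intros i. assert (Q := RRle_abs (F i)). destruct i; lra. }
  assert (H2 : forall i, exists M, 0 < M /\ forall j, D i j <= M) by (intros i; apply H1).
  apply choice in H2. destruct H2 as [m Hm]. destruct (H1 m) as [M [PM HM]].
  exists M. split; auto. intros i j. apply Rle_trans with (m i); auto. apply Hm.
Qed.

Lemma quadrilateral_affine_bound (x : idx -> C) (u : C) (A B G M : R) :
  quadrilateral x u -> (forall v, Rabs (A * Re (x v) + B * Im (x v) + G) <= M) ->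
  Rabs (A * Re u + B * Im u + G) <= M.
Proof.
  intros [t1 [t2 [t3 [t4 [T1 [T2 [T3 [T4 [T ->]]]]]]]]] H.
  set (L := fun v => A * Re (x v) + B * Im (x v) + G) in *.
  assert (E : A * Re (t1 * x i1 + t2 * x i2 + t3 * x i3 + t4 * x i4)%C +
     B * Im (t1 * x i1 + t2 * x i2 + t3 * x i3 + t4 * x i4)%C + G =
     t1 * L i1 + t2 * L i2 + t3 * L i3 + t4 * L i4).
  { replace t4 with (1 - t1 - t2 - t3) by lra. unfold L. simpl. unfold Re, Im. ring. }
   apply Rabs_le.
  assert (K : forall t v, 0 <= t -> - (t * M) <= t * L v <= t * M).
  { intros t v Ht. specialize (H v). apply Rabs_le_between in H. fold (L v) in H.
    assert (t * L v <= t * M) by (apply Rmult_le_compat_l; lra).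
    assert (t * - M <= t * L v) by (apply Rmult_le_compat_l; lra). lra. }
  assert (K1 := K t1 i1 T1). assert (K2 := K t2 i2 T2). assert (K3 := K t3 i3 T3). assert (K4 := K t4 i4 T4).
  assert (t1 * M + t2 * M + t3 * M + t4 * M = M) by (rewrite <- !Rmult_plus_distr_r, T; ring). lra.
Qed.

(** * Quadratic functions *)

Section QuadraticData.
Variables (f : idx -> R -> R) (a b c : idx -> R) (x : R -> idx -> C) (p : idx -> R).
Hypothesis Hf : forall i t, f i t = a i / 2 * t ^ 2 + b i * t + c i.
Hypothesis Hx : forall eps i, 0 < eps ->
  lagr (f i) eps (x eps i) /\ lagr (f (nxt i)) eps (x eps i).
Hypothesis Hp : forall eps i, 0 < eps -> Re (x eps i) = p i.
Hypothesis Hconv : forall eps, 0 < eps -> ccw_convex (x eps).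

Lemma Derive_quadratic (i : idx) (t : R) : Derive (f i) t = a i * t + b i.
Proof.
  rewrite (Derive_ext _ _ t (Hf i)). apply is_derive_unique. auto_derive; auto. field.
Qed.

Lemma Derive_difference (i j : idx) (t : R) :
  Derive (dfun f i j) t = (a j - a i) * t + (b j - b i).
Proof.
  unfold dfun. rewrite (Derive_ext _ (fun t => (a j / 2 * t ^ 2 + b j * t + c j) - (a i / 2 * t ^ 2 + b i * t + c i))).
  apply is_derive_unique. auto_derive; auto. field. intros y. now rewrite !Hf.
Qed.

Lemma morse_index_zero (i j : idx) (q : R) :
  a i <> a j -> morse_index (dfun f i j) q = 0%nat -> a i < a j.
Proof.
  intros N. unfold morse_index. destruct (Rlt_dec _ 0) as [L | L]; [discriminate | intros _].
  change (Derive_n (dfun f i j) 2 q) with (Derive (Derive (dfun f i j)) q) in L.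
  rewrite (Derive_ext _ _ q (Derive_difference i j)) in L.
  replace (Derive (fun t => (a j - a i) * t + (b j - b i)) q) with (a j - a i) in L. lra.
  symmetry. apply is_derive_unique. auto_derive; auto. ring.
Qed.

Lemma vertex_height (eps : R) (i : idx) : 0 < eps ->
  Im (x eps i) = eps * (a i * p i + b i) /\ Im (x eps i) = eps * (a (nxt i) * p i + b (nxt i)).
Proof.
  intros He. destruct (Hx eps i He) as [H1 H2]. unfold lagr in H1, H2.
  rewrite Derive_quadratic, Hp in H1 by auto. rewrite Derive_quadratic, Hp in H2 by auto. auto.
Qed.

Lemma critical_point (i : idx) : a i * p i + b i = a (nxt i) * p i + b (nxt i).
Proof. destruct (vertex_height 1 i Rlt_0_1). lra. Qed.

(** This is the orientation of three consecutive vertices for [eps = 1]: the middle vertex is joined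
    to its neighbours along the lines [nxt i] and [nxt (nxt i)], so the heights are the slopes times
    differences of first coordinates. *)
Lemma slope_sign (i : idx) :
  0 < (p i - p (nxt i)) * (p (nxt (nxt i)) - p (nxt i)) * (a (nxt i) - a (nxt (nxt i))).
Proof.
  assert (H := Hconv 1 Rlt_0_1 (nxt i) i ltac:(destruct i; discriminate) ltac:(destruct i; discriminate)).
  unfold orient in H. rewrite !Hp in H by lra.
  destruct (vertex_height 1 (nxt i) Rlt_0_1) as [E1 _]. rewrite E1 in H.
  destruct (vertex_height 1 i Rlt_0_1) as [_ E2]. rewrite E2 in H.
  destruct (vertex_height 1 (nxt (nxt i)) Rlt_0_1) as [E3 _]. rewrite E3 in H.
  assert (E := critical_point (nxt i)).
  set (P := p (nxt i)) in *. set (A := a (nxt i)) in *. set (A' := a (nxt (nxt i))) in *.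
  set (B := b (nxt i)) in *. set (B' := b (nxt (nxt i))) in *.
  replace B' with (A * P + B - A' * P) in H by lra. lra.
Qed.

(** Both ends of side [k] lie on the line with index [nxt k], and [slope_sign] makes their first
    coordinates distinct. *)
Lemma side_on_line (eps : R) (k : idx) (u : C) : 0 < eps ->
  side_height (x eps) k u = 0 -> Im u = eps * (a (nxt k) * Re u + b (nxt k)).
Proof.
  intros He H. assert (S := slope_sign k).
  unfold side_height, orient in H. rewrite !Hp in H by auto.
  destruct (vertex_height eps k He) as [_ E1]. rewrite E1 in H.
  destruct (vertex_height eps (nxt k) He) as [E2 _]. rewrite E2 in H.
  assert (N : p (nxt k) - p k <> 0).
  { intros E. replace (p k - p (nxt k)) with 0 in S by lra. lra. }
  apply Rmult_eq_reg_l with (p (nxt k) - p k); auto. lra.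
Qed.

(** If [p i1 = p i3], two instances of [slope_sign] contain squares and give [a i3 < a i2] and
    [a i1 < a i4]. The other two give [a i1 - a i2] and [a i3 - a i4] the same sign, and if it were
    positive the slopes would decrease all around the cycle. The case [p i2 = p i4] is the same
    after a shift of the indices. *)
Lemma degenerate_index_zero :
  (p i3 - p i1) * (p i4 - p i2) = 0 ->
  exists i, (i = i1 \/ i = i2) /\ p (nxt (nxt i)) = p i /\
    forall j, a j < a (nxt j) <-> j = i \/ j = nxt (nxt i).
Proof.
  assert (S1 := slope_sign i1). assert (S2 := slope_sign i2).
  assert (S3 := slope_sign i3). assert (S4 := slope_sign i4). simpl in *.
  assert (Pos : forall y z : R, 0 < y * y * z -> 0 < z).
  { intros y z H. nra. }
  intros H. apply Rmult_integral in H. destruct H as [H | H].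
  - exists i1. assert (E : p i3 = p i1) by lra. rewrite E in *.
    assert (A2 := Pos (p i1 - p i2) (a i2 - a i3) ltac:(lra)).
    assert (A4 := Pos (p i1 - p i4) (a i4 - a i1) ltac:(lra)).
    assert (X : (p i4 - p i1) * (p i2 - p i1) < 0).
    { nra. }
    assert (a i1 < a i2) by nra. assert (a i3 < a i4) by nra.
    repeat split; simpl; auto; destruct j; simpl; intros; auto; try lra;
    destruct H2; discriminate || lra.
  - exists i2. assert (E : p i4 = p i2) by lra. rewrite E in *.
    assert (A1 := Pos (p i2 - p i1) (a i1 - a i2) ltac:(lra)).
    assert (A3 := Pos (p i2 - p i3) (a i3 - a i4) ltac:(lra)).
    assert (X : (p i1 - p i2) * (p i3 - p i2) < 0).
    { nra. }
    assert (a i2 < a i3) by nra. assert (a i4 < a i1) by nra.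
    repeat split; simpl; auto; destruct j; simpl; intros; auto; try lra;
    destruct H2; discriminate || lra.
Qed.

(** The two edges of index zero are constant with the same value [p i0]. They are opposite, so in
    either shape with an internal edge each end of that edge carries one of them; hence all four
    external edges end at [p i0]. *)
Lemma tree_edges (l : R) (I : idx -> R -> R) (i0 : idx) :
  gradient_tree f p l I -> (p i3 - p i1) * (p i4 - p i2) = 0 -> a i0 < a (nxt i0) ->
  forall i, (a i < a (nxt i) -> p i = p i0) /\
    forall t, t <= 0 -> I i t = p i + (p i0 - p i) * exp ((a i - a (nxt i)) * t).
Proof.
  intros [_ [HI Htree]] Hdeg Hi0.
  assert (Hexp : forall i t, t <= 0 -> I i t = p i + (I i 0 - p i) * exp ((a i - a (nxt i)) * t)).
  { intros i. apply exponential_curve. intros t Ht. destruct (HI i) as [Hg _].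
    replace ((a i - a (nxt i)) * (I i t - p i)) with (- Derive (dfun f i (nxt i)) (I i t)); auto.
    rewrite Derive_difference. assert (E := critical_point i). lra. }
  assert (Hconst : forall i, a i < a (nxt i) -> I i 0 = p i).
  { intros i L. apply exponential_curve_constant with (k := a i - a (nxt i)); auto. lra. apply HI. }
  assert (H0 : forall i, I i 0 = p i0).
  { destruct (degenerate_index_zero Hdeg) as [k [Hk [Ep Hz]]].
    assert (Zk := Hconst k (proj2 (Hz k) (or_introl eq_refl))).
    assert (Zk' := Hconst (nxt (nxt k)) (proj2 (Hz (nxt (nxt k))) (or_intror eq_refl))).
    assert (E0 : p i0 = p k) by (destruct (proj1 (Hz i0) Hi0) as [-> | ->]; auto).
    rewrite Ep, <- E0 in Zk'.
    destruct Hk as [-> | ->]; simpl in Zk, Zk';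
    destruct Htree as [[_ [T1 [T2 T3]]] | [[_ [J [_ [T1 [T2 [T3 T4]]]]]] | [_ [J [_ [T1 [T2 [T3 T4]]]]]]]];
    intros i; destruct i; congruence. }
   split.
  - intros L. now rewrite <- (Hconst i L).
  - intros t Ht. now rewrite (Hexp i t Ht), H0.
Qed.

(** * Estimates for one [eps] between [0] and [1] *)

Section FixedEps.
Variables (w : C -> C) (z4 eps delta : R).
Hypothesis Hw : schwarz_christoffel (x eps) w z4.
Hypothesis Heps : 0 < eps < 1.
Hypothesis Hdelta : 0 < delta.
Hypothesis Hdisj : forall j, j <> i4 -> forall z,
  ~ (Dnear (zpt z4 i4) delta z /\ Dnear (zpt z4 j) delta z).

Let g := clamp w.

Lemma map_cont (z : C) : ccont g z.
Proof. apply clamp_cont. apply Hw. Qed.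

Lemma map_holo (z : C) : 0 < Im z -> exists l, holo g z l.
Proof. intros Hz. apply clamp_holo; auto. now apply Hw. Qed.

Lemma marked_point_range : 0 < z4 < 1.
Proof. apply Hw. Qed.

Lemma map_injective (y z : C) : 0 < Im y -> 0 < Im z -> g y = g z -> y = z.
Proof.
  intros Hy Hz. unfold g. rewrite !clamp_eq by lra. now apply Hw.
Qed.

Lemma map_onto_interior (u : C) :
  Defs.interior (quadrilateral (x eps)) u <-> exists z, 0 < Im z /\ g z = u.
Proof.
  destruct Hw as [[_ [_ H]] _]. rewrite H.
  split; intros [z [Hz E]]; exists z; (split; [exact Hz | ]); rewrite <- E;
  [ | symmetry]; apply clamp_eq; left; exact Hz.
Qed.

Lemma map_at_infinity (e : R) : 0 < e ->
  exists B, forall z, 0 <= Im z -> B < Cmod z -> Cmod (g z - x eps i2) < e.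
Proof.
  intros He. destruct Hw as [_ [_ [_ [H _]]]].
  destruct (H (fun v => Cmod (v - x eps i2) < e)) as [B HB].
  { apply locally_C_Cmod. now exists e. }
  exists B. intros z Hz Lz. unfold g. rewrite clamp_eq by auto. now apply HB.
Qed.

Lemma map_marked_points : g (1, 0) = x eps i1 /\ g (0, 0) = x eps i3 /\ g (z4, 0) = x eps i4.
Proof.
  destruct Hw as [_ [_ [H1 [_ [H0 [_ H4]]]]]]. unfold g.
  rewrite !clamp_eq by (simpl; lra). auto.
Qed.

Lemma map_boundary (k : idx) (t : R) : arc z4 k t ->
  Im (g (t, 0)) = eps * (a (nxt k) * Re (g (t, 0)) + b (nxt k)).
Proof.
  intros Ht. apply side_on_line; [lra | ]. destruct map_marked_points as [E1 [E0 E4]].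
  apply (boundary_correspondence (x eps) (Hconv eps (proj1 Heps)) g z4); auto using marked_point_range,
    map_cont, map_holo, map_injective, map_onto_interior, map_at_infinity.
Qed.

Lemma map_in_quadrilateral (z : C) : quadrilateral (x eps) (g z).
Proof.
  assert (Hc := Hconv eps (proj1 Heps)).
  apply height_nonneg_quadrilateral; auto.
  destruct (Rlt_dec 0 (Im z)) as [L | L].
  - left. apply interior_height_pos; auto. apply map_onto_interior. eauto.
  - replace (g z) with (g (Re z, 0)).
    + apply (real_points_on_boundary (x eps) Hc g); auto using map_cont, map_holo, map_injective, map_onto_interior.
    + unfold g, clamp. simpl. rewrite Rmax_left, Rmax_left by lra. reflexivity.
Qed.

(** If [z4] were closer than [2 * delta] to [0] or [1], the midpoint between them would lie in both
    half disks. *)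
Lemma delta_small : 2 * delta <= z4 /\ 2 * delta <= 1 - z4.
Proof.
  destruct marked_point_range as [Z0 Z1].
  assert (K : forall r j, j <> i4 -> zpt z4 j = Bfin r -> 2 * delta <= Rabs (z4 - r)).
  { intros r j Nj Ej. apply Rnot_lt_le. intros L. apply (Hdisj j Nj (RtoC ((z4 + r) / 2))).
    assert (D : forall m, (m = z4 \/ m = r) -> Cmod (RtoC ((z4 + r) / 2) - RtoC m) < delta).
    { intros m Hm. rewrite <- RtoC_minus, Cmod_R.
      replace ((z4 + r) / 2 - m) with ((if Req_EM_T m z4 then -1 else 1) * ((z4 - r) / 2)).
      rewrite Rabs_mult. replace (Rabs (if Req_EM_T m z4 then -1 else 1)) with 1.
      unfold Rdiv. rewrite Rabs_mult, (Rabs_pos_eq (/ 2)) by lra. lra.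
      destruct (Req_EM_T m z4). rewrite Rabs_left; lra. rewrite Rabs_R1; auto.
      destruct (Req_EM_T m z4). subst; field. destruct Hm; [contradiction | subst; field]. }
    rewrite Ej. repeat split; try (unfold HHbar; simpl; lra); apply D; auto. }
  assert (K0 := K 0 i3 ltac:(discriminate) eq_refl). assert (K1 := K 1 i1 ltac:(discriminate) eq_refl).
  rewrite Rabs_pos_eq in K0 by lra. rewrite Rabs_left in K1 by lra. lra.
Qed.

(** The point [i / delta] is the reference point of the thick part; it also shows that the supremum
    there is over a nonempty set. *)
Lemma thick_point : Dthick z4 delta (0, / delta).
Proof.
  destruct delta_small as [D4 D1].
  assert (I4 : 4 <= / delta) by (apply (inv_delta_ge_4 z4); auto).
  split. unfold HHbar; simpl; lra.
  assert (K : forall r, ~ Dnear (Bfin r) delta (0, / delta)).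
  { intros r [_ L]. assert (Q := Rle_lt_trans _ _ _ (Im_minus_RtoC_le _ _) L).
    simpl in Q. rewrite Rabs_pos_eq in Q; lra. }
   destruct i; simpl zpt; auto. intros [_ [_ L]].
  assert (E : Cmod (0, / delta) <= / delta).
  { apply Rle_trans with (1 := Cmod_le_Re_Im _). simpl. rewrite Rabs_R0, Rabs_pos_eq; lra. }
  assert (P : 0 < Cmod (0, / delta)).
  { apply Rlt_le_trans with (2 := Im_le_Cmod _). simpl. rewrite Rabs_pos_eq; lra. }
  apply Rinv_le_contravar in E; auto. rewrite Rinv_inv in E. lra.
Qed.

Variables M D V : R.
Hypothesis HM : 0 < M.
Hypothesis Mbound : forall i k, Rabs (a i * p i + b i - (a k * p i + b k)) <= M.
Hypothesis Dbound : forall i j, Rabs (p j - p i) <= D.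
Hypothesis Vbound : forall i, Rabs (a i * p i + b i) <= V.

(** An affine function is bounded on the quadrilateral by its values at the vertices, where it is
    [eps] times a number independent of [eps]. *)
Lemma map_band (k : idx) (z : C) : Rabs (Im (g z) - eps * (a k * Re (g z) + b k)) <= M * eps.
Proof.
  replace (Im (g z) - eps * (a k * Re (g z) + b k)) with
    (- (eps * a k) * Re (g z) + 1 * Im (g z) + - (eps * b k)) by ring.
  apply (quadrilateral_affine_bound (x eps)); [apply map_in_quadrilateral | ].
  intros v. rewrite Hp by lra. destruct (vertex_height eps v) as [-> _]. lra.
  replace (- (eps * a k) * p v + 1 * (eps * (a v * p v + b v)) + - (eps * b k)) with
    (eps * (a v * p v + b v - (a k * p v + b k))) by ring.
  rewrite Rabs_mult, Rabs_pos_eq, Rmult_comm by lra. apply Rmult_le_compat_r; auto; lra.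
Qed.

Lemma map_Re_bound (i : idx) (z : C) : Rabs (Re (g z) - p i) <= D.
Proof.
  replace (Re (g z) - p i) with (1 * Re (g z) + 0 * Im (g z) + - p i) by ring.
  apply (quadrilateral_affine_bound (x eps)); [apply map_in_quadrilateral | ].
  intros v. rewrite Hp by lra. replace (1 * p v + 0 * Im (x eps v) + - p i) with (p v - p i) by ring. auto.
Qed.

Lemma map_Im_bound (z : C) : Rabs (Im (g z)) <= V * eps.
Proof.
  replace (Im (g z)) with (0 * Re (g z) + 1 * Im (g z) + 0) by ring.
  apply (quadrilateral_affine_bound (x eps)); [apply map_in_quadrilateral | ].
  intros v. destruct (vertex_height eps v) as [-> _]. lra.
  replace (0 * Re (x eps v) + 1 * (eps * (a v * p v + b v)) + 0) with (eps * (a v * p v + b v)) by ring.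
  rewrite Rabs_mult, Rabs_pos_eq, Rmult_comm by lra. apply Rmult_le_compat_r; auto; lra.
Qed.

Definition thick_const : R := 192 * M / (delta * delta).
Definition end_const (i : idx) : R := strip_const M a i D.

Lemma thick_bound (z : C) :
  0 <= Im z -> (forall m, marked z4 m -> delta <= Cmod (z - RtoC m)) -> Cmod z <= / delta ->
  Cmod (g z - g (0, / delta)) <= thick_const * eps.
Proof.
   destruct delta_small as [D4 D1].
  replace (thick_const * eps) with (192 * M * eps / (delta * delta)) by (unfold thick_const; field; lra).
  apply (thick_part_lipschitz g z4 eps M a b); auto using map_cont, map_holo, marked_point_range, map_band, map_boundary.
  lra.
Qed.

Lemma PI_half_in : 0 <= PI / 2 <= PI.
Proof. assert (H := PI_gt_3). lra. Qed.

(** The top of the half circle that bounds an end has height [delta], or [/ delta] at infinity, and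
    belongs to the thick part; this links each end to the reference point. *)
Lemma end_circle_near_thick (i : idx) :
  Rabs (Re (strip g z4 delta i (0, PI / 2)) - Re (g (0, / delta))) <= thick_const * eps.
Proof.
  apply Rle_trans with (1 := Re_le_Cmod (strip g z4 delta i (0, PI / 2) - g (0, / delta))).
  destruct delta_small as [D4 D1].
  assert (I4 : 4 <= / delta) by (apply (inv_delta_ge_4 z4); auto).
  unfold strip. set (q := zpt z4 i).
  assert (Er : match q with Bfin _ => end_radius q delta 0 = delta | Binf => end_radius q delta 0 = / delta end).
  { destruct q; simpl; rewrite ?Ropp_0, exp_0; ring. }
  assert (Ei : Im (end_map q delta (0, PI / 2)) = end_radius q delta 0).
  { rewrite Im_end_map. simpl Im. simpl Re. rewrite sin_PI2. ring. }
  assert (Ee : Re (end_map q delta (0, PI / 2)) = match q with Bfin r => r | Binf => 0 end).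
  { rewrite Re_end_map. simpl Im. rewrite cos_PI2. destruct q; ring. }
  assert (Hr : delta <= end_radius q delta 0) by (destruct q; lra).
  apply thick_bound.
  - lra.
  - intros m _. apply Rle_trans with (2 := Im_minus_RtoC_le _ _).
    rewrite Ei, Rabs_pos_eq; lra.
  - apply Rle_trans with (1 := Cmod_le_Re_Im _). rewrite Ei, Ee, (Rabs_pos_eq (end_radius q delta 0)) by lra.
    unfold q in *. destruct i; simpl zpt in *; cbv beta iota in *; rewrite Er, Rabs_pos_eq; lra.
Qed.

Lemma end_start_bound (i : idx) (s t : R) :
  a i < a (nxt i) -> s <= 0 -> 0 <= t <= PI ->
  Rabs (Re (strip g z4 delta i (s, t)) - p i) <= end_const i * eps.
Proof.
   destruct delta_small as [D4 D1].
  apply (strip_near_start g z4 eps M a b); auto using map_cont, map_holo, marked_point_range,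
    map_band, map_boundary, critical_point, map_Re_bound; lra.
Qed.

Lemma end_exponential_bound (i : idx) (s t : R) :
  a (nxt i) < a i -> s <= 0 -> 0 <= t <= PI ->
  Rabs (Re (strip g z4 delta i (s, t)) - p i - (Re (strip g z4 delta i (0, PI / 2)) - p i) *
    exp (eps * (a i - a (nxt i)) / PI * s)) <= end_const i * eps.
Proof.
  intros L Hs Ht. destruct delta_small as [D4 D1].
  apply (strip_near_exponential g z4 eps M a b); auto using map_cont, map_holo, marked_point_range,
    map_band, map_boundary, critical_point, map_Re_bound, PI_half_in; lra.
Qed.

Variable i0 : idx.
Hypothesis Hi0 : a i0 < a (nxt i0).

Lemma thick_near_index_zero : Rabs (Re (g (0, / delta)) - p i0) <= (thick_const + end_const i0) * eps.
Proof.
  assert (H1 := end_circle_near_thick i0).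
  assert (H2 := end_start_bound i0 0 (PI / 2) Hi0 ltac:(lra) PI_half_in).
  apply Rabs_le_between in H1. apply Rabs_le_between in H2. apply Rabs_le_between. lra.
Qed.

Lemma thick_estimate (z : C) : Dthick z4 delta z ->
  Cmod (w z - RtoC (p i0)) <= (2 * thick_const + end_const i0 + V) * eps.
Proof.
  intros [Hz Hn].
  assert (Hm : forall m, marked z4 m -> delta <= Cmod (z - RtoC m)).
  { intros m Hm. apply Rnot_lt_le. intros L.
    destruct Hm as [-> | [-> | ->]]; [apply (Hn i3) | apply (Hn i4) | apply (Hn i1)]; split; auto. }
  assert (Hm0 := Hm 0 (or_introl eq_refl)). replace (z - RtoC 0)%C with z in Hm0 by ring.
  assert (Hz2 : Cmod z <= / delta).
  { apply Rnot_lt_le. intros L. apply (Hn i2). split; auto. split.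
    - intros ->. rewrite Cmod_0 in Hm0. lra.
    - rewrite <- (Rinv_inv delta). apply Rinv_lt_contravar; auto.
      apply Rmult_lt_0_compat. now apply Rinv_0_lt_compat. lra. }
  assert (B := thick_bound z Hz Hm Hz2).
  rewrite <- (clamp_eq w z Hz). fold g.
  apply Rle_trans with (1 := Cmod_triangle_minus _ (g (0, / delta)) _).
  assert (B2 := Cmod_le_Re_Im (g (0, / delta) - RtoC (p i0))).
  change (Re (g (0, / delta) - RtoC (p i0))) with (Re (g (0, / delta)) - p i0) in B2.
  change (Im (g (0, / delta) - RtoC (p i0))) with (Im (g (0, / delta)) - 0) in B2.
  rewrite Rminus_0_r in B2. assert (B3 := map_Im_bound (0, / delta)). assert (B4 := thick_near_index_zero).
  lra.
Qed.

Lemma end_estimate (l : R) (I : idx -> R -> R) (i : idx) (tau sigma : R) :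
  a i <> a (nxt i) ->
  gradient_tree f p l I -> (p i3 - p i1) * (p i4 - p i2) = 0 -> Theta_ext tau sigma ->
  Cmod (w (phi (zpt z4 i) delta tau sigma) - RtoC (I i (eps * tau))) <=
    (2 * thick_const + end_const i0 + end_const i + V) * eps.
Proof.
  intros Ha HI Hdeg [Ht Hs]. assert (HPI := PI_gt_3).
  destruct (tree_edges l I i0 HI Hdeg Hi0 i) as [Hi HIi].
  rewrite phi_end_map by lra.
  set (z := (PI * tau, PI * sigma)).
  assert (Ht' : PI * tau <= 0) by nra. assert (Hs' : 0 <= PI * sigma <= PI) by nra.
  assert (Hz : 0 <= Im (end_map (zpt z4 i) delta z)).
  { rewrite Im_end_map. apply Rmult_le_pos. left. now apply end_radius_pos. apply sin_ge_0; simpl; lra. }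
  rewrite <- (clamp_eq w _ Hz). fold g. change (g (end_map (zpt z4 i) delta z)) with (strip g z4 delta i z).
  assert (HIm : Rabs (Im (strip g z4 delta i z)) <= V * eps) by apply map_Im_bound.
  apply Rle_trans with (1 := Cmod_minus_RtoC_le _ _).
  assert (Het : eps * tau <= 0) by nra.
  assert (P1 := Rle_trans _ _ _ (Rabs_pos _) thick_near_index_zero).
  assert (P2 := Rle_trans _ _ _ (Rabs_pos _) (end_circle_near_thick i)).
  rewrite HIi by auto.
  destruct (Rlt_dec (a i) (a (nxt i))) as [L | L].
  - assert (B := end_start_bound i (PI * tau) (PI * sigma) L Ht' Hs'). fold z in B.
    rewrite (Hi L). rewrite (Hi L) in B. replace (p i0 + (p i0 - p i0) * exp ((a i - a (nxt i)) * (eps * tau))) with (p i0) by ring.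
    lra.
  - assert (L' : a (nxt i) < a i) by lra.
    assert (B := end_exponential_bound i (PI * tau) (PI * sigma) L' Ht' Hs'). fold z in B.
    (* The strip coordinate is [PI * tau], so the exponent becomes that of the tree edge at time
       [eps * tau]. *)
    replace (eps * (a i - a (nxt i)) / PI * (PI * tau)) with ((a i - a (nxt i)) * (eps * tau)) in B by (field; lra).
    set (e := exp _) in *.
    assert (He : 0 < e) by apply exp_pos.
    assert (He1 : e <= 1). { apply exp_le_1. assert (0 <= (a i - a (nxt i)) * - (eps * tau)) by (apply Rmult_le_pos; lra). lra. }
    set (n0 := Re (strip g z4 delta i (0, PI / 2))) in *.
    assert (B0 : Rabs (n0 - p i0) <= (2 * thick_const + end_const i0) * eps).
    { assert (H1 := end_circle_near_thick i). fold n0 in H1. assert (H2 := thick_near_index_zero).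
      apply Rabs_le_between in H1. apply Rabs_le_between in H2. apply Rabs_le_between. lra. }
    (* The initial value [n0] of the strip is exchanged for the endpoint [p i0] of the edge; the
       factor [e <= 1] does not enlarge the difference. *)
    replace (Re (strip g z4 delta i z) - (p i + (p i0 - p i) * e)) with
      ((Re (strip g z4 delta i z) - p i - (n0 - p i) * e) + (n0 - p i0) * e) by ring.
    assert (T := Rabs_triang (Re (strip g z4 delta i z) - p i - (n0 - p i) * e) ((n0 - p i0) * e)).
    rewrite (Rabs_mult (n0 - p i0) e), (Rabs_pos_eq e) in T by lra.
    assert (Rabs (n0 - p i0) * e <= Rabs (n0 - p i0) * 1) by (apply Rmult_le_compat_l; [apply Rabs_pos | lra]).
    lra.
Qed.

End FixedEps.
End QuadraticData.

Theorem theorem3p2 (f : idx -> R -> R) (a b c : idx -> R)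
    (x : R -> idx -> C) (p : idx -> R)
    (w : R -> C -> C) (z4 : R -> R)
    (l : R) (I : idx -> R -> R) (delta : R) (i0 : idx)
    (Hf : forall i t, f i t = a i / 2 * t ^ 2 + b i * t + c i)
    (Ha : forall i, a i <> a (nxt i))
    (Hx : forall eps i, 0 < eps ->
            lagr (f i) eps (x eps i) /\ lagr (f (nxt i)) eps (x eps i))
    (Hp : forall eps i, 0 < eps -> Re (x eps i) = p i)
    (Hconv : forall eps, 0 < eps -> ccw_convex (x eps))
    (Hw : forall eps, 0 < eps -> schwarz_christoffel (x eps) (w eps) (z4 eps))
    (HI : gradient_tree f p l I)
    (Hdelta : 0 < delta)
    (Hdisj : at_right 0 (fun eps => forall j, j <> i4 -> forall z,
               ~ (Dnear (zpt (z4 eps) i4) delta z /\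
                  Dnear (zpt (z4 eps) j) delta z)))
    (Hi0 : morse_index (dfun f i0 (nxt i0)) (p i0) = 0%nat)
    (Hdeg : (p i3 - p i1) * (p i4 - p i2) = 0) :
  sup_tends_to
    (fun eps r => exists z, Dthick (z4 eps) delta z /\
                            r = Cmod (w eps z - RtoC (p i0))%C) 0
  /\
  (forall i : idx,
    sup_tends_to
      (fun eps r => exists tau sigma, Theta_ext tau sigma /\
         r = Cmod (w eps (phi (zpt (z4 eps) i) delta tau sigma)
                   - RtoC (I i (eps * tau)%R))%C) 0).
Proof.
  assert (Hi0' := morse_index_zero f a b c Hf i0 (nxt i0) (p i0) (Ha i0) Hi0).
  (* These three constants involve only slopes, intercepts and critical points and are fixed before
     [eps], so the final bounds are linear in [eps]. *)
  destruct (idx_upper_bound (fun i k => Rabs (a i * p i + b i - (a k * p i + b k)))) as [M [HM Mb]].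
  destruct (idx_upper_bound (fun i j => Rabs (p j - p i))) as [D [HD Db]].
  destruct (idx_upper_bound (fun i _ => Rabs (a i * p i + b i))) as [V [HV Vb]].
  assert (Near : at_right 0 (fun eps => 0 < eps < 1 /\ forall j, j <> i4 -> forall z,
               ~ (Dnear (zpt (z4 eps) i4) delta z /\ Dnear (zpt (z4 eps) j) delta z))).
  { assert (N1 : at_right 0 (fun eps => 0 < eps < 1)).
    { exists (mkposreal 1 Rlt_0_1). intros y Hy Py. change (Rabs (y - 0) < 1) in Hy.
      apply Rabs_def2 in Hy. lra. }
    exact (filter_and _ _ N1 Hdisj). }
  split.
  - apply sup_tends_to_0_of_linear_bound with (B := 2 * thick_const delta M + end_const a M D i0 + V).
    revert Near. apply filter_imp. intros eps [He Hd]. split.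
    + eexists. exists (0, / delta). split; [ | reflexivity].
      apply (thick_point x (w eps) (z4 eps) eps delta); auto. now apply Hw.
    + intros r [z [Hz ->]]. split. apply Cmod_ge_0.
      apply (thick_estimate f a b c x p Hf Hx Hp Hconv (w eps) (z4 eps) eps delta); auto. now apply Hw.
  - intros i.
    apply sup_tends_to_0_of_linear_bound with (B := 2 * thick_const delta M + end_const a M D i0 + end_const a M D i + V).
    revert Near. apply filter_imp. intros eps [He Hd]. split.
    (* Any point of the end shows that the supremum is over a nonempty set. *)
    + eexists. exists (-1), 0. split; [ | reflexivity]. unfold Theta_ext. lra.
    + intros r [tau [sigma [Hts ->]]]. split. apply Cmod_ge_0.
      apply (end_estimate f a b c x p Hf Hx Hp Hconv (w eps) (z4 eps) eps delta) with (l := l); auto. now apply Hw.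
Qed.
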